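(* Let $(Q,S)$ be any quiver with potential and let $k,\ell\in Q_0$ be distinct vertices such that $k$ is not incident to any $2$-cycle of $Q$. If the indecomposable injective $I_{(Q,S)}(\ell)$ is finite-dimensional, then so is the indecomposable injective $I_{\mu_k(Q,S)}(\ell)$, and the decorated representations $\mu_k(I_{(Q,S)}(\ell),0)$ and $(I_{\mu_k(Q,S)}(\ell),0)$ of the Jacobian algebra $\Lambda(\mu_k(Q,S))$ are isomorphic.
   Context: Quivers $Q=(Q_0,Q_1,h,t)$ are finite and loop-free; an arrow $a$ goes from $t(a)$ to $h(a)$. Paths are composed like functions: in a path $a_1\cdots a_d$ one has $t(a_j)=h(a_{j+1})$. Let $A^d$ be the $\mathbb{C}$-vector space with basis the paths of length $d$ (for $d=0$ the idempotents $e_i$, $i\in Q_0$). The complete path algebra is $\mathbb{C}\langle\langle Q\rangle\rangle=\prod_{d\ge0}A^d$ with multiplication induced by concatenation; $\mathfrak m=\prod_{d\ge1}A^d$, and the topology is $\mathfrak m$-adic. A potential $S$ is an element of $\mathbb{C}\langle\langle Q\rangle\rangle$ all of whose terms are cyclic paths of positive length; a quiver with potential (QP) is a pair $(Q,S)$. For an arrow $a$, $\partial_a(a_1\cdots a_d)=\sum_i\delta_{a,a_i}a_{i+1}\cdots a_da_1\cdots a_{i-1}$, extended linearly and continuously. $J(S)$ is the closure of the two-sided ideal generated by all $\partial_a(S)$; the Jacobian algebra is $\Lambda(Q,S)=\mathbb{C}\langle\langle Q\rangle\rangle/J(S)$ (not assumed finite-dimensional). $I_{(Q,S)}(\ell)$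 denotes the indecomposable injective left $\Lambda(Q,S)$-module at $\ell$, i.e. the injective envelope of the one-dimensional simple module at $\ell$. Two potentials are cyclically equivalent if their difference lies in the closure of the span of all $a_1\cdots a_d-a_2\cdots a_da_1$ with $a_1\cdots a_d$ cyclic. A right-equivalence $(Q,S)\to(Q',S')$ (same vertex set) is an algebra isomorphism $\mathbb{C}\langle\langle Q\rangle\rangle\to\mathbb{C}\langle\langle Q'\rangle\rangle$ fixing all $e_i$ and sending $S$ to a potential cyclically equivalent to $S'$; it induces an isomorphism of Jacobian algebras. $(Q,S)$ is trivial if $S\in A^2$ and the $\partial_a(S)$ span $A^1$; reduced if $S$ has no degree-$2$ component. By the Splitting Theorem every QP is right-equivalent to a direct sum $(Q_{\rm red},S_{\rm red})\oplus(C,T)$ (disjoint union of arrows, sum of potentials) of a reduced QP, its reduced part, and a trivial QP, unique up to right-equivalence; via the right-equivalence and the inclusion $\mathbb{C}\langle\langle Q_{\rm red}\rangle\rangle\to\mathbb{C}\langle\langle Q_{\rm red}\oplus C\rangle\rangle$ one gets $\Lambda(Q_{\rm red},S_{\rm red})\cong\Lambda(Q,S)$. QP mutation at $k$ (not incident to $2$-cycles): a $k$-hook is a path $ab$ of length two with $t(a)=k=h(b)$. $\widetilde\mu_k(Q)$ is obtained from $Q$ by adding an arrow $[ab]:t(b)\to h(a)$ for each $k$-hook and replacing each arrow $c$ incident to $k$ by an opposite arrow $c^*$. Replace $S$ by a cyclically equivalent potential none of whose terms begins at $k$; $[S]$ is obtained by replacing each $k$-hook $ab$ by $[ab]$, and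 $\widetilde\mu_k(S)=[S]+\sum a^*[ab]b^*$ (sum over $k$-hooks). The premutation is $\widetilde\mu_k(Q,S)=(\widetilde\mu_k(Q),\widetilde\mu_k(S))$ and the mutation $\mu_k(Q,S)$ is its reduced part (well defined up to right-equivalence). A decorated representation of $(Q,S)$ is a pair $\mathcal M=(M,\mathbf v)$ with $M$ a finite-dimensional left $\Lambda(Q,S)$-module and $\mathbf v\in\mathbb{Z}_{\ge0}^{Q_0}$; write $M_j=e_jM$ and $a_M:M_{t(a)}\to M_{h(a)}$ for the action of an arrow. Let $a_1,\ldots,a_s$ (resp. $b_1,\ldots,b_r$) be the arrows of $Q$ ending (resp. starting) at $k$, $M_{\rm in}=\bigoplus_iM_{t(a_i)}$, $M_{\rm out}=\bigoplus_jM_{h(b_j)}$, $\alpha=[(a_1)_M\cdots(a_s)_M]:M_{\rm in}\to M_k$, $\beta=[(b_1)_M\cdots(b_r)_M]^T:M_k\to M_{\rm out}$, and $\gamma:M_{\rm out}\to M_{\rm in}$ with entries $\gamma_{i,j}=\partial_{b_ja_i}(S)_M$, where $\partial_{b_ja_i}(S)$ sums, over all occurrences of $b_ja_i$ as consecutive arrows in the cyclic terms of $S$, the complementary path (read cyclically starting right after $b_ja_i$). One has $\alpha\gamma=0$, $\gamma\beta=0$. Define $\overline M_j=M_j$, $\overline v_j=v_j$ for $j\ne k$, $\overline M_k=\operatorname{coker}\beta\oplus\frac{\ker\alpha}{\operatorname{im}\gamma}\oplus\mathbb{C}^{v_k}$, $\overline v_k=\dim\frac{\ker\beta}{\ker\beta\cap\operatorname{im}\alpha}$.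 Arrows of $Q$ not incident to $k$ act as before, $[b_ja_i]$ acts as $(b_j)_M(a_i)_M$, the $a_i^*$ act through $[\overline\gamma\ \ \iota\sigma\ \ 0]:\overline M_k\to M_{\rm in}$, and the $b_j^*$ act through $[-p\ \ 0\ \ 0]^T:M_{\rm out}\to\overline M_k$, where $p:M_{\rm out}\to\operatorname{coker}\beta$ is the projection, $\overline\gamma$ is induced by $\gamma$, $\iota:\ker\alpha\to M_{\rm in}$ is the inclusion, and $\sigma:\ker\alpha/\operatorname{im}\gamma\to\ker\alpha$ is a linear section of the projection. The premutation $\widetilde\mu_k(\mathcal M)=(\overline M,\overline{\mathbf v})$ is a decorated representation of $\widetilde\mu_k(Q,S)$, and $\mu_k(\mathcal M)$ is the decorated representation of $\mu_k(Q,S)$ obtained by restricting the action along $\Lambda(\mu_k(Q,S))\cong\Lambda(\widetilde\mu_k(Q,S))$. Decorated representations $(M,\mathbf v)$, $(M',\mathbf v')$ of the same algebra are isomorphic if $M\cong M'$ as modules and $\mathbf v=\mathbf v'$. *)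

(* Defs.v *)
From HB Require Import structures.
From mathcomp Require Import all_boot all_order all_algebra.
From mathcomp Require Import generic_quotient ring_quotient.
From mathcomp Require Import mathcomp_extra boolp classical_sets functions.

Set Implicit Arguments.
Unset Strict Implicit.
Unset Printing Implicit Defensive.

Import GRing.Theory.

Local Open Scope classical_set_scope.
Local Open Scope ring_scope.
Local Open Scope quotient_scope.

Definition is_submod (R : pzRingType) (U : lmodType R) (A : set U) : Prop :=
  A 0 /\ forall c x y, A x -> A y -> A (c *: x + y).

Record submod (R : pzRingType) (U : lmodType R) := Submod {
  sub_set :> set U;
  submodP : is_submod sub_set }.

Definition submod_pred (R : pzRingType) (U : lmodType R) (A : submod U) :
  {pred U} := fun x => `[< sub_set A x >].

Section SubmodPred.
Variables (R : pzRingType) (U : lmodType R) (A : submod U).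

Lemma submod_pred_closed : GRing.subsemimod_closed (submod_pred A).
Proof.
have [A0 AD] := submodP A; split; first split; first exact/asboolP.
  by move=> x y /asboolP Ax /asboolP Ay; apply/asboolP; rewrite -[x]scale1r; apply: AD.
by move=> c x /asboolP Ax; apply/asboolP; rewrite -[_ *: _]addr0; apply: AD.
Qed.

HB.instance Definition _ :=
  GRing.isSubmodClosed.Build R U (submod_pred A) submod_pred_closed.

Definition sub_of : Type := {x : U | submod_pred A x}.
HB.instance Definition _ := SubChoice.on sub_of.
HB.instance Definition _ := [SubChoice_isSubLmodule of sub_of by <:].

Definition quot_mod : Type := (Quotient.quot (submod_pred A)).
HB.instance Definition _ := GRing.Zmodule.on quot_mod.
HB.instance Definition _ : EqQuotient U _ quot_mod := EqQuotient.on quot_mod.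

Definition mod_pi (x : U) : quot_mod := \pi_quot_mod x.

Lemma mod_piK (x : quot_mod) : mod_pi (repr x) = x.
Proof. exact: reprK. Qed.

Lemma mod_piE (x y : U) : mod_pi x = mod_pi y <-> sub_set A (x - y).
Proof.
split=> [/eqP|Axy]; last by apply/eqP; rewrite -Quotient.idealrBE; apply/asboolP.
by rewrite -Quotient.idealrBE => /asboolP.
Qed.

Fact mod_pi_zmod : zmod_morphism mod_pi.
Proof. exact: (raddfB (\pi_(Quotient.quot (submod_pred A)))). Qed.
HB.instance Definition _ := GRing.isZmodMorphism.Build U quot_mod mod_pi mod_pi_zmod.

Definition quot_scale (c : R) (x : quot_mod) : quot_mod := mod_pi (c *: repr x).

Lemma quot_scale_pi c x : quot_scale c (mod_pi x) = mod_pi (c *: x).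
Proof.
apply/mod_piE; rewrite -scalerBr -[_ *: _]addr0.
have [A0 AD] := submodP A; apply: (AD) => //.
by apply/mod_piE; rewrite mod_piK.
Qed.

Fact quot_scaleA a b x : quot_scale a (quot_scale b x) = quot_scale (a * b) x.
Proof. by rewrite -[x]mod_piK !quot_scale_pi scalerA. Qed.
Fact quot_scale1 : left_id 1 quot_scale.
Proof. by move=> x; rewrite -[x]mod_piK quot_scale_pi scale1r. Qed.
Fact quot_scaleDr : right_distributive quot_scale +%R.
Proof.
move=> c x y; rewrite -[x]mod_piK -[y]mod_piK -raddfD !quot_scale_pi.
by rewrite scalerDr raddfD.
Qed.
Fact quot_scaleDl x : {morph quot_scale^~ x : a b / a + b}.
Proof. by move=> a b /=; rewrite -[x]mod_piK !quot_scale_pi scalerDl raddfD. Qed.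

HB.instance Definition _ := GRing.Zmodule_isLmodule.Build R quot_mod
  quot_scaleA quot_scale1 quot_scaleDr quot_scaleDl.

End SubmodPred.

(* A / (A `&` B) for two submodules A and B of U.                             *)
Section Subquotient.
Variables (R : pzRingType) (U : lmodType R) (A B : submod U).

Fact restrict_submod_subproof : is_submod [set x : sub_of A | sub_set B (val x)].
Proof. by have [B0 BD] := submodP B; split=> // c x y Bx By; apply: BD. Qed.
Definition restrict_submod : submod (sub_of A) := Submod restrict_submod_subproof.

Definition subquot : lmodType R := quot_mod restrict_submod.

(* The class of u modulo B; only meaningful for u in A.                       *)
Definition subquot_class (u : U) : subquot :=
  mod_pi restrict_submod (insubd (0 : sub_of A) u).

Definition subquot_repr (c : subquot) : U :=
  val (repr (c : quot_mod restrict_submod)).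

End Subquotient.

Section KernelImage.
Variables (R : pzRingType) (U W : lmodType R) (f : {linear U -> W}) (A : submod U).

Fact ker_submod_subproof : is_submod [set x | sub_set A x /\ f x = 0].
Proof.
have [A0 AD] := submodP A; split; first by split=> //; rewrite linear0.
by move=> c x y [Ax fx] [Ay fy]; split; [exact: AD | rewrite linearP fx fy scaler0 addr0].
Qed.
Definition ker_submod : submod U := Submod ker_submod_subproof.

Fact im_submod_subproof : is_submod (f @` A).
Proof.
have [A0 AD] := submodP A; split; first by exists 0 => //; rewrite linear0.
move=> c _ _ [x Ax <-] [y Ay <-]; exists (c *: x + y); first exact: AD.
by rewrite linearP.
Qed.
Definition im_submod : submod W := Submod im_submod_subproof.
End KernelImage.

Definition two_sided_ideal (A : pzRingType) (I : set A) : Prop :=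
  [/\ I 0, forall x y, I x -> I y -> I (x - y),
      forall a x, I x -> I (a * x) & forall a x, I x -> I (x * a)].

Record ideal2 (A : pzRingType) := Ideal2 {
  ideal_set :> set A;
  ideal2P : two_sided_ideal ideal_set }.

Definition ideal_pred (A : pzRingType) (I : ideal2 A) : {pred A} :=
  fun x => `[< ideal_set I x >].

Section QuotientRing.
Variables (A : pzRingType) (I : ideal2 A).

Fact ideal_pred_closed : zmod_closed (ideal_pred I).
Proof.
have [I0 IB _ _] := ideal2P I; split; first exact/asboolP.
by move=> x y /asboolP Ix /asboolP Iy; apply/asboolP; apply: IB.
Qed.
HB.instance Definition _ :=
  GRing.isZmodClosed.Build A (ideal_pred I) ideal_pred_closed.

Definition quot_ring : Type := (Quotient.quot (ideal_pred I)).
HB.instance Definition _ := GRing.Zmodule.on quot_ring.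
HB.instance Definition _ : EqQuotient A _ quot_ring := EqQuotient.on quot_ring.

Definition quot_pi (x : A) : quot_ring := \pi_quot_ring x.

Lemma quot_piK (x : quot_ring) : quot_pi (repr x) = x.
Proof. exact: reprK. Qed.

Lemma quot_piE (x y : A) : quot_pi x = quot_pi y <-> ideal_set I (x - y).
Proof.
split=> [/eqP|Axy]; last by apply/eqP; rewrite -Quotient.idealrBE; apply/asboolP.
by rewrite -Quotient.idealrBE => /asboolP.
Qed.

Fact quot_pi_zmod : zmod_morphism quot_pi.
Proof. exact: (raddfB (\pi_(Quotient.quot (ideal_pred I)))). Qed.
HB.instance Definition _ := GRing.isZmodMorphism.Build A quot_ring quot_pi quot_pi_zmod.

Definition quot_one : quot_ring := quot_pi 1.
Definition quot_mul (x y : quot_ring) : quot_ring := quot_pi (repr x * repr y).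

Lemma quot_mul_pi x y : quot_mul (quot_pi x) (quot_pi y) = quot_pi (x * y).
Proof.
have [I0 IB IMl IMr] := ideal2P I; apply/quot_piE.
set x' := repr _; set y' := repr _.
have Ix : ideal_set I (x - x') by apply/quot_piE; rewrite quot_piK.
have Iy : ideal_set I (y' - y) by apply/quot_piE; rewrite quot_piK.
have -> : x' * y' - x * y = x' * (y' - y) - (x - x') * y.
  by rewrite mulrBr mulrBl opprB addrA subrK.
by apply: IB; [exact: IMl | exact: IMr].
Qed.

Fact quot_mulA : associative quot_mul.
Proof.
by move=> x y z; rewrite -[x]quot_piK -[y]quot_piK -[z]quot_piK !quot_mul_pi mulrA.
Qed.
Fact quot_mul1l : left_id quot_one quot_mul.
Proof. by move=> x; rewrite -[x]quot_piK quot_mul_pi mul1r. Qed.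
Fact quot_mul1r : right_id quot_one quot_mul.
Proof. by move=> x; rewrite -[x]quot_piK quot_mul_pi mulr1. Qed.
Fact quot_mulDl : left_distributive quot_mul +%R.
Proof.
move=> x y z; rewrite -[x]quot_piK -[y]quot_piK -[z]quot_piK -raddfD !quot_mul_pi.
by rewrite mulrDl raddfD.
Qed.
Fact quot_mulDr : right_distributive quot_mul +%R.
Proof.
move=> x y z; rewrite -[x]quot_piK -[y]quot_piK -[z]quot_piK -raddfD !quot_mul_pi.
by rewrite mulrDr raddfD.
Qed.

HB.instance Definition _ := GRing.Zmodule_isPzRing.Build quot_ring
  quot_mulA quot_mul1l quot_mul1r quot_mulDl quot_mulDr.

Fact quot_pi_monoid : monoid_morphism quot_pi.
Proof. by split=> // x y; rewrite -quot_mul_pi. Qed.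
HB.instance Definition _ :=
  GRing.isMonoidMorphism.Build A quot_ring quot_pi quot_pi_monoid.

End QuotientRing.

Definition restr (A B : pzRingType) (f : {rmorphism A -> B}) (M : lmodType B) :
  Type := M.

Section RestrictScalars.
Variables (A B : pzRingType) (f : {rmorphism A -> B}) (M : lmodType B).
Local Notation restr := (restr f M).

HB.instance Definition _ := GRing.Zmodule.on restr.

Definition restr_scale (a : A) (m : restr) : restr := f a *: (m : M).
Fact restr_scaleA a b m : restr_scale a (restr_scale b m) = restr_scale (a * b) m.
Proof. by rewrite /restr_scale scalerA rmorphM. Qed.
Fact restr_scale1 : left_id 1 restr_scale.
Proof. by move=> m; rewrite /restr_scale rmorph1 scale1r. Qed.
Fact restr_scaleDr : right_distributive restr_scale +%R.
Proof. by move=> a m n; rewrite /restr_scale scalerDr. Qed.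
Fact restr_scaleDl m : {morph restr_scale^~ m : a b / a + b}.
Proof. by move=> a b; rewrite /restr_scale rmorphD scalerDl. Qed.
HB.instance Definition _ := GRing.Zmodule_isLmodule.Build A restr
  restr_scaleA restr_scale1 restr_scaleDr restr_scaleDl.
End RestrictScalars.

Definition has_dim (F : fieldType) (U : lmodType F) (n : nat) : Prop :=
  exists f : {linear 'rV[F]_n -> U}, bijective f.

Definition finite_dim (F : fieldType) (U : lmodType F) : Prop :=
  exists n, has_dim U n.

(* The dimension of a finite-dimensional space (0 for the other ones).        *)
Definition dimension (F : fieldType) (U : lmodType F) : nat :=
  xget 0%N [set n | has_dim U n].

Definition injective_module (A : pzRingType) (I : lmodType A) : Prop :=
  forall (X Y : lmodType A) (i : {linear X -> Y}) (g : {linear X -> I}),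
    injective i -> exists h : {linear Y -> I}, forall x, h (i x) = g x.

Definition essential_mono (A : pzRingType) (E I : lmodType A)
    (i : {linear E -> I}) : Prop :=
  injective i /\
  forall P : set I, is_submod P -> (exists2 x, P x & x != 0) ->
    exists2 e, P (i e) & i e != 0.

Definition injective_envelope (A : pzRingType) (E I : lmodType A) : Prop :=
  injective_module I /\ exists i : {linear E -> I}, essential_mono i.

Record quiver (V : finType) := Quiver {
  arrow :> finType;
  hd : arrow -> V;
  tl : arrow -> V }.

Section Paths.
Variables (V : finType) (Q : quiver V).

Definition loop_free : Prop := forall a : Q, hd a != tl a.

Definition in_2cycle (k : V) : Prop :=
  exists a b : Q, [/\ tl a = k, hd a = tl b & hd b = k].

(* A path a_1 ... a_d is encoded by the pair (h(a_1), [:: a_1; ...; a_d]),    *)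
(* and the path of length 0 at i by (i, [::]).                                *)
Fixpoint is_path (v : V) (s : seq Q) : bool :=
  if s is a :: s' then (hd a == v) && is_path (tl a) s' else true.

Definition word_tl (v : V) (s : seq Q) : V := last v (map (@tl V Q) s).

Definition qpath : Type := {p : V * seq Q | is_path p.1 p.2}.
HB.instance Definition _ := SubEquality.on qpath.

Definition path_hd (p : qpath) : V := (val p).1.
Definition path_word (p : qpath) : seq Q := (val p).2.
Definition path_tl (p : qpath) : V := word_tl (path_hd p) (path_word p).
Definition path_len (p : qpath) : nat := size (path_word p).

Lemma is_path_cat v s t :
  is_path v (s ++ t) = is_path v s && is_path (word_tl v s) t.
Proof. by elim: s v => //= a s IH v; rewrite IH andbA. Qed.

Lemma word_tl_cat v s t : word_tl v (s ++ t) = word_tl (word_tl v s) t.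
Proof. by rewrite /word_tl map_cat last_cat. Qed.

End Paths.

(* Since Q is finite, a family (x_d) with x_d in A^d for all d is the same    *)
(* thing as an arbitrary function from the set of all paths to F.             *)
Record cpalg (F : fieldType) (V : finType) (Q : quiver V) := Cpalg {
  coef : qpath Q -> F }.
HB.instance Definition _ F V Q := gen_eqMixin (@cpalg F V Q).
HB.instance Definition _ F V Q := gen_choiceMixin (@cpalg F V Q).

Section PathAlgebra.
Variables (F : fieldType) (V : finType) (Q : quiver V).
Implicit Types (x y z : cpalg F Q) (v : V) (s : seq Q).

(* coefficient of a word, 0 if it is not a path                               *)
Definition wcoef x v s : F := if insub (v, s) is Some p then coef x p else 0.

Definition of_wcoef (f : V -> seq Q -> F) : cpalg F Q :=
  Cpalg (fun p => f (path_hd p) (path_word p)).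

Lemma cpalgP x y : (forall p, coef x p = coef y p) -> x = y.
Proof. by case: x y => [f] [g] /= fg; congr Cpalg; apply/funext. Qed.

Lemma wcoefE x v s (p : is_path v s) : wcoef x v s = coef x (exist _ (v, s) p).
Proof.
rewrite /wcoef insubT /=; congr (coef x _); exact/val_inj.
Qed.

Lemma wcoef_out x v s : ~~ is_path v s -> wcoef x v s = 0.
Proof. by move=> np; rewrite /wcoef insubN. Qed.

Lemma coefE x (p : qpath Q) : coef x p = wcoef x (path_hd p) (path_word p).
Proof. by case: p => [[v s] /= p]; rewrite (wcoefE _ p). Qed.

Lemma wcoefP x y : (forall v s, wcoef x v s = wcoef y v s) -> x = y.
Proof. by move=> xy; apply: cpalgP => p; rewrite !coefE. Qed.

Lemma wcoef_of f v s : wcoef (of_wcoef f) v s = if is_path v s then f v s else 0.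
Proof.
by have [p|np] := boolP (is_path v s); [rewrite (wcoefE _ p) | rewrite wcoef_out].
Qed.

Definition cp_zero : cpalg F Q := Cpalg (fun=> 0).
Definition cp_opp x := Cpalg (fun p => - coef x p).
Definition cp_add x y := Cpalg (fun p => coef x p + coef y p).
Definition cp_scale (c : F) x := Cpalg (fun p => c * coef x p).

Fact cp_addA : associative cp_add.
Proof. by move=> x y z; apply: cpalgP => p; rewrite /= addrA. Qed.
Fact cp_addC : commutative cp_add.
Proof. by move=> x y; apply: cpalgP => p; rewrite /= addrC. Qed.
Fact cp_add0 : left_id cp_zero cp_add.
Proof. by move=> x; apply: cpalgP => p; rewrite /= add0r. Qed.
Fact cp_addN : left_inverse cp_zero cp_opp cp_add.
Proof. by move=> x; apply: cpalgP => p; rewrite /= addNr. Qed.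
HB.instance Definition _ :=
  GRing.isZmodule.Build (cpalg F Q) cp_addA cp_addC cp_add0 cp_addN.

Fact cp_scaleA a b x : cp_scale a (cp_scale b x) = cp_scale (a * b) x.
Proof. by apply: cpalgP => p; rewrite /= mulrA. Qed.
Fact cp_scale1 : left_id 1 cp_scale.
Proof. by move=> x; apply: cpalgP => p; rewrite /= mul1r. Qed.
Fact cp_scaleDr : right_distributive cp_scale +%R.
Proof. by move=> a x y; apply: cpalgP => p; rewrite /= mulrDr. Qed.
Fact cp_scaleDl x : {morph cp_scale^~ x : a b / a + b}.
Proof. by move=> a b; apply: cpalgP => p; rewrite /= mulrDl. Qed.
HB.instance Definition _ := GRing.Zmodule_isLmodule.Build F (cpalg F Q)
  cp_scaleA cp_scale1 cp_scaleDr cp_scaleDl.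

(* The product on formal sums of paths induced by concatenation: the sum      *)
(* below runs over all factorisations of the path (v, s) as a product.        *)
Definition cp_one : cpalg F Q := of_wcoef (fun _ s => (nilp s)%:R).
Definition cp_mul x y : cpalg F Q := of_wcoef (fun v s =>
  \sum_(i < (size s).+1)
    wcoef x v (take i s) * wcoef y (word_tl v (take i s)) (drop i s)).

Lemma wcoefD x y v s : wcoef (x + y) v s = wcoef x v s + wcoef y v s.
Proof. by rewrite /wcoef; case: insub => //=; rewrite addr0. Qed.

Lemma wcoefM x y v s : wcoef (cp_mul x y) v s =
  \sum_(i < (size s).+1)
    wcoef x v (take i s) * wcoef y (word_tl v (take i s)) (drop i s).
Proof.
rewrite wcoef_of; case: ifPn => // np; rewrite big1 // => i _.
move: np; rewrite -{1}(cat_take_drop i s) is_path_cat negb_and.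
by case/orP => np; rewrite (wcoef_out _ np) ?mul0r ?mulr0.
Qed.

Lemma wcoef1 v s : wcoef cp_one v s = (nilp s)%:R.
Proof. by rewrite wcoef_of; case: s => //= a s; case: ifP. Qed.

Fact cp_mulA : associative cp_mul.
Proof.
move=> x y z; apply: wcoefP => v s; rewrite !wcoefM.
under eq_bigr => i _ do rewrite wcoefM mulr_sumr.
under [RHS]eq_bigr => i _ do rewrite wcoefM mulr_suml.
pose G i j := wcoef x v (take i s) *
  (wcoef y (word_tl v (take i s)) (drop i (take j s)) *
   wcoef z (word_tl v (take j s)) (drop j s)).
transitivity (\sum_(i < (size s).+1) \sum_(j < (size s).+1 | (i <= j)%N) G i j).
  apply: eq_bigr => i _; have le_i : (i <= size s)%N by rewrite -ltnS.
  rewrite -(big_mkord (fun j => (i <= j)%N) (G i)).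
  rewrite (big_cat_nat (n := i)) ?leqW //=.
  rewrite [X in _ = X + _]big_nat_cond [X in _ = X + _]big1 ?add0r; last first.
    by move=> j /andP[/andP[_ ji] ij]; rewrite leqNgt ji in ij.
  rewrite -[X in \big[_/_]_(X <= _ < _ | _) _]add0n big_addn subSn //.
  rewrite big_mkord size_drop.
  apply: eq_big => j; first by rewrite leq_addl.
  by move=> _; rewrite /G -take_drop drop_drop addnC takeD word_tl_cat [(i + j)%N]addnC.
rewrite (exchange_big_dep xpredT) //=; apply: eq_bigr => j _.
have le_j : (j <= size s)%N by rewrite -ltnS.
rewrite -(big_mkord (fun i => (i <= j)%N) (G^~ j)).
rewrite (big_cat_nat (n := j.+1)) //=.
rewrite [X in _ + X]big_nat_cond [X in _ + X]big1 ?addr0; last first.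
  by move=> i /andP[/andP[ji _] ij]; rewrite leqNgt ji in ij.
rewrite big_mkord size_takel //; apply: eq_big => [i|i ij]; first by rewrite -ltnS ltn_ord.
by rewrite /G take_takel // mulrA.
Qed.

Fact cp_mul1l : left_id cp_one cp_mul.
Proof.
move=> x; apply: wcoefP => v s; rewrite wcoefM big_ord_recl /= take0 drop0 wcoef1 mul1r.
rewrite big1 ?addr0 // => i _; rewrite wcoef1.
by case: s i => [[]|a s i] //; rewrite mul0r.
Qed.
Fact cp_mul1r : right_id cp_one cp_mul.
Proof.
move=> x; apply: wcoefP => v s; rewrite wcoefM big_ord_recr /= wcoef1.
rewrite take_size drop_size mulr1 big1 ?add0r // => i _; rewrite wcoef1.
by rewrite /nilp size_drop subn_eq0 leqNgt ltn_ord mulr0.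
Qed.
Fact cp_mulDl : left_distributive cp_mul +%R.
Proof.
move=> x y z; apply: wcoefP => v s; rewrite wcoefD !wcoefM -big_split.
by apply: eq_bigr => i _; rewrite wcoefD mulrDl.
Qed.
Fact cp_mulDr : right_distributive cp_mul +%R.
Proof.
move=> x y z; apply: wcoefP => v s; rewrite wcoefD !wcoefM -big_split.
by apply: eq_bigr => i _; rewrite wcoefD mulrDr.
Qed.
HB.instance Definition _ := GRing.Zmodule_isPzRing.Build (cpalg F Q)
  cp_mulA cp_mul1l cp_mul1r cp_mulDl cp_mulDr.

End PathAlgebra.

Section Potentials.
Variables (F : fieldType) (V : finType) (Q : quiver V).
Local Notation A := (cpalg F Q).
Implicit Types (x y z S T : A) (p q : qpath Q) (a b : Q).

Definition vtx (i : V) : A := of_wcoef (fun v s => ((v == i) && nilp s)%:R).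
Definition arr (a : Q) : A := of_wcoef (fun _ s => (s == [:: a])%:R).
Definition pth (p : qpath Q) : A := Cpalg (fun q => (q == p)%:R).

(* Closure for the m-adic topology: m^d is the set of the elements all of     *)
(* whose terms have length at least d.                                        *)
Definition madic_closure (X : set A) : set A :=
  [set x | forall d, exists2 y, X y &
    forall p, (path_len p < d)%N -> coef x p = coef y p].

Definition linear_span (X : set A) : set A :=
  [set z | forall W : set A, is_submod W -> X `<=` W -> W z].

Definition ideal_span (X : set A) : set A :=
  [set z | forall I : set A, two_sided_ideal I -> X `<=` I -> I z].

Definition homogeneous (d : nat) x : Prop :=
  forall p, coef x p != 0 -> path_len p = d.

Definition potential S : Prop :=
  forall p, coef S p != 0 -> (0 < path_len p)%N /\ path_hd p = path_tl p.

Definition is_QP S : Prop := loop_free Q /\ potential S.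

Definition reduced S : Prop := forall p, path_len p = 2 -> coef S p = 0.

(* a_1 = a and a_2 ... a_d = p, where a p is a cyclic path                    *)
Definition cyclic_relations : set A :=
  [set z | exists a p, [/\ path_hd p = tl a, path_tl p = hd a &
                          z = arr a * pth p - pth p * arr a]].

Definition cyc_equiv S T : Prop :=
  madic_closure (linear_span cyclic_relations) (S - T).

(* The coefficient of a path p in the cyclic derivative is the sum of the     *)
(* coefficients in S of all the cyclic paths c1 a c2 with c2 c1 = p.          *)
Definition cderiv (a : Q) S : A := of_wcoef (fun v s =>
  \sum_(i < (size s).+1)
    wcoef S (word_tl v (take i s)) (drop i s ++ a :: take i s)).

(* Same thing for the path b a of length 2, with tl b = hd a: the coefficient *)
(* of p collects the terms c1 b a c2 of S with c2 c1 = p, and the term a p b, *)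
(* in which b a occurs cyclically.                                            *)
Definition cderiv2 (b a : Q) S : A := of_wcoef (fun v s =>
  \sum_(i < (size s).+1)
    wcoef S (word_tl v (take i s)) (drop i s ++ [:: b, a & take i s])
  + wcoef S (hd a) (a :: rcons s b)).

Definition trivial_QP T : Prop :=
  homogeneous 2 T /\
  forall x, homogeneous 1 x <->
    exists c : {ffun Q -> F}, x = \sum_a c a *: cderiv a T.

Fact ideal_span_ideal (X : set A) : two_sided_ideal (ideal_span X).
Proof.
split.
- by move=> I [].
- by move=> x y Ix Iy I II XI; have [_ IB _ _] := II; apply: IB; [exact: Ix|exact: Iy].
- by move=> a x Ix I II XI; have [_ _ IM _] := II; apply: IM; exact: Ix.
by move=> a x Ix I II XI; have [_ _ _ IM] := II; apply: IM; exact: Ix.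
Qed.

Fact madic_closure_ideal (I : set A) :
  two_sided_ideal I -> two_sided_ideal (madic_closure I).
Proof.
case=> I0 IB IMl IMr; have agree d x y :
    (forall p, (path_len p < d)%N -> coef x p = coef y p) ->
    forall v s, (size s < d)%N -> wcoef x v s = wcoef y v s.
  move=> xy v s sd; have [p|np] := boolP (is_path v s); last by rewrite !wcoef_out.
  by rewrite !(wcoefE _ p) xy.
split.
- by move=> d; exists 0.
- move=> x y cx cy d; have [x' Ix xx'] := cx d; have [y' Iy yy'] := cy d.
  by exists (x' - y'); [exact: IB | move=> p pd /=; rewrite xx' // yy'].
- move=> a x cx d; have [x' Ix /agree xx'] := cx d.
  exists (a * x'); first exact: IMl.
  move=> p pd; rewrite !coefE !wcoefM; apply: eq_bigr => i _.
  by rewrite xx' // (leq_ltn_trans _ pd) // size_drop leq_subr.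
- move=> a x cx d; have [x' Ix /agree xx'] := cx d.
  exists (x' * a); first exact: IMr.
  move=> p pd; rewrite !coefE !wcoefM; apply: eq_bigr => i _.
  by rewrite xx' // (leq_ltn_trans _ pd) // size_take_min geq_minr.
Qed.

Definition jac_ideal S : ideal2 A :=
  Ideal2 (madic_closure_ideal (ideal_span_ideal [set cderiv a S | a in [set: Q]])).

Definition jacobian S : pzRingType := quot_ring (jac_ideal S).

Definition jac S : {rmorphism A -> jacobian S} := @quot_pi _ (jac_ideal S).

Lemma wcoefZ c x v s : wcoef (c *: x) v s = c * wcoef x v s.
Proof. by rewrite /wcoef; case: insub => //=; rewrite mulr0. Qed.

Lemma cp_scalerAl c x y : c *: (x * y) = (c *: x) * y.
Proof.
apply: wcoefP => v s; rewrite wcoefZ !wcoefM mulr_sumr.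
by apply: eq_bigr => i _; rewrite wcoefZ mulrA.
Qed.
Lemma cp_scalerAr c x y : c *: (x * y) = x * (c *: y).
Proof.
apply: wcoefP => v s; rewrite wcoefZ !wcoefM mulr_sumr.
by apply: eq_bigr => i _; rewrite wcoefZ mulrCA.
Qed.

Definition cp_const (c : F) : A := c *: (1 : A).
Fact cp_const_zmod : zmod_morphism cp_const.
Proof. by move=> c d; rewrite /cp_const scalerBl. Qed.
Fact cp_const_monoid : monoid_morphism cp_const.
Proof.
split; first exact: scale1r.
by move=> c d; rewrite /cp_const -cp_scalerAl mul1r scalerA.
Qed.
HB.instance Definition _ := GRing.isZmodMorphism.Build F A cp_const cp_const_zmod.
HB.instance Definition _ := GRing.isMonoidMorphism.Build F A cp_const cp_const_monoid.

Definition vspace_of S (M : lmodType (jacobian S)) : lmodType F :=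
  restr (jac S \o cp_const) M.

Definition act S (M : lmodType (jacobian S)) (x : A) (m : vspace_of M) :
  vspace_of M := jac S x *: (m : M).

Section Act.
Variables (S : A) (M : lmodType (jacobian S)).

Fact act_linear x : linear (@act S M x).
Proof.
move=> c m n; rewrite /act.
have -> : (c *: m + n : vspace_of M) = jac S (cp_const c) *: (m : M) + n by [].
rewrite scalerDr scalerA -rmorphM; congr (_ + _).
by rewrite /cp_const -cp_scalerAr mulr1 -[x in LHS]mul1r cp_scalerAl rmorphM -scalerA.
Qed.
HB.instance Definition _ x := GRing.isLinear.Build F (vspace_of M) (vspace_of M) _
  (@act S M x) (act_linear x).

Fact at_vertex_subproof (i : V) :
  is_submod [set m : vspace_of M | act (vtx i) m = m].
Proof.
split; first exact: linear0.
by move=> c m n /= em en; rewrite act_linear em en.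
Qed.
Definition at_vertex (i : V) : submod (vspace_of M) := Submod (at_vertex_subproof i).

End Act.

Record decrep S := DecRep {
  dmod :> lmodType (jacobian S);
  dmod_fin : finite_dim (vspace_of dmod);
  ddec : V -> nat }.

Definition decrep_iso S (M N : decrep S) : Prop :=
  (exists f : {linear dmod M -> dmod N}, bijective f) /\ ddec M =1 ddec N.

(* The one-dimensional module on which x acts through its coefficient at e_l. *)
Definition simple_at S (l : V) (E : lmodType (jacobian S)) : Prop :=
  exists2 f : {linear vspace_of E -> F^o}, bijective f &
    forall x (e : vspace_of E), f (act x e) = wcoef x l [::] * f e.

Definition indec_injective S (l : V) (I : lmodType (jacobian S)) : Prop :=
  exists2 E : lmodType (jacobian S), simple_at l E & injective_envelope E I.

End Potentials.

Section RightEquivalence.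
Variables (F : fieldType) (V : finType).

Definition right_equivalence (Q Q' : quiver V) (S : cpalg F Q) (S' : cpalg F Q')
    (phi : {rmorphism cpalg F Q -> cpalg F Q'}) : Prop :=
  [/\ bijective phi, scalable phi, forall i, phi (vtx F Q i) = vtx F Q' i,
      potential (phi S) & cyc_equiv (phi S) S'].

Variables Q C : quiver V.

Definition sum_quiver : quiver V := @Quiver V (Q + C)%type
  (fun a => match a with inl a => hd a | inr c => hd c end)
  (fun a => match a with inl a => tl a | inr c => tl c end).

Definition left_arrow (a : sum_quiver) : option Q :=
  if a is inl a then Some a else None.
Definition right_arrow (a : sum_quiver) : option C :=
  if a is inr c then Some c else None.

Definition sum_inl (x : cpalg F Q) : cpalg F sum_quiver := of_wcoef (fun v s =>
  if all left_arrow s then wcoef x v (pmap left_arrow s) else 0).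
Definition sum_inr (x : cpalg F C) : cpalg F sum_quiver := of_wcoef (fun v s =>
  if all right_arrow s then wcoef x v (pmap right_arrow s) else 0).

End RightEquivalence.

Section QPMutation.
Variables (F : fieldType) (V : finType) (Q : quiver V) (k : V).

Definition in_arrow : finType := {a : Q | hd a == k}.
Definition out_arrow : finType := {b : Q | tl b == k}.
Definition old_arrow : finType := {c : Q | (hd c != k) && (tl c != k)}.

(* Arrows of the premutation: arrows c not incident to k, arrows [b a] for    *)
(* all k-hooks b a, arrows a^* and b^*.                                       *)
Definition premut_arrow : finType :=
  (old_arrow + out_arrow * in_arrow + (in_arrow + out_arrow))%type.

Definition premut_hd (c : premut_arrow) : V :=
  match c with
  | inl (inl c) => hd (val c)
  | inl (inr (b, a)) => hd (val b)
  | inr (inl a) => tl (val a)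
  | inr (inr b) => k
  end.

Definition premut_tl (c : premut_arrow) : V :=
  match c with
  | inl (inl c) => tl (val c)
  | inl (inr (b, a)) => tl (val a)
  | inr (inl a) => k
  | inr (inr b) => hd (val b)
  end.

Definition premut_quiver : quiver V := Quiver premut_hd premut_tl.

Definition p_old (c : old_arrow) : premut_quiver := inl (inl c).
Definition p_hook (b : out_arrow) (a : in_arrow) : premut_quiver := inl (inr (b, a)).
Definition p_star_in (a : in_arrow) : premut_quiver := inr (inl a).
Definition p_star_out (b : out_arrow) : premut_quiver := inr (inr b).

Definition is_star (c : premut_quiver) : bool := if c is inr _ then true else false.

Definition expand (c : premut_quiver) : seq Q :=
  match c with
  | inl (inl c) => [:: val c]
  | inl (inr (b, a)) => [:: val b; val a]
  | inr _ => [::]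
  end.

(* [S]: the path of the premutated quiver obtained by bracketing the k-hooks  *)
(* of a path w is the unique star-free one whose expansion is w.              *)
Definition bracket (S : cpalg F Q) : cpalg F premut_quiver := of_wcoef (fun v s =>
  if has is_star s then 0 else wcoef S v (flatten (map expand s))).

Definition premut_pot (S : cpalg F Q) : cpalg F premut_quiver :=
  bracket S + \sum_(b : out_arrow) \sum_(a : in_arrow)
    arr F (p_star_out b) * arr F (p_hook b a) * arr F (p_star_in a).

(* All the choices involved in the mutation of (Q, S) at k: a potential S0    *)
(* cyclically equivalent to S without terms beginning at k, and a             *)
(* right-equivalence of the premutation with the sum of a reduced QP, which   *)
(* is the mutation, and of a trivial one.                                     *)
Record QPmutation (S : cpalg F Q) := {
  mu_norm : cpalg F Q;
  mu_quiver : quiver V;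
  mu_pot : cpalg F mu_quiver;
  mu_trivial_quiver : quiver V;
  mu_trivial_pot : cpalg F mu_trivial_quiver;
  mu_phi : {rmorphism cpalg F premut_quiver ->
                      cpalg F (sum_quiver mu_quiver mu_trivial_quiver)};
  mu_norm_potential : potential mu_norm;
  mu_norm_equiv : cyc_equiv S mu_norm;
  mu_norm_hd : forall p, coef mu_norm p != 0 -> path_hd p <> k;
  mu_QP : is_QP mu_pot;
  mu_reduced : reduced mu_pot;
  mu_trivial_is_QP : is_QP mu_trivial_pot;
  mu_trivial : trivial_QP mu_trivial_pot;
  mu_right_equivalence : right_equivalence (premut_pot mu_norm)
    (sum_inl mu_trivial_quiver mu_pot + sum_inr mu_quiver mu_trivial_pot) mu_phi }.

End QPMutation.

Section DecrepMutation.
Variables (F : fieldType) (V : finType) (Q : quiver V) (S : cpalg F Q) (k : V).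
Variable M : decrep S.
Local Notation M_ := (vspace_of M).
Local Notation inQ := (in_arrow Q k).
Local Notation outQ := (out_arrow Q k).

(* M_in and M_out, as subspaces of the families of elements of M.             *)
Fact M_in_subproof :
  is_submod [set x : {ffun inQ -> M_} | forall a, sub_set (at_vertex M (tl (val a))) (x a)].
Proof.
split=> [a|c x y xP yP a]; first by rewrite ffunE; exact: (submodP _).1.
by rewrite !ffunE; apply: (submodP (at_vertex M _)).2.
Qed.
Definition M_in : submod {ffun inQ -> M_} := Submod M_in_subproof.

Fact M_out_subproof :
  is_submod [set y : {ffun outQ -> M_} | forall b, sub_set (at_vertex M (hd (val b))) (y b)].
Proof.
split=> [a|c x y xP yP a]; first by rewrite ffunE; exact: (submodP _).1.
by rewrite !ffunE; apply: (submodP (at_vertex M _)).2.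
Qed.
Definition M_out : submod {ffun outQ -> M_} := Submod M_out_subproof.

Definition alpha (x : {ffun inQ -> M_}) : M_ := \sum_a act (arr F (val a)) (x a).
Definition beta (m : M_) : {ffun outQ -> M_} := [ffun b => act (arr F (val b)) m].
Definition gamma (y : {ffun outQ -> M_}) : {ffun inQ -> M_} :=
  [ffun a => \sum_b act (cderiv2 (val b) (val a) S) (y b)].

Fact alpha_linear : linear alpha.
Proof.
move=> c x y; rewrite /alpha scaler_sumr -big_split; apply: eq_bigr => a _.
by rewrite !ffunE linearP.
Qed.
HB.instance Definition _ :=
  GRing.isLinear.Build F {ffun inQ -> M_} M_ _ alpha alpha_linear.

Fact beta_linear : linear beta.
Proof. by move=> c x y; apply/ffunP => b; rewrite !ffunE linearP. Qed.
HB.instance Definition _ :=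
  GRing.isLinear.Build F M_ {ffun outQ -> M_} _ beta beta_linear.

Fact gamma_linear : linear gamma.
Proof.
move=> c x y; apply/ffunP => a; rewrite !ffunE scaler_sumr -big_split.
by apply: eq_bigr => b _; rewrite !ffunE linearP.
Qed.
HB.instance Definition _ :=
  GRing.isLinear.Build F {ffun outQ -> M_} {ffun inQ -> M_} _ gamma gamma_linear.

Definition ker_alpha := ker_submod alpha M_in.
Definition im_alpha := im_submod alpha M_in.
Definition ker_beta := ker_submod beta (at_vertex M k).
Definition im_beta := im_submod beta (at_vertex M k).
Definition im_gamma := im_submod gamma M_out.

Definition coker_beta : lmodType F := subquot M_out im_beta.
Definition alpha_gamma : lmodType F := subquot ker_alpha im_gamma.

Definition premut_space : lmodType F :=
  (coker_beta * alpha_gamma * 'rV[F]_(ddec M k))%type.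

Definition premut_dec (j : V) : nat :=
  if j == k then dimension (subquot ker_beta im_alpha) else ddec M j.

Definition is_section (sigma : {linear alpha_gamma -> {ffun inQ -> M_}}) : Prop :=
  forall h, sub_set ker_alpha (sigma h) /\ subquot_class ker_alpha im_gamma (sigma h) = h.

(* [gamma-bar, iota sigma, 0]; as gamma vanishes on im beta, the value of     *)
(* gamma-bar on a class is that of gamma on any representative.               *)
Definition premut_in (sigma : {linear alpha_gamma -> {ffun inQ -> M_}})
    (n : premut_space) : {ffun inQ -> M_} :=
  gamma (subquot_repr n.1.1) + sigma n.1.2.

(* The b-component of the transpose of [-p, 0, 0].                            *)
Definition premut_out (b : outQ) (m : M_) : premut_space :=
  (- subquot_class M_out im_beta [ffun b' => if b' == b then m else 0], 0, 0).

(* N is the premutation of M, up to the identification of N_j with M_j (via   *)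
(* f, for j != k), and of N_k with premut_space (via g).                      *)
Definition is_premutation (sigma : {linear alpha_gamma -> {ffun inQ -> M_}})
    (S0 : cpalg F Q) (N : decrep (premut_pot k S0)) : Prop :=
  ddec N =1 premut_dec /\
  exists (f : {linear vspace_of N -> M_}) (g : {linear vspace_of N -> premut_space}),
    [/\ forall j, j != k -> set_bij (at_vertex N j) (at_vertex M j) f,
        set_bij (at_vertex N k) [set: premut_space] g,
        forall (c : old_arrow Q k) n, sub_set (at_vertex N (tl (val c))) n ->
          f (act (arr F (p_old c)) n) = act (arr F (val c)) (f n),
        forall (b : outQ) (a : inQ) n, sub_set (at_vertex N (tl (val a))) n ->
          f (act (arr F (p_hook b a)) n) =
            act (arr F (val b)) (act (arr F (val a)) (f n)) &
        (forall (a : inQ) n, sub_set (at_vertex N k) n ->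
          f (act (arr F (p_star_in a)) n) = premut_in sigma (g n) a) /\
        (forall (b : outQ) n, sub_set (at_vertex N (hd (val b))) n ->
          g (act (arr F (p_star_out b)) n) = premut_out b (f n))].

(* N' is the restriction of N along the map of Jacobian algebras induced by   *)
(* the inclusion of the reduced part and by the inverse of mu_phi.            *)
Definition is_restriction (mu : QPmutation k S)
    (N : decrep (premut_pot k (mu_norm mu))) (N' : decrep (mu_pot mu)) : Prop :=
  ddec N' =1 ddec N /\
  exists2 h : {linear vspace_of N' -> vspace_of N}, bijective h &
    forall x y n, mu_phi mu y = sum_inl (mu_trivial_quiver mu) x ->
      h (act x n) = act y (h n).

Definition is_mutation (mu : QPmutation k S)
    (sigma : {linear alpha_gamma -> {ffun inQ -> M_}}) (N' : decrep (mu_pot mu)) : Prop :=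
  exists2 N, is_premutation sigma N & is_restriction N N'.

End DecrepMutation.

(* Main.v *)
(* A finite-dimensional module U is the injective envelope of the simple at l   *)
(* as soon as it is nilpotent, its socle is spanned by one vector at l and      *)
(* Ext^1(S_j, U) = 0 for all j, i.e. each complex U_j -> U_out(j) -> U_in(j) is *)
(* exact in the middle; conversely, these properties hold for a finite-         *)
(* dimensional injective envelope. For such a U and k <> l the map beta is      *)
(* injective with image ker gamma, so the premutation has                       *)
(* coker beta + ker alpha / im gamma = ker alpha at k, the arrows a^* acting by *)
(* the inclusion and the arrows b^* by - gamma. On this model the properties    *)
(* above are checked directly over the premutation, and they pass to the        *)
(* mutation because, by the cyclic chain rule, right-equivalences and           *)
(* the removal of trivial summands induce isomorphisms of Jacobian algebras.    *)

From HB Require Import structures.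
Require Import Defs.
From mathcomp Require Import all_boot all_order all_algebra.
From mathcomp Require Import boolp classical_sets functions reals complex.

Set Implicit Arguments.
Unset Strict Implicit.
Unset Printing Implicit Defensive.

Import GRing.Theory VectorInternalTheory.
Local Open Scope classical_set_scope.
Local Open Scope ring_scope.

(** * Linear algebra *)

(** A finite-dimensional module over a Jacobian algebra is recognised as the injective envelope of
    the simple at [l] by three conditions that can be checked on arrows: long paths act by zero, the
    socle is a line at [l] ([socle_spanned]), and a family [y] satisfying the linear relations read
    off the cyclic derivatives is of the form [y b = b m] ([lifts]). Their necessity is
    [has_dim_nil], [envelope_socle] and [envelope_lifts]. Their sufficiency, [envelope_iso], rests
    on a duality: if phi is a functional with value 1 on the socle generator, then the [u] in e_l A
    with phi(u m) = 0 for all [m] lie in J(S) ([annihilator_jac]). Hence e_l m^d lies in J(S), so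
    that an envelope not known to be finite-dimensional is killed by m^d as well; this is also how
    the finite dimension of the mutated injective is obtained.

    For such a module and [k] distinct from [l], beta is injective because the socle is not at [k]
    ([ker_out0]), and im beta = ker gamma is the lifting condition at [k] ([ker_gamma]). So gamma
    embeds coker beta in ker alpha with image im gamma, and the space at [k] of the premutation
    becomes ker alpha ([premut_in_inj], [premut_in_surj]), with decoration 0. On this model the
    relations, the socle and the lifting property are verified in [premut_action_kills],
    [premut_action_socle] and [premut_action_lifts].

    The Jacobian algebras of the premutation and of the mutation are isomorphic ([reduction_iso]),
    by the cyclic chain rule [cyc_insert_chain] and the elimination of the arrows of the trivial
    part. The envelope over the mutation is therefore an envelope over the premutation, and
    [envelope_iso] identifies it with the model.

    Infinite sums of paths are handled throughout by quotients by a last arrow ([strip]): an element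
    is a finite combination of vertices plus a finite sum of products z a with [a] an arrow, and the
    arguments are inductions on the order in the m-adic filtration. *)

Section LinearAlgebra.
Variable F : fieldType.

(** A matrix of maximal rank among those with row space inside [P] works: a vector of [P] outside
    its row space could be added and would raise the rank. *)
Lemma submod_rowspace n (P : set 'rV[F]_n) : is_submod P ->
  exists B : 'M[F]_n, forall w, P w <-> (w <= B)%MS.
Proof.
case=> P0 PD.
have PZ c x : P x -> P (c *: x) by move=> Px; rewrite -[_ *: _]addr0; apply: PD.
pose good r := `[< exists2 B : 'M[F]_n, \rank B = r & forall w : 'rV_n, (w <= B)%MS -> P w >].
have g0 : exists r, good r.
  by exists 0%N; apply/asboolP; exists 0 => [|w]; [exact: mxrank0 | rewrite submx0 => /eqP ->].
have gmax r : good r -> (r <= n)%N by move=> /asboolP[B <- _]; exact: rank_leq_col.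
case: (ex_maxnP g0 gmax) => r /asboolP[B Br BP] rmax.
exists B => w; split=> [Pw|]; last exact: BP.
apply: contrapT => /negP wB.
have /rmax : good (\rank (B + w)%MS).
  apply/asboolP; exists (B + w)%MS => // u /sub_addsmxP[[u1 u2] /= ->].
  rewrite addrC [u2]mx11_scalar mul_scalar_mx; apply: PD => //.
  by apply: BP; rewrite submxMl.
rewrite -Br leqNgt rank_ltmx // ltmxE addsmxSl /=.
by apply: contra wB; apply: submx_trans; rewrite addsmxSr.
Qed.

Lemma has_dim_coord (U : lmodType F) n : has_dim U n ->
  exists2 f : {linear 'rV[F]_n -> U}, bijective f &
    exists2 g : {linear U -> 'rV[F]_n}, cancel f g & cancel g f.
Proof.
case=> f bf; exists f => //; have [g fK gK] := bf.
have gl : linear g by move=> c x y; apply: (bij_inj bf); rewrite linearP !gK.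
pose G : {linear U -> 'rV[F]_n} := HB.pack g (GRing.isLinear.Build F U 'rV[F]_n _ g gl).
by exists G.
Qed.

(** In coordinates the range is a row space, and [row_base] of its matrix is the basis that
    [has_dim] asks for. *)
Lemma finite_dim_inj (U : lmodType F) (W : vectType F) (h : {linear U -> W}) :
  injective h -> finite_dim U.
Proof.
move=> hinj; pose g := v2r \o h.
have ginj : injective g by apply: inj_comp hinj; exact: v2r_inj.
have gl : linear g.
  by move=> c x y; rewrite /g /= linearP linearD linearZ.
pose G : {linear U -> 'rV[F]_(dim W)} :=
  HB.pack g (GRing.isLinear.Build F U 'rV[F]_(dim W) _ g gl).
have [|B BP] := @submod_rowspace _ (range G).
  split; first by exists 0 => //; rewrite linear0.
  by move=> c _ _ [x _ <-] [y _ <-]; exists (c *: x + y) => //; rewrite linearP.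
have Pk (x : 'rV_(\rank B)) : exists u, G u = x *m row_base B.
  have /BP[u _ gu] : (x *m row_base B <= B)%MS.
    by rewrite (submx_trans (submxMl _ _)) ?eq_row_base.
  by exists u.
pose k x := projT1 (cid (Pk x)).
have kE x : G (k x) = x *m row_base B by rewrite /k; case: cid.
have kl : linear k.
  move=> c x y; apply: ginj; transitivity (c *: G (k x) + G (k y)); last by rewrite -linearP.
  by rewrite !kE (kE _ : g _ = _) mulmxDl scalemxAl.
pose K : {linear 'rV[F]_(\rank B) -> U} := HB.pack k (GRing.isLinear.Build F 'rV[F]_(\rank B) U _ k kl).
exists (\rank B), K; apply: (@Bijective _ _ _ (fun u => G u *m pinvmx (row_base B))).
  by move=> x; rewrite [G _]kE mulmxKp ?row_base_free.
move=> u; apply: ginj; rewrite (kE _ : g _ = _) mulmxKpV //.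
by rewrite eq_row_base; apply/BP; exists u.
Qed.

Lemma finite_dim_coord (U : lmodType F) : finite_dim U ->
  exists n (g : {linear U -> 'rV[F]_n}), injective g.
Proof. by case=> n /has_dim_coord[f _ [g _ /can_inj gi]]; exists n, g. Qed.

Lemma finite_dim_ffun (T : finType) (U : lmodType F) :
  finite_dim U -> finite_dim {ffun T -> U}.
Proof.
move=> /finite_dim_coord[n [g gi]].
pose h (y : {ffun T -> U}) : {ffun T -> 'rV[F]_n} := [ffun t => g (y t)].
have hl : linear h by move=> c x y; apply/ffunP => t; rewrite !ffunE linearP.
pose H : {linear {ffun T -> U} -> {ffun T -> 'rV[F]_n}} :=
  HB.pack h (GRing.isLinear.Build F {ffun T -> U} {ffun T -> 'rV[F]_n} _ h hl).
apply: (@finite_dim_inj _ _ H) => x y /ffunP xy; apply/ffunP => t.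
by apply: gi; have := xy t; rewrite !ffunE.
Qed.

Lemma finite_dim_prod (U W : lmodType F) :
  finite_dim U -> finite_dim W -> finite_dim (U * W)%type.
Proof.
move=> /finite_dim_coord[n [g gi]] /finite_dim_coord[m [h hi]].
pose k (y : U * W) : 'rV[F]_n * 'rV[F]_m := (g y.1, h y.2).
have kl : linear k by move=> c x y; rewrite /k /= !linearP.
pose K : {linear (U * W)%type -> ('rV[F]_n * 'rV[F]_m)%type} := HB.pack k
  (GRing.isLinear.Build F (U * W)%type ('rV[F]_n * 'rV[F]_m)%type _ k kl).
by apply: (@finite_dim_inj _ _ K) => -[x1 x2] [y1 y2] [] /gi -> /hi ->.
Qed.

Lemma finite_dim_inj_lin (U W : lmodType F) (h : {linear U -> W}) :
  injective h -> finite_dim W -> finite_dim U.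
Proof.
move=> hi /finite_dim_coord[n [g gi]].
by apply: (@finite_dim_inj _ _ (g \o h : {linear U -> 'rV[F]_n})); apply: inj_comp hi.
Qed.

(** In coordinates the space of functionals [W] is a row space, and the columns of its [cokermx] are
    common zeros of [W]; a functional vanishing on them belongs to the row space. *)
Lemma double_annihilator (U : lmodType F) (W : set (U -> F)) (theta : U -> F) :
  finite_dim U -> (forall w, W w -> scalar w) ->
  W (fun=> 0) -> (forall c w1 w2, W w1 -> W w2 -> W (fun u => c * w1 u + w2 u)) ->
  scalar theta -> (forall u, (forall w, W w -> w u = 0) -> theta u = 0) -> W theta.
Proof.
case=> n /has_dim_coord[f bf [g fK gK]] Wlin W0 WD tl Wt.
pose co (w : U -> F) : 'rV[F]_n := \row_i w (f (delta_mx 0 i)).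
have coE w : scalar w -> forall u, w u = (g u *m (co w)^T) 0 0.
  move=> wl u; pose w' : {linear U -> F^o} := HB.pack w (GRing.isLinear.Build F U F^o _ w wl).
  have -> : u = \sum_i (g u) 0 i *: f (delta_mx 0 i).
    rewrite -[LHS]gK [X in f X]row_sum_delta linear_sum.
    by apply: eq_bigr => i _; rewrite linearZ.
  transitivity (\sum_i (g u) 0 i * w (f (delta_mx 0 i))).
    rewrite -[LHS]/(w' _) linear_sum; apply: eq_bigr => i _.
    by rewrite linearZ.
  rewrite mxE; apply: eq_bigr => i _; rewrite !mxE linear_sum summxE (bigD1 i) //=.
  rewrite linearZ /= fK !mxE !eqxx mulr1 big1 ?addr0 // => j ji.
  by rewrite linearZ /= fK !mxE eq_sym (negPf ji) andbF mulr0.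
have [|B BP] := @submod_rowspace n (fun v => W (fun u => (g u *m v^T) 0 0)).
  split.
    by have -> : (fun u => (g u *m (0 : 'rV[F]_n)^T) 0 0) = fun=> 0 by apply/funext => u; rewrite trmx0 mulmx0 mxE.
  move=> c x y Wx Wy; have := WD c _ _ Wx Wy; congr W; apply/funext => u.
  by rewrite linearP /= mulmxDr -scalemxAr !mxE.
have -> : theta = fun u => (g u *m (co theta)^T) 0 0 by apply/funext; apply: coE.
apply/BP; rewrite submxE; apply/eqP/rowP => j; rewrite [RHS]mxE.
set v := col j (cokermx B).
have vE (r : 'rV_n) : (r *m cokermx B) 0 j = (r *m v) 0 0.
  by rewrite !mxE; apply: eq_bigr => i _; rewrite !mxE.
rewrite vE; have -> : (co theta *m v) 0 0 = theta (f v^T).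
  by rewrite (coE _ tl) fK -trmx_mul [RHS]mxE.
apply: Wt => w Ww; rewrite (coE _ (Wlin _ Ww)) fK -trmx_mul [LHS]mxE.
have /BP : W (fun u => (g u *m (co w)^T) 0 0).
  by have <- : w = fun u => (g u *m (co w)^T) 0 0 by apply/funext; apply: coE; apply: Wlin.
by rewrite submxE => /eqP/rowP/(_ j); rewrite vE => ->; rewrite mxE.
Qed.

End LinearAlgebra.

(** * Complete path algebras *)

Section Strip.
Variables (F : fieldType) (V : finType) (Q : quiver V).
Local Notation A := (cpalg F Q).
Implicit Types (x y z : A) (a b : Q) (v i : V) (s : seq Q).

Lemma wcoef_mul x y v s : wcoef (x * y) v s = \sum_(i < (size s).+1)
    wcoef x v (take i s) * wcoef y (word_tl v (take i s)) (drop i s).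
Proof. exact: wcoefM. Qed.

Lemma wcoef0 v s : wcoef (0 : A) v s = 0.
Proof. by rewrite /wcoef; case: insub. Qed.

Lemma wcoefN x v s : wcoef (- x) v s = - wcoef x v s.
Proof. by rewrite -scaleN1r wcoefZ mulN1r. Qed.

Lemma wcoef_sum v s T (r : seq T) P (f : T -> A) :
  wcoef (\sum_(t <- r | P t) f t) v s = \sum_(t <- r | P t) wcoef (f t) v s.
Proof. by apply: (big_morph (fun x : A => wcoef x v s)) => [x y|]; rewrite (wcoefD, wcoef0). Qed.

Lemma wcoefB x y v s : wcoef (x - y) v s = wcoef x v s - wcoef y v s.
Proof. by rewrite wcoefD wcoefN. Qed.

Lemma wcoef_vtx i v s : wcoef (vtx F Q i) v s = ((v == i) && nilp s)%:R.
Proof.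
rewrite wcoef_of; case: ifPn => //; case: s => //= a s _.
by rewrite andbF.
Qed.

Lemma wcoef_arr a v s : wcoef (arr F a) v s = ((s == [:: a]) && (v == hd a))%:R.
Proof.
rewrite wcoef_of; case: eqP => [->|] /=; last by rewrite if_same.
by rewrite andbT eq_sym; case: eqP.
Qed.

Lemma is_path_rcons v s a : is_path v (rcons s a) = is_path v s && (word_tl v s == hd a).
Proof. by rewrite -cats1 is_path_cat /= andbT eq_sym. Qed.

Lemma word_tl_rcons v s a : word_tl v (rcons s a) = tl a.
Proof. by rewrite /word_tl map_rcons last_rcons. Qed.

(** The right quotient x / a of Fox calculus. Together with the terms of length 0, these finitely
    many quotients determine [x], see [strip_decomp]. *)
Definition strip a x : A := of_wcoef (fun v s => wcoef x v (rcons s a)).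

Lemma wcoef_strip a x v s : wcoef (strip a x) v s = wcoef x v (rcons s a).
Proof.
rewrite wcoef_of; case: ifPn => // np; rewrite wcoef_out //.
by rewrite is_path_rcons (negPf np).
Qed.

Fact strip_linear a : linear (strip a).
Proof. by move=> c x y; apply: wcoefP => v s; rewrite !(wcoef_strip, wcoefD, wcoefZ). Qed.
HB.instance Definition _ a := GRing.isLinear.Build F A A _ (strip a) (strip_linear a).

Lemma wcoef_mul_nil x y v : wcoef (x * y) v [::] = wcoef x v [::] * wcoef y v [::].
Proof. by rewrite wcoef_mul big_ord1. Qed.

(** The last arrow of a product comes from [y], unless [y] contributes an idempotent, which can only
    be the one at [tl a]. *)
Lemma strip_mul a x y :
  strip a (x * y) = x * strip a y + wcoef y (tl a) [::] *: strip a x.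
Proof.
apply: wcoefP => v s; rewrite !(wcoef_strip, wcoefD, wcoefZ) !wcoef_mul size_rcons.
rewrite big_ord_recr /= -[X in drop X](size_rcons s a) drop_size.
rewrite -[X in take X](size_rcons s a) take_size word_tl_rcons mulrC; congr (_ + _).
apply: eq_bigr => i _; have le_i : (i <= size s)%N by rewrite -ltnS.
rewrite wcoef_strip -cats1 take_cat drop_cat; case: ltnP => [_|ge_i].
  by rewrite cats1.
have -> : nat_of_ord i = size s by apply/eqP; rewrite eqn_leq le_i.
by rewrite subnn /= cats0 drop_size take_size.
Qed.

Lemma strip_vtx a i : strip a (vtx F Q i) = 0.
Proof.
by apply: wcoefP => v s; rewrite wcoef_strip wcoef_vtx wcoef0; case: s => *; rewrite andbF.
Qed.

Lemma strip_one a : strip a (1 : A) = 0.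
Proof. by apply: wcoefP => v s; rewrite wcoef_strip wcoef1 wcoef0; case: s. Qed.

Lemma strip_arr a b : strip a (arr F b) = (a == b)%:R *: vtx F Q (hd b).
Proof.
apply: wcoefP => v s; rewrite wcoef_strip wcoefZ wcoef_arr wcoef_vtx.
case: s => [|c s] /=; last first.
  by rewrite andbF mulr0 eqseq_cons -cats1; case: s => *; rewrite /= andbF.
by rewrite eqseq_cons !andbT -natrM mulnb.
Qed.

Lemma mul_arr a x v s b : wcoef (x * arr F a) v (rcons s b) =
  if (b == a) && (word_tl v s == hd a) then wcoef x v s else 0.
Proof.
rewrite -wcoef_strip strip_mul wcoefD wcoefZ wcoef_arr mul0r addr0.
rewrite strip_arr -cp_scalerAr wcoefZ; case: eqP => _ /=; last by rewrite mul0r.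
rewrite mul1r wcoef_mul big_ord_recr /= take_size drop_size wcoef_vtx andbT.
rewrite big1 ?add0r; first by case: eqP; rewrite (mulr1, mulr0).
move=> i _; rewrite wcoef_vtx /nilp size_drop subn_eq0 leqNgt ltn_ord.
by rewrite andbF mulr0.
Qed.

Lemma mul_arr_nil a x v : wcoef (x * arr F a) v [::] = 0.
Proof. by rewrite wcoef_mul_nil wcoef_arr mulr0. Qed.

Lemma strip_decomp x :
  x = \sum_i wcoef x i [::] *: vtx F Q i + \sum_a strip a x * arr F a.
Proof.
apply: wcoefP => v s; rewrite wcoefD !wcoef_sum.
case/lastP: s => [|s b].
  rewrite [X in _ + X]big1 ?addr0 => [|a _]; last exact: mul_arr_nil.
  rewrite (bigD1 v) //= big1 ?addr0 => [|i /negPf iv].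
    by rewrite wcoefZ wcoef_vtx eqxx mulr1.
  by rewrite wcoefZ wcoef_vtx eq_sym iv mulr0.
rewrite big1 ?add0r => [|i _]; last first.
  by rewrite wcoefZ wcoef_vtx /nilp size_rcons andbF mulr0.
rewrite (bigD1 b) //= big1 ?addr0 => [|a /negPf ab]; last by rewrite mul_arr eq_sym ab.
rewrite mul_arr eqxx /= wcoef_strip; case: eqP => // ne.
by rewrite wcoef_out // is_path_rcons negb_and orbC; move/eqP: ne => ->.
Qed.

Lemma vtx_mul i j : vtx F Q i * vtx F Q j = (i == j)%:R *: vtx F Q i.
Proof.
rewrite [LHS]strip_decomp [X in _ + X]big1 ?addr0 => [|a _]; last first.
  by rewrite strip_mul !strip_vtx mulr0 scaler0 addr0 mul0r.
rewrite (bigD1 i) //= big1 ?addr0 => [|l /negPf li].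
  by rewrite wcoef_mul_nil !wcoef_vtx eqxx /= andbT mul1r.
by rewrite wcoef_mul_nil !wcoef_vtx li /= mul0r scale0r.
Qed.

Lemma sum_vtx : \sum_i vtx F Q i = 1.
Proof.
rewrite [RHS]strip_decomp [X in _ = _ + X]big1 ?addr0 => [|a _]; last first.
  by rewrite strip_one mul0r.
by apply: eq_bigr => i _; rewrite wcoef1 scale1r.
Qed.

Lemma wcoef_vtx_mul i x v s : wcoef (vtx F Q i * x) v s = if v == i then wcoef x v s else 0.
Proof.
rewrite wcoef_mul big_ord_recl /= take0 drop0 wcoef_vtx andbT big1 ?addr0.
  by case: eqP; rewrite (mul1r, mul0r).
by move=> j _; rewrite wcoef_vtx; case: s j => [[]|? ? j] //; rewrite andbF mul0r.
Qed.

Lemma wcoef_mul_vtx i x v s : wcoef (x * vtx F Q i) v s = if word_tl v s == i then wcoef x v s else 0.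
Proof.
rewrite wcoef_mul big_ord_recr /= take_size drop_size wcoef_vtx andbT big1 ?add0r.
  by case: eqP; rewrite (mulr1, mulr0).
move=> j _; rewrite wcoef_vtx /nilp size_drop subn_eq0 leqNgt ltn_ord.
by rewrite andbF mulr0.
Qed.

Lemma vtx_arr i a : vtx F Q i * arr F a = (i == hd a)%:R *: arr F a.
Proof.
apply: wcoefP => v s; rewrite wcoef_vtx_mul wcoefZ wcoef_arr eq_sym.
case: (s == _); rewrite ?if_same ?mulr0 //=.
by case: (v =P hd a) => [->|_]; rewrite ?if_same ?mulr0 // mulr1; case: eqP.
Qed.

Lemma arr_vtx i a : arr F a * vtx F Q i = (i == tl a)%:R *: arr F a.
Proof.
apply: wcoefP => v s; rewrite wcoef_mul_vtx wcoefZ wcoef_arr.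
case: (s =P _) => [->|_] /=; rewrite ?if_same ?mulr0 //.
by rewrite /word_tl /= eq_sym; case: eqP; rewrite (mul1r, mul0r).
Qed.

(* [mpow n x] means that x lies in the n-th power of the ideal m *)
Definition mpow n x := forall v s, (size s < n)%N -> wcoef x v s = 0.

Lemma mpowP n x : mpow n x <-> forall p, (path_len p < n)%N -> coef x p = 0.
Proof.
split=> [xn p pn|xn v s sn]; first by rewrite Defs.coefE xn.
by have [p|np] := boolP (is_path v s); [rewrite (wcoefE _ p) xn | rewrite wcoef_out].
Qed.

Lemma mpow0 n : mpow n 0. Proof. by move=> *; rewrite wcoef0. Qed.
Lemma mpowD n x y : mpow n x -> mpow n y -> mpow n (x + y).
Proof. by move=> xn yn v s sn; rewrite wcoefD xn ?yn ?addr0. Qed.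
Lemma mpowZ n c x : mpow n x -> mpow n (c *: x).
Proof. by move=> xn v s sn; rewrite wcoefZ xn ?mulr0. Qed.
Lemma mpowN n x : mpow n x -> mpow n (- x).
Proof. by move=> xn; rewrite -scaleN1r; apply: mpowZ. Qed.
Lemma mpowB n x y : mpow n x -> mpow n y -> mpow n (x - y).
Proof. by move=> xn yn; apply: mpowD => //; apply: mpowN. Qed.
Lemma mpow_sum n T (r : seq T) (P : pred T) (f : T -> A) :
  (forall t, P t -> mpow n (f t)) -> mpow n (\sum_(t <- r | P t) f t).
Proof. by move=> fn; apply: big_ind => //; [exact: mpow0 | exact: mpowD]. Qed.
Lemma mpow_le m n x : (m <= n)%N -> mpow n x -> mpow m x.
Proof. by move=> mn xn v s sm; apply: xn; apply: leq_trans mn. Qed.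
Lemma mpow_any x : mpow 0 x. Proof. by []. Qed.

Lemma mpowM m n x y : mpow m x -> mpow n y -> mpow (m + n) (x * y).
Proof.
move=> xm yn v s smn; rewrite wcoef_mul big1 // => i _.
have [im|mi] := ltnP i m.
  by rewrite xm ?mul0r // size_take_min (leq_ltn_trans (geq_minl _ _)).
rewrite yn ?mulr0 // size_drop ltn_subLR; last by rewrite -ltnS.
by apply: leq_trans smn _; rewrite leq_add2r.
Qed.

Lemma mpowMl n x y : mpow n x -> mpow n (x * y).
Proof. by move=> xn; rewrite -[n]addn0; apply: mpowM. Qed.
Lemma mpowMr n x y : mpow n y -> mpow n (x * y).
Proof. by move=> yn; rewrite -[n]add0n; apply: mpowM. Qed.

Lemma mpow_arr a : mpow 1 (arr F a).
Proof. by move=> v [|//] _; rewrite wcoef_arr. Qed.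

Lemma mpow_strip n a x : mpow n.+1 x -> mpow n (strip a x).
Proof. by move=> xn v s sn; rewrite wcoef_strip xn // size_rcons. Qed.

Lemma strip_decomp1 x : mpow 1 x -> x = \sum_a strip a x * arr F a.
Proof.
move=> x1; rewrite [LHS]strip_decomp big1 ?add0r // => i _.
by rewrite x1 ?scale0r.
Qed.

Lemma mpow_eq x y : (forall n, mpow n (x - y)) -> x = y.
Proof.
move=> xy; apply: wcoefP => v s; apply/eqP; rewrite -subr_eq0 -wcoefB.
by rewrite (xy (size s).+1).
Qed.

Lemma madic_closureP (X : set A) x :
  madic_closure X x <-> forall n, exists2 y, X y & mpow n (x - y).
Proof.
split=> cx n; have [y Xy xy] := cx n; exists y => //.
  by apply/mpowP => p pn; rewrite /= xy // subrr.
by move=> p pn; apply/eqP; rewrite -subr_eq0; apply/eqP; move/mpowP: xy => /(_ p pn).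
Qed.

Lemma madic_closureK (X : set A) x :
  madic_closure (madic_closure X) x -> madic_closure X x.
Proof.
move/madic_closureP => cx; apply/madic_closureP => n; have [y /madic_closureP/(_ n)[z Xz yz] xy] := cx n.
by exists z => //; rewrite -(subrK y x) -addrA; apply: mpowD.
Qed.

Lemma sub_closure (X : set A) x : X x -> madic_closure X x.
Proof. by move=> Xx d; exists x. Qed.

(** The geometric series of [x]. For [x] in m the cut at the length of [s] is harmless, as higher
    powers have no terms of that length. *)
Definition geom x : A := of_wcoef (fun v s => \sum_(n < (size s).+1) wcoef (x ^+ n) v s).

Lemma mpow_exp x n : mpow 1 x -> mpow n (x ^+ n).
Proof.
by move=> x1; elim: n => [|n IH]; rewrite ?expr0 // exprS -add1n; apply: mpowM.
Qed.

Lemma geomK x : mpow 1 x -> geom x * (1 - x) = 1.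
Proof.
move=> x1; apply: mpow_eq => n.
have gn : mpow n (geom x - \sum_(m < n) x ^+ m).
  move=> v s sn; rewrite wcoefB wcoef_sum wcoef_of; case: ifPn => [_|np]; last first.
    by rewrite big1 ?subrr // => m _; rewrite wcoef_out.
  apply/eqP; rewrite subr_eq0; apply/eqP.
  rewrite (big_ord_widen n (fun m => wcoef (x ^+ m) v s)) // [RHS](bigID (fun m : 'I_n => (m < (size s).+1)%N)) /=.
  rewrite [X in _ = _ + X]big1 ?addr0 // => m; rewrite -leqNgt => sm.
  exact: (mpow_exp x1).
rewrite -[geom x](subrK (\sum_(m < n) x ^+ m)) mulrDl -addrA; apply: mpowD.
  exact: mpowMl.
have -> : (\sum_(m < n) x ^+ m) * (1 - x) = 1 - x ^+ n.
  elim: n {gn} => [|n IH]; first by rewrite big_ord0 mul0r expr0 subrr.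
  rewrite big_ord_recr /= mulrDl IH mulrBr mulr1 -exprSr addrA subrK //.
by rewrite addrAC subrr add0r; apply: mpowN; apply: mpow_exp.
Qed.

End Strip.

(** * Nilpotent modules *)

Section Actions.
Variables (F : fieldType) (V : finType) (Q : quiver V).
Local Notation A := (cpalg F Q).
Implicit Types (x y z : A) (a b : Q) (v i : V) (s : seq Q).

(** A module over the complete path algebra, kept as operators on a vector space: it can be built
    before the Jacobian relations are checked and can serve two potentials at once. *)
Record action (U : lmodType F) := Action {
  ap :> A -> U -> U;
  ap_linear : forall x, linear (ap x);
  ap_linearl : forall m, linear (ap^~ m);
  apM : forall x y m, ap (x * y) m = ap x (ap y m);
  ap1 : forall m, ap 1 m = m }.

Section Theory.
Variables (U : lmodType F) (T : action U).
HB.instance Definition _ x := GRing.isLinear.Build F U U _ (T x) (ap_linear T x).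

Lemma apD x m n : T x (m + n) = T x m + T x n. Proof. exact: linearD. Qed.
Lemma apB x m n : T x (m - n) = T x m - T x n. Proof. exact: linearB. Qed.
Lemma apN x m : T x (- m) = - T x m. Proof. exact: linearN. Qed.
Lemma apZ x c m : T x (c *: m) = c *: T x m. Proof. exact: linearZ. Qed.
Lemma ap0 x : T x 0 = 0. Proof. exact: linear0. Qed.
Lemma ap_sum x I (r : seq I) (P : pred I) (f : I -> U) :
  T x (\sum_(i <- r | P i) f i) = \sum_(i <- r | P i) T x (f i).
Proof. exact: linear_sum. Qed.

Lemma apDl x y m : T (x + y) m = T x m + T y m.
Proof. by have := ap_linearl T m 1 x y; rewrite !scale1r. Qed.
Lemma ap0l m : T 0 m = 0.
Proof. by apply: (addrI (T 0 m)); rewrite -apDl !addr0. Qed.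
Lemma apZl c x m : T (c *: x) m = c *: T x m.
Proof. by have := ap_linearl T m c x 0; rewrite !addr0 ap0l addr0. Qed.
Lemma apNl x m : T (- x) m = - T x m.
Proof. by rewrite -[- x]scaleN1r apZl scaleN1r. Qed.
Lemma apBl x y m : T (x - y) m = T x m - T y m.
Proof. by rewrite apDl apNl. Qed.
Lemma ap_suml I (r : seq I) (P : pred I) (f : I -> A) m :
  T (\sum_(i <- r | P i) f i) m = \sum_(i <- r | P i) T (f i) m.
Proof. by apply: (big_morph (T^~ m)) => [x y|]; rewrite ?apDl ?ap0l. Qed.

Fixpoint nil d (m : U) : Prop :=
  if d is d'.+1 then forall a, nil d' (T (arr F a) m) else m = 0.

Lemma nilS d m : nil d m -> nil d.+1 m.
Proof. by elim: d m => [m /= -> a|d IH m /= dm a]; [rewrite ap0 | apply: IH]. Qed.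

(** Infinite sums cause no trouble: an element of m^(d+1) is a finite sum of products z a with [a]
    an arrow and z in m^d. *)
Lemma ap_order d x m : mpow d x -> nil d m -> T x m = 0.
Proof.
elim: d x m => [x m _ /= ->|d IH x m xd dm]; first exact: ap0.
rewrite (strip_decomp1 (mpow_le _ xd)) // ap_suml big1 // => a _.
by rewrite apM; apply: IH; [exact: mpow_strip | exact: dm].
Qed.

Lemma ap_strip x m :
  T x m = \sum_i wcoef x i [::] *: T (vtx F Q i) m + \sum_a T (strip a x) (T (arr F a) m).
Proof.
rewrite [in LHS](strip_decomp x) apDl !ap_suml; congr (_ + _).
  by apply: eq_bigr => i _; rewrite apZl.
by apply: eq_bigr => a _; rewrite apM.
Qed.

Lemma ap_strip1 x m : mpow 1 x -> T x m = \sum_a T (strip a x) (T (arr F a) m).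
Proof. by move=> x1; rewrite ap_strip big1 ?add0r // => i _; rewrite x1 ?scale0r. Qed.

Lemma ap_vtx_arr a m : T (vtx F Q (hd a)) (T (arr F a) m) = T (arr F a) m.
Proof. by rewrite -apM vtx_arr eqxx scale1r. Qed.
Lemma ap_arr_vtx a m : T (arr F a) (T (vtx F Q (tl a)) m) = T (arr F a) m.
Proof. by rewrite -apM arr_vtx eqxx scale1r. Qed.
Lemma ap_arr_vtx0 a i m : i != tl a -> T (arr F a) (T (vtx F Q i) m) = 0.
Proof. by move=> /negPf ia; rewrite -apM arr_vtx ia scale0r ap0l. Qed.
Lemma ap_vtx_arr0 a i m : i != hd a -> T (vtx F Q i) (T (arr F a) m) = 0.
Proof. by move=> /negPf ia; rewrite -apM vtx_arr ia scale0r ap0l. Qed.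
Lemma ap_vtx_sum m : \sum_i T (vtx F Q i) m = m.
Proof. by rewrite -ap_suml sum_vtx ap1. Qed.
Lemma ap_vtx_vtx i j m : T (vtx F Q i) (T (vtx F Q j) m) = if i == j then T (vtx F Q i) m else 0.
Proof. by rewrite -apM vtx_mul apZl; case: eqP; rewrite ?scale1r ?scale0r. Qed.

Definition kills S := forall m, forall x, ideal_set (jac_ideal S) x -> T x m = 0.

(** Modulo m^d, which acts by zero, an element of the closure agrees with an element of the ideal
    itself, and this one is controlled by the generators. *)
Lemma kills_of_deriv S d : (forall m, nil d m) ->
  (forall a m, T (cderiv a S) m = 0) -> kills S.
Proof.
move=> dU dS m x /madic_closureP/(_ d)[y Iy xy].
rewrite -[x](subrK y) apDl (ap_order xy (dU m)) add0r.
suff: [set x | forall m, T x m = 0] y by apply.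
apply: Iy; last by move=> z [a _ <-] n; apply: dS.
split=> [n|z t zP tP n|z t zP n|z t zP n] /=; first exact: ap0l.
- by rewrite apBl zP tP subrr.
- by rewrite apM zP ap0.
by rewrite apM zP.
Qed.

End Theory.

Lemma ap_hom (U W : lmodType F) (T : action U) (T' : action W) (f : {linear U -> W}) d m :
  (forall i m, f (T (vtx F Q i) m) = T' (vtx F Q i) (f m)) ->
  (forall a m, f (T (arr F a) m) = T' (arr F a) (f m)) ->
  nil T d m -> forall x, f (T x m) = T' x (f m).
Proof.
move=> fv fa; elim: d m => [m /= -> x|d IH m dm x]; first by rewrite !(ap0, linear0).
rewrite [in LHS]ap_strip [in RHS]ap_strip linearD !linear_sum; congr (_ + _).
  by apply: eq_bigr => i _; rewrite linearZ /= fv.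
by apply: eq_bigr => a _; rewrite IH ?fa //; apply: dm.
Qed.

(** * Modules from nilpotent representations of the quiver *)

Section FromRep.
Variables (U : lmodType F) (e : V -> {linear U -> U}) (r : Q -> {linear U -> U}).

Fixpoint rnil d (m : U) : Prop := if d is d'.+1 then forall a, rnil d' (r a m) else m = 0.

Definition is_nilrep d := [/\ forall i j m, e i (e j m) = if i == j then e i m else 0,
  forall m, \sum_i e i m = m,
  forall a i m, r a (e i m) = if i == tl a then r a m else 0,
  forall a i m, e i (r a m) = if i == hd a then r a m else 0 &
  forall m, rnil d m].

(** Last arrows are peeled off and act first. The fuel [d] keeps the paths of length less than [d],
    which loses nothing on vectors with [rnil d m] ([ev_fuel]). *)
Fixpoint ev d x m : U := if d is d'.+1 then
    \sum_i wcoef x i [::] *: e i m + \sum_a ev d' (strip a x) (r a m) else 0.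

Lemma rnil0 d : rnil d 0.
Proof. by elim: d => //= d IH a; rewrite linear0. Qed.
Lemma rnilD d c m n : rnil d m -> rnil d n -> rnil d (c *: m + n).
Proof.
elim: d m n => [m n /= -> ->|d IH m n /= dm dn a]; first by rewrite scaler0 addr0.
by rewrite linearP; apply: IH.
Qed.
Lemma rnil_sum d I (s : seq I) (P : pred I) (f : I -> U) :
  (forall t, P t -> rnil d (f t)) -> rnil d (\sum_(i <- s | P i) f i).
Proof.
move=> fd; apply: big_ind => //; first exact: rnil0.
by move=> x y dx dy; rewrite -[x]scale1r; apply: rnilD.
Qed.
Lemma rnilS d m : rnil d m -> rnil d.+1 m.
Proof. by elim: d m => [m /= -> a|d IH m /= dm a]; [rewrite linear0 | apply: IH]. Qed.

Lemma ev_linear d x : linear (ev d x).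
Proof.
elim: d x => [x c m n|d IH x c m n]; first by rewrite scaler0 addr0.
rewrite /= scalerDr addrACA !scaler_sumr -!big_split; congr (_ + _); apply: eq_bigr => i _.
  by rewrite linearP scalerDr !scalerA mulrC.
by rewrite linearP IH.
Qed.

Lemma ev_linearl d m : linear (fun x => ev d x m).
Proof.
elim: d m => [m c x y|d IH m c x y]; first by rewrite scaler0 addr0.
rewrite /= scalerDr addrACA !scaler_sumr -!big_split; congr (_ + _); apply: eq_bigr => i _.
  by rewrite wcoefD wcoefZ scalerDl scalerA.
by rewrite linearP IH.
Qed.

HB.instance Definition _ d x := GRing.isLinear.Build F U U _ (ev d x) (@ev_linear d x).

Lemma ev_fuel d n n' x m : rnil d m -> (d <= n)%N -> (d <= n')%N -> ev n x m = ev n' x m.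
Proof.
elim: d n n' x m => [n n' x m /= -> _ _|d IH [|n] [|n'] x m dm //= dn dn'].
  by rewrite !linear0.
by congr (_ + _); apply: eq_bigr => a _; apply: IH.
Qed.

Variable d0 : nat.
Hypothesis rep : is_nilrep d0.

Lemma rnil_ev d n x m : rnil d m -> rnil d (ev n x m).
Proof.
have [ee es ere err _] := rep.
have rnil_e i c k : rnil c k -> rnil c (e i k).
  elim: c k => [k /= ->|c IH k /= ck a]; first exact: linear0.
  by rewrite ere; case: ifP => // _; apply: rnil0.
elim: n d x m => [|n IH] d x m dm /=; first exact: rnil0.
rewrite -[X in rnil _ (X + _)]scale1r; apply: rnilD; apply: rnil_sum => i _.
  by rewrite -[_ *: _]addr0; apply: rnilD; [exact: rnil_e | exact: rnil0].
apply: IH; case: d dm => [/= ->|d dm]; first by rewrite linear0.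
by apply: rnilS; apply: dm.
Qed.

Lemma evM d n x y m : rnil d m -> (d <= n)%N -> ev n (x * y) m = ev n x (ev n y m).
Proof.
have [ee es ere err _] := rep.
elim: d n x y m => [n x y m /= -> _|d IH [|n] x y m dm //= dn]; first by rewrite !linear0.
pose u := \sum_i wcoef y i [::] *: e i m.
pose w := \sum_a ev n (strip a y) (r a m).
have wd : rnil d w by apply: rnil_sum => a _; apply: rnil_ev; apply: dm.
have -> : \sum_i wcoef x i [::] *: e i (u + w) + \sum_a ev n (strip a x) (r a (u + w)) =
  ev n.+1 x u + ev n.+1 x w by rewrite -linearD.
have eu i : e i u = wcoef y i [::] *: e i m.
  rewrite linear_sum (bigD1 i) //= linearZ /= ee eqxx big1 ?addr0 // => j /negPf ji.
  by rewrite linearZ /= ee eq_sym ji scaler0.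
have ru a : r a u = wcoef y (tl a) [::] *: r a m.
  rewrite linear_sum (bigD1 (tl a)) //= linearZ /= ere eqxx big1 ?addr0 // => j /negPf ji.
  by rewrite linearZ /= ere ji scaler0.
(* One unit of fuel is given up, which [wd] permits, so that the induction hypothesis at fuel [n]
   applies to each summand of [w]. *)
rewrite (ev_fuel x wd (ltnW dn : (d <= n.+1)%N) (dn : (d <= n)%N)) /=.
have -> : ev n x w = \sum_a ev n (x * strip a y) (r a m).
  by rewrite linear_sum; apply: eq_bigr => a _; rewrite IH //; apply: dm.
rewrite -addrA -big_split /=; congr (_ + _).
  by apply: eq_bigr => i _; rewrite eu wcoef_mul_nil scalerA.
apply: eq_bigr => a _; rewrite ru linearZ /= strip_mul addrC.
have := ev_linearl n (r a m) (wcoef y (tl a) [::]) (strip a x) (x * strip a y).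
by move=> E; rewrite [x * _ + _]addrC E addrC.
Qed.

Fact ev_mul x y m : ev d0 (x * y) m = ev d0 x (ev d0 y m).
Proof. by have [_ _ _ _ ed] := rep; apply: (evM _ _ (ed m)). Qed.

Lemma ev0l d m : ev d 0 m = 0.
Proof.
by have := ev_linearl d m 1 0 0; rewrite !scale1r addr0 => E; apply: (addrI (ev d 0 m)); rewrite -E addr0.
Qed.

Lemma ev_const d x m : (forall a, strip a x = 0) -> rnil d m ->
  ev d x m = \sum_i wcoef x i [::] *: e i m.
Proof.
case: d => [|d] sx /=; last first.
  by move=> _; rewrite [X in _ + X]big1 ?addr0 // => a _; rewrite sx ev0l.
by move=> ->; rewrite big1 // => i _; rewrite linear0 scaler0.
Qed.

Lemma ev_vtx d i m : rnil d m -> ev d (vtx F Q i) m = e i m.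
Proof.
move=> dm; rewrite ev_const // => [|a]; last exact: strip_vtx.
rewrite (bigD1 i) //= big1 ?addr0 => [|j /negPf ji].
  by rewrite wcoef_vtx eqxx scale1r.
by rewrite wcoef_vtx ji scale0r.
Qed.

Fact ev_one m : ev d0 1 m = m.
Proof.
have [_ es _ _ ed] := rep; rewrite ev_const // => [|a]; last exact: strip_one.
by rewrite -[RHS]es; apply: eq_bigr => i _; rewrite wcoef1 scale1r.
Qed.

Definition rep_action : action U :=
  Action (@ev_linear d0) (@ev_linearl d0) ev_mul ev_one.

Lemma rep_action_vtx i m : rep_action (vtx F Q i) m = e i m.
Proof. by have [_ _ _ _ ed] := rep; apply: ev_vtx. Qed.

Lemma rep_action_arr a m : rep_action (arr F a) m = r a m.
Proof.
have [_ _ _ err ed] := rep; have /= := ed m; rewrite /rep_action /=.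
case: d0 => [/= ->|d dm]; first by rewrite linear0.
rewrite /= big1 ?add0r => [|i _]; last by rewrite wcoef_arr scale0r.
rewrite (bigD1 a) //= big1 ?addr0 => [|b /negPf ba].
  by rewrite strip_arr eqxx scale1r ev_vtx ?err ?eqxx //; apply: dm.
by rewrite strip_arr ba scale0r ev0l.
Qed.

Lemma rep_action_nil m : nil rep_action d0 m.
Proof.
have [_ _ _ _ ed] := rep.
suff rn d k : rnil d k -> nil rep_action d k by apply: rn; apply: ed.
by elim: d k => //= d IH k dk a; rewrite [X in nil _ _ X]rep_action_arr; apply: IH.
Qed.

End FromRep.

Definition act_action (S : A) (M : lmodType (jacobian S)) : action (vspace_of M).
Proof.
refine (@Action (vspace_of M) (@act F V Q S M) (@act_linear F V Q S M) _ _ _).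
- move=> m c x y; rewrite /act rmorphD scalerDl; congr (_ + _).
  have -> : (c *: (jac S x *: (m : M) : vspace_of M)) = jac S (cp_const Q c) *: (jac S x *: (m : M)) by [].
  by rewrite scalerA -rmorphM /cp_const -cp_scalerAl mul1r.
- by move=> x y m; rewrite /act rmorphM scalerA.
by move=> m; rewrite /act rmorph1 scale1r.
Defined.

Lemma act_kills (S : A) (M : lmodType (jacobian S)) : kills (act_action M) S.
Proof.
move=> m x Jx; rewrite /= /act.
have -> : jac S x = 0 by rewrite -(rmorph0 (jac S)); apply/quot_piE; rewrite subr0.
by rewrite scale0r.
Qed.

(** * From actions killed by J(S) to modules over the Jacobian algebra *)

Section FromAction.
Variables (U : lmodType F) (T : action U) (S : A) (H : kills T S).

Definition action_mod of kills T S : Type := U.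
Local Notation W := (action_mod H).
HB.instance Definition _ := GRing.Zmodule.on W.

Definition action_scale (q : jacobian S) (m : W) : W := T (repr q) m.

Lemma action_scale_pi x m : action_scale (quot_pi _ x) m = T x m.
Proof.
apply/eqP; rewrite -subr_eq0 -apBl; apply/eqP; apply: H.
by apply/quot_piE; rewrite quot_piK.
Qed.

Fact action_scaleA (a b : jacobian S) m : action_scale a (action_scale b m) = action_scale (a * b) m.
Proof.
by rewrite -[a]quot_piK -[b]quot_piK -rmorphM !action_scale_pi apM.
Qed.
Fact action_scale1 : left_id 1 action_scale.
Proof. by move=> m; rewrite -(rmorph1 (quot_pi _)) action_scale_pi ap1. Qed.
Fact action_scaleDr : right_distributive action_scale +%R.
Proof. by move=> a m n; apply: apD. Qed.
Fact action_scaleDl m : {morph action_scale^~ m : a b / a + b}.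
Proof.
by move=> a b; rewrite -[a]quot_piK -[b]quot_piK -rmorphD !action_scale_pi apDl.
Qed.
HB.instance Definition _ := GRing.Zmodule_isLmodule.Build (jacobian S) W
  action_scaleA action_scale1 action_scaleDr action_scaleDl.

Definition of_action : lmodType (jacobian S) := W.

Lemma of_actionE x (m : U) : @act F V Q S of_action x m = T x m.
Proof. exact: action_scale_pi. Qed.

Lemma of_action_scale c (m : U) : (c *: (m : vspace_of of_action)) = c *: m.
Proof.
rewrite -[LHS]/(@act F V Q S of_action (cp_const Q c) m) of_actionE.
by rewrite /cp_const apZl ap1.
Qed.

End FromAction.
End Actions.

(** * Nilpotency, socles and the lifting property *)

Section Modules.
Variables (F : fieldType) (V : finType) (Q : quiver V).
Local Notation A := (cpalg F Q).
Implicit Types (x y z S : A) (a b : Q) (l : V) (s : seq Q).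

(** A form of Nakayama's lemma: [1 - x] is invertible by [geomK]. *)
Lemma mpow1_fix (U : lmodType F) (T : action Q U) x m : mpow 1 x -> T x m = m -> m = 0.
Proof.
move=> x1 xm; rewrite -(ap1 T m) -(geomK x1) apM.
by rewrite [T (1 - x) m]apBl ap1 xm subrr ap0.
Qed.

(* A non-vanishing path of length n on a space of dimension n would give n + 1 *)
(* vectors w_0, ..., w_n with w_j in m w_i for i < j; a linear relation        *)
(* between them then yields w_i = x w_i with x in m, where 1 - x is a unit.    *)
Lemma has_dim_nil (U : lmodType F) (T : action Q U) n m : has_dim U n -> nil T n m.
Proof.
move=> /has_dim_coord[f _ [g _ gK]]; apply: contrapT => nnil.
have chain d k : ~ nil T d k -> exists w : nat -> U, [/\ w 0%N = k, w d <> 0 &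
    forall i, (i < d)%N -> exists a, w i.+1 = T (arr F a) (w i)].
  elim: d k => [k /= k0|d IH k /= /existsNP[a /IH[w [w0 wd wS]]]].
    by exists (fun=> k); split.
  exists (fun i => if i is i'.+1 then w i' else k); split=> // -[_|i] /=.
    by exists a.
  by rewrite ltnS; apply: wS.
have [w [_ wn wS]] := chain _ _ nnil.
have wx i j : (i < j <= n)%N -> exists2 x, mpow 1 x & w j = T x (w i).
  elim: j => // j IH /andP[]; rewrite ltnS leq_eqVlt => /orP[/eqP ->|ij] jn.
    by have [a ->] := wS _ jn; exists (arr F a) => //; exact: mpow_arr.
  have [|x x1 xE] := IH; first by rewrite ij ltnW.
  have [a ->] := wS _ jn; exists (arr F a * x); last by rewrite apM xE.
  exact: mpowMr.
pose M : 'M[F]_(n.+1, n) := \matrix_i g (w i).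
have /rowV0Pn[c /sub_kermxP cM c0] : kermx M != 0.
  rewrite kermx_eq0 /row_free neq_ltn; apply/orP; left.
  by rewrite ltnS; exact: rank_leq_col.
have cw : \sum_(i < n.+1) c 0 i *: w i = 0.
  apply: (can_inj gK); rewrite linear0 linear_sum -[RHS]cM mulmx_sum_row; apply: eq_bigr => i _.
  by rewrite linearZ /= rowK.
have [i0 ci0] : exists i : 'I_n.+1, c 0 i != 0.
  by apply/existsP; move: c0; apply: contraR => /existsPn c0; apply/eqP/rowP => i; rewrite mxE; apply/eqP; rewrite -[_ == _]negbK.
case: (arg_minnP (fun i : 'I_n.+1 => nat_of_ord i) (P := fun i => c 0 i != 0) ci0) => i ci imin.
(* By minimality of [i], any other term of the relation either has coefficient 0 or an index after
   [i], and in the latter case it lies in m w_i. *)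
have cj (j : 'I_n.+1) : exists2 x, mpow 1 x & c 0 j *: w j = T x (w i) + (j == i)%:R *: (c 0 i *: w i).
  case: (ltngtP i j) => [ij|ji|/val_inj ij].
  - have [|x x1 xj] := wx i j; first by rewrite ij -ltnS ltn_ord.
    exists (c 0 j *: x); first exact: mpowZ.
    by rewrite apZl xj -val_eqE gtn_eqF // scale0r addr0.
  - exists 0; first exact: mpow0.
    have [/eqP cj0|/imin] := boolP (c 0 j == 0); last by rewrite leqNgt ji.
    by rewrite cj0 scale0r ap0l add0r -val_eqE ltn_eqF // scale0r.
  exists 0; first exact: mpow0.
  by rewrite ap0l add0r ij eqxx scale1r.
have [x x1 xE] : exists2 x, mpow 1 x & T x (w i) = w i.
  pose xj j := s2val (cid2 (cj j)).
  exists (\sum_j (- (c 0 i)^-1) *: xj j).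
    by apply: mpow_sum => j _; apply: mpowZ; rewrite /xj; case: cid2.
  rewrite -scaler_sumr apZl ap_suml.
  have -> : \sum_j T (xj j) (w i) = - (c 0 i *: w i).
    apply/eqP; rewrite -subr_eq0 opprK -{2}cw; apply/eqP.
    have -> : c 0 i *: w i = \sum_(j < n.+1) (j == i)%:R *: (c 0 i *: w i).
      rewrite (bigD1 i) //= eqxx scale1r big1 ?addr0 // => j /negPf ->.
      by rewrite scale0r.
    by rewrite -big_split; apply: eq_bigr => j _; rewrite /xj; case: cid2.
  by rewrite scalerN scaleNr opprK scalerA mulVf ?scale1r.
have wi0 := mpow1_fix x1 xE.
have [] := wn; have := ltn_ord i; rewrite ltnS leq_eqVlt => /orP[/eqP <- //|ilt].
by have [|y _ ->] := wx i n; [rewrite ilt leqnn | rewrite wi0 ap0].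
Qed.

Lemma hom_of (S : A) (M N : lmodType (jacobian S)) (f : M -> N) :
  (forall m n, f (m + n) = f m + f n) ->
  (forall x m, f (@act F V Q S M x m) = @act F V Q S N x (f m)) ->
  exists f' : {linear M -> N}, f' =1 f.
Proof.
move=> fD fa; have fl : linear f.
  by move=> q m n; rewrite fD -[q]quot_piK; congr (_ + _); apply: fa.
by exists (HB.pack f (GRing.isLinear.Build (jacobian S) M N _ f fl) : {linear M -> N}).
Qed.

Lemma hom_act (S : A) (M N : lmodType (jacobian S)) (f : {linear M -> N}) x m :
  f (@act F V Q S M x m) = @act F V Q S N x (f m).
Proof. exact: linearZ. Qed.

Lemma strip_cderiv b a S : tl b <> hd a -> strip b (cderiv a S) = 0.
Proof.
move=> ba; apply: wcoefP => v s; rewrite wcoef0 wcoef_strip wcoef_of.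
case: ifP => // _; rewrite big1 // => i _; apply: wcoef_out.
rewrite is_path_cat /= negb_and; apply/orP; right; rewrite negb_and; apply/orP; left.
have [i_s|i_s] := ltnP i (size (rcons s b)).
  rewrite -word_tl_cat cat_take_drop word_tl_rcons.
  by apply/eqP => E; apply: ba.
rewrite drop_oversize // /word_tl /= -/(word_tl v _) take_oversize // word_tl_rcons.
by apply/eqP => E; apply: ba.
Qed.

Lemma potentialP S : potential S <->
  forall v s, wcoef S v s != 0 -> (0 < size s)%N /\ v = word_tl v s.
Proof.
split=> [pS v s|pS p]; last by rewrite Defs.coefE => /pS.
by have [p|np] := boolP (is_path v s); [rewrite (wcoefE _ p) => /pS | rewrite wcoef_out ?eqxx].
Qed.

(** A constant term would come from a term of length 1 of [S], which would be a loop. *)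
Lemma cderiv_mpow1 a S : loop_free Q -> potential S -> mpow 1 (cderiv a S).
Proof.
move=> lf /potentialP pS v [|//] _; rewrite wcoef_of /= big_ord1 /=.
apply/eqP; apply: contraT => nz; have [_ E] := pS _ _ nz.
have : is_path v [:: a] by apply: contraT => np; rewrite wcoef_out ?eqxx in nz.
by rewrite /= andbT; move: E; rewrite /word_tl /= => ->; rewrite (negPf (lf a)).
Qed.

(* Ext^1(S_j, U) = 0 for all vertices j. *)
Definition lifts (U : lmodType F) (T : action Q U) S :=
  forall y : Q -> U, (forall b, T (vtx F Q (hd b)) (y b) = y b) ->
  (forall a, \sum_b T (strip b (cderiv a S)) (y b) = 0) ->
  exists m, forall b, y b = T (arr F b) m.

Definition socle_spanned (U : lmodType F) (T : action Q U) l (s : U) :=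
  [/\ s != 0, T (vtx F Q l) s = s, forall a, T (arr F a) s = 0 &
      forall m, (forall a, T (arr F a) m = 0) -> exists c, m = c *: s].

Lemma ap_socle (U : lmodType F) (T : action Q U) x m :
  (forall a, T (arr F a) m = 0) -> T x m = \sum_i wcoef x i [::] *: T (vtx F Q i) m.
Proof.
move=> am; rewrite ap_strip [X in _ + X]big1 ?addr0 // => a _.
by rewrite am ap0.
Qed.

Lemma ap_socle_vtx (U : lmodType F) (T : action Q U) l x m :
  (forall a, T (arr F a) m = 0) -> T (vtx F Q l) m = m -> T x m = wcoef x l [::] *: m.
Proof.
move=> am lm; rewrite ap_socle // (bigD1 l) //= lm big1 ?addr0 // => i /negPf il.
by rewrite -lm ap_vtx_vtx il scaler0.
Qed.

(** * Injective envelopes *)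

Section Envelope.
Variables (S : A) (M : lmodType (jacobian S)).
Local Notation T := (act_action M).

(** By essentiality every nonzero submodule contains the generator [s] of the image of the simple.
    If all arrows kill [m], each component of [m] at a vertex spans a submodule, hence is zero or
    proportional to [s]. *)
Lemma envelope_socle l : indec_injective l M -> exists s : vspace_of M,
  [/\ socle_spanned T l s,
      forall P : set M, is_submod P -> (exists2 x, P x & x != 0) -> P s &
      exists2 E : lmodType (jacobian S), simple_at l E &
       exists2 i : {linear E -> M}, injective i & exists e, i e = s].
Proof.
case=> E sE [injM [i [ii ess]]]; have [f [g fK gK] fE] := sE.
pose s : vspace_of M := i (g 1).
have iE (e : E) : i e = jac S (@cp_const F V Q (f e)) *: (s : M).
  rewrite -linearZ; congr (i _); rewrite -[RHS]/(f e *: (g 1 : vspace_of E)).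
  by apply: (can_inj fK); rewrite linearZ /= gK; exact: (esym (mulr1 (f e))).
have s0 : s != 0.
  apply/eqP => s0; have : g 1 = 0 by apply: ii; rewrite linear0.
  move/(congr1 f); rewrite gK linear0 => /eqP; exact/negP/oner_neq0.
have key (P : set M) : is_submod P -> (exists2 x, P x & x != 0) -> P s.
  move=> Psub /(ess _ Psub)[e Pe e0]; have [P0 PD] := Psub.
  have fe : f e != 0 by apply: contraNneq e0 => fe; rewrite iE fe /cp_const scale0r rmorph0 scale0r.
  have -> : s = jac S (@cp_const F V Q (f e)^-1) *: (i e) + 0.
    rewrite iE scalerA -rmorphM /cp_const -cp_scalerAl mul1r scalerA mulVf // scale1r.
    by rewrite rmorph1 scale1r addr0.
  exact: PD.
have sl x : T x s = wcoef x l [::] *: s.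
  rewrite /= /act -linearZ -[jac S x *: _]/(act x (g 1 : vspace_of E)).
  rewrite -[RHS]/(jac S (@cp_const F V Q (wcoef x l [::])) *: i (g 1)) -linearZ; congr (i _).
  apply: (can_inj fK); rewrite fE gK.
  rewrite -[jac S _ *: g 1]/(wcoef x l [::] *: (g 1 : vspace_of E)).
  by rewrite linearZ /= gK.
exists s; split=> //; last by exists E => //; exists i => //; exists (g 1).
split=> //.
- by rewrite sl wcoef_vtx eqxx scale1r.
- by move=> a; rewrite sl wcoef_arr scale0r.
move=> m am.
have mj j : exists c, T (vtx F Q j) m = c *: s.
  have [->|mj0] := eqVneq (T (vtx F Q j) m) 0; first by exists 0; rewrite scale0r.
  pose P : set M := [set n | exists c, n = c *: T (vtx F Q j) m :> vspace_of M].
  have ajm a : T (arr F a) (T (vtx F Q j) m) = 0.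
    have [->|ne] := eqVneq j (tl a); first by rewrite ap_arr_vtx am.
    by rewrite ap_arr_vtx0.
  have [|| c sc] := key P; first split.
  - by exists 0; rewrite scale0r.
  - move=> q _ _ [c1 ->] [c2 ->]; rewrite -[q]quot_piK.
    exists (wcoef (repr q) j [::] * c1 + c2).
    rewrite scalerDl; congr (_ + _).
    rewrite -[LHS]/(T (repr q) (c1 *: T (vtx F Q j) m)) apZ.
    by rewrite (ap_socle_vtx _ ajm (l := j)) ?ap_vtx_vtx ?eqxx // scalerA mulrC.
  - by exists (T (vtx F Q j) m) => //; exists 1; rewrite scale1r.
  have c0 : c != 0 by apply: contraNneq s0 => c0; rewrite sc c0 scale0r.
  by exists c^-1; rewrite sc scalerA mulVf ?scale1r.
exists (\sum_j projT1 (cid (mj j))); rewrite scaler_suml -[LHS](ap_vtx_sum T).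
by apply: eq_bigr => j _; case: cid.
Qed.

End Envelope.
End Modules.

Section Envelopes.
Variables (F : fieldType) (V : finType) (Q : quiver V).
Local Notation A := (cpalg F Q).
Implicit Types (x z S : A) (a b : Q) (l : V).

(** * Extensions of a sum of simples, and the lifting property of injectives *)

Section Extension.
Variables (U : lmodType F) (T : action Q U) (d : nat).
Hypothesis nilT : forall m, nil T d m.
Variable y : Q -> U.
Hypothesis y_vtx : forall b, T (vtx F Q (hd b)) (y b) = y b.

Local Notation X := (U * {ffun V -> F^o})%type.

Definition ext_vtx (i : V) (m : X) : X :=
  (T (vtx F Q i) m.1, [ffun j => if i == j then m.2 j else 0]).
(** The extension of the sum of all simples by [U] with cocycle [y]: there is one new basis vector
    per vertex, and [b] sends the one at [tl b] to [y b]. *)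
Definition ext_arr (b : Q) (m : X) : X := (T (arr F b) m.1 + (m.2 (tl b) : F) *: y b, 0).

Fact ext_vtx_linear i : linear (ext_vtx i).
Proof.
move=> c m n; rewrite /ext_vtx; congr (_, _); first by rewrite apD apZ.
by apply/ffunP => j; rewrite !ffunE; case: eqP; rewrite ?scaler0 ?addr0.
Qed.
HB.instance Definition _ i := GRing.isLinear.Build F X X _ (ext_vtx i) (ext_vtx_linear i).

Fact ext_arr_linear b : linear (ext_arr b).
Proof.
move=> c m n; rewrite /ext_arr; congr (_, _); last by rewrite /= scaler0 addr0.
by rewrite /= apD apZ !ffunE scalerDl scalerDr scalerA addrACA.
Qed.
HB.instance Definition _ b := GRing.isLinear.Build F X X _ (ext_arr b) (ext_arr_linear b).

Lemma ext_rep : is_nilrep ext_vtx ext_arr d.+1.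
Proof.
have r_nil n m : nil T n m -> rnil ext_arr n (m, 0).
  elim: n m => [m /= -> //|n IH m /= nm a].
  by rewrite /= /ext_arr /= ffunE scale0r addr0; apply: IH.
split.
- move=> i j m; rewrite /= /ext_vtx /= ap_vtx_vtx; case: eqP => [->|ij].
    by congr (_, _); apply/ffunP => k; rewrite !ffunE; case: eqP.
  congr (_, _); apply/ffunP => k; rewrite !ffunE; case: eqP => // <-.
  by case: eqP => // ji; case: ij.
- case=> m c; rewrite -[RHS]/(m, c).
  have -> : \sum_i ext_vtx i (m, c) =
      (\sum_i T (vtx F Q i) m, \sum_i [ffun j => if i == j then c j else 0]).
    by apply: (big_ind3 (fun (p : X) u v => p = (u, v))) => // p u v p' u' v' -> ->.
  rewrite ap_vtx_sum; congr (_, _); apply/ffunP => j; rewrite sum_ffunE (bigD1 j) //=.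
  by rewrite ffunE eqxx big1 ?addr0 // => i /negPf ij; rewrite ffunE ij.
- move=> a i m; rewrite /= /ext_arr /= ffunE; case: eqP => [->|/eqP ia].
    by rewrite ap_arr_vtx.
  by rewrite ap_arr_vtx0 // scale0r add0r.
- move=> a i m; rewrite /= /ext_vtx /= apD apZ.
  have -> : [ffun j => if i == j then (0 : {ffun V -> F^o}) j else 0] = 0.
    by apply/ffunP => j; rewrite !ffunE if_same.
  case: eqP => [->|/eqP ia]; first by rewrite ap_vtx_arr y_vtx.
  by rewrite ap_vtx_arr0 // -y_vtx ap_vtx_vtx (negPf ia) scaler0 addr0.
case=> m c a /=; apply: r_nil; apply: nilT.
Qed.

Definition ext_action := rep_action ext_rep.

Definition ext_inl (m : U) : X := (m, 0).
Fact ext_inl_linear : linear ext_inl.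
Proof. by move=> c m n; congr (_, _); rewrite /= scaler0 addr0. Qed.
HB.instance Definition _ := GRing.isLinear.Build F U X _ ext_inl ext_inl_linear.

Lemma ext_inl_hom x m : ext_inl (T x m) = ext_action x (ext_inl m).
Proof.
apply: (@ap_hom _ _ _ _ _ T ext_action ext_inl d) => // [i n|a n].
  rewrite /ext_action rep_action_vtx; congr (_, _).
  by apply/ffunP => j; rewrite !ffunE if_same.
rewrite /ext_action rep_action_arr; congr (_, _).
by rewrite /= ffunE scale0r addr0.
Qed.

(** Only arrows with tail [hd a] occur last in the derivative along [a]; on the new vectors it
    therefore acts by [c (hd a)] times the sum assumed to vanish. *)
Lemma ext_kills S : loop_free Q -> potential S -> kills T S ->
  (forall a, \sum_b T (strip b (cderiv a S)) (y b) = 0) -> kills ext_action S.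
Proof.
move=> lf pS kS yS; apply: (@kills_of_deriv _ _ _ _ _ S d.+1); first exact: rep_action_nil.
move=> a [m c].
rewrite ap_strip1; last exact: cderiv_mpow1.
have strE b : ext_action (strip b (cderiv a S)) (ext_action (arr F b) (m, c)) =
    ext_inl (T (strip b (cderiv a S)) (T (arr F b) m) + (c (hd a) : F) *: T (strip b (cderiv a S)) (y b)).
  rewrite [ext_action (arr F b) _]rep_action_arr -/(ext_inl _) -ext_inl_hom apD apZ /=.
  have [->//|/eqP ne] := eqVneq (tl b) (hd a).
  by rewrite strip_cderiv // !ap0l !scaler0.
under eq_bigr do rewrite strE.
rewrite -linear_sum big_split -scaler_sumr /= yS scaler0 addr0.
rewrite -ap_strip1; last exact: cderiv_mpow1.
rewrite kS ?linear0 //; apply: sub_closure => I _ sI; apply: sI.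
by exists a.
Qed.

End Extension.

(** By injectivity the inclusion of the module in its extension with cocycle [y] has a retraction,
    and the retraction makes the cocycle a coboundary. *)
Lemma envelope_lifts S (M : lmodType (jacobian S)) l d :
  loop_free Q -> potential S -> (forall m, nil (act_action M) d m) ->
  indec_injective l M -> lifts (act_action M) S.
Proof.
move=> lf pS nM [E sE [injM _]] y yv yS.
have kX := @ext_kills _ _ _ nM _ yv _ lf pS (@act_kills _ _ _ S M) yS.
pose X := of_action kX.
have [||i iE] := @hom_of _ _ _ S M X (@ext_inl (vspace_of M)).
- by move=> m n; congr (_, _); rewrite addr0.
- by move=> x m; rewrite of_actionE -ext_inl_hom.
have [|h hE] := injM _ _ i idfun; first by move=> m n; rewrite !iE => -[].
(* The retraction of the sum of all new vectors; the arrow [b] sees only the one at its tail. *)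
exists (h (0, [ffun=> 1])) => b.
rewrite -[RHS]/(@act F V Q S M (arr F b) _) -hom_act of_actionE rep_action_arr.
transitivity (h (ext_inl (y b))); first by rewrite -iE hE.
congr (h _); symmetry; congr (_, _).
by rewrite [X in X + _](ap0 (act_action M)) add0r ffunE scale1r.
Qed.

(** While some arrow does not kill the vector, apply it; nilpotency ends this in the socle, at a
    nonzero multiple of [s]. *)
Lemma socle_reach (U : lmodType F) (T : action Q U) l s d m :
  socle_spanned T l s -> nil T d m -> m != 0 -> exists x, T x m = s.
Proof.
move=> [s0 ls as0 sS]; elim: d m => [m /= -> /eqP//|d IH m dm m0].
have [am|/existsNP[a /eqP am]] := pselect (forall a, T (arr F a) m = 0).
  have [c mc] := sS _ am.
  have c0 : c != 0 by apply: contraNneq m0 => c0; rewrite mc c0 scale0r.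
  by exists (c^-1 *: (1 : A)); rewrite apZl ap1 mc scalerA mulVf ?scale1r.
by have [x xm] := IH _ (dm a) am; exists (x * arr F a); rewrite apM.
Qed.

Lemma arr_vtx_hd x b : x * vtx F Q (hd b) * arr F b = x * arr F b.
Proof. by rewrite -mulrA vtx_arr eqxx scale1r. Qed.

Lemma socle_functional (U : lmodType F) (T : action Q U) l s :
  finite_dim U -> socle_spanned T l s -> exists phi : {linear U -> F^o},
    phi s = 1 /\ forall m, phi (T (vtx F Q l) m) = phi m.
Proof.
move=> /finite_dim_coord[n [g gi]] [s0 ls _ _].
have gs0 : g s != 0 by apply: contraNneq s0 => gs0; apply/eqP/gi; rewrite gs0 linear0.
have [j gj] : exists j, g s 0 j != 0.
  apply/existsP; move: gs0; apply: contraR => /existsPn gj; apply/eqP/rowP => j.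
  by rewrite mxE; apply/eqP; rewrite -[_ == _]negbK.
pose f (m : U) : F^o := (g s 0 j)^-1 * (g (T (vtx F Q l) m)) 0 j.
have fl : linear f.
  by move=> c m1 m2; rewrite /f apD apZ linearP !mxE mulrDr mulrCA.
exists (HB.pack f (GRing.isLinear.Build F U F^o _ f fl) : {linear U -> F^o}).
split=> [|m]; first by rewrite /= /f ls mulVf.
by rewrite /= /f ap_vtx_vtx eqxx.
Qed.

(* The functionals phi o u with u in e_l A exhaust the dual of U; the kernel   *)
(* of u |-> phi o u is e_l J, because a relation sum_b phi u_b b = 0 lifts, by *)
(* the dual of [lifts], to u_b = sum_a v_a (d_a S / b) modulo this kernel.     *)
Lemma annihilator_jac S (U : lmodType F) (T : action Q U) l s d (phi : {linear U -> F^o}) u :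
  loop_free Q -> potential S -> finite_dim U -> (forall m, nil T d m) ->
  socle_spanned T l s -> lifts T S ->
  phi s = 1 -> (forall m, phi (T (vtx F Q l) m) = phi m) ->
  (forall m, phi (T u m) = 0) -> ideal_set (jac_ideal S) (vtx F Q l * u).
Proof.
move=> lf pS fU nU soc lft phis phil phiu; apply/madic_closureP => N.
(* The pairing of [A] with [U] given by [phi] is nondegenerate on the side of [U]. *)
have sep m : (forall v, phi (T v m) = 0) -> m = 0.
  move=> vm; apply/eqP; apply: contraT => /(socle_reach soc (nU m))[v vs].
  by have := vm v; rewrite vs phis => /eqP; rewrite oner_eq0.
have [s0 ls as0 _] := soc.
elim: N u phiu => [u _|N IH u phiu].
  by exists 0 => // I [I0 _ _ _] _.
set u' := vtx F Q l * u.
have lu' : vtx F Q l * u' = u' by rewrite mulrA vtx_mul eqxx scale1r.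
have phiu' m : phi (T u' m) = 0 by rewrite apM phil.
have u'1 : mpow 1 u'.
  move=> v [|//] _; have [->|vl] := eqVneq v l; last by rewrite wcoef_vtx_mul (negPf vl).
  have := phiu' s; rewrite (ap_socle_vtx (l := l)) // linearZ /= phis => E.
  by rewrite -[LHS]mulr1.
pose D a b := strip b (cderiv a S) * vtx F Q (hd b).
(* On families [y], [theta] comes from the quotients of [u'] by the arrows, and [om v] from the
   quotients of the combination of cyclic derivatives with left coefficients [v]. The aim is
   [theta = om v] for some [v]. *)
pose theta (y : {ffun Q -> U}) : F := \sum_b phi (T (strip b u' * vtx F Q (hd b)) (y b)).
pose om (v : Q -> A) (y : {ffun Q -> U}) : F := \sum_a phi (T (v a) (\sum_b T (D a b) (y b))).
have omE v y : om v y = \sum_b phi (T (\sum_a v a * D a b) (y b)).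
  rewrite /om; under eq_bigr => a _ do rewrite ap_sum linear_sum.
  rewrite exchange_big; apply: eq_bigr => b _; rewrite ap_suml linear_sum.
  by apply: eq_bigr => a _; rewrite apM.
have lin_sum (t : Q -> A) : scalar (fun y : {ffun Q -> U} => \sum_b phi (T (t b) (y b)) : F).
  move=> c y1 y2 /=; rewrite mulr_sumr -big_split; apply: eq_bigr => b _ /=.
  by rewrite !ffunE apD apZ linearP.
have [||||||v vE] := @double_annihilator _ _ [set w | exists v, w = om v] theta.
- exact: finite_dim_ffun.
- move=> w [v ->] c y1 y2; rewrite !omE; exact: lin_sum.
- exists (fun=> 0); apply/funext => y; rewrite omE big1 // => b _.
  by rewrite big1 ?ap0l ?linear0 // => a _; rewrite mul0r.
- move=> c _ _ [v1 ->] [v2 ->]; exists (fun a => c *: v1 a + v2 a); apply/funext => y.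
  rewrite !omE mulr_sumr -big_split; apply: eq_bigr => b _ /=.
  rewrite -linearP -apZl -apDl scaler_sumr -big_split; congr (phi (T _ _)).
  by apply: eq_bigr => a _; rewrite mulrDl cp_scalerAl.
- exact: lin_sum.
(* A common zero of all [om v] satisfies the relations of [lifts]. Its components at the heads of
   the arrows are then the b m for one [m], and [theta y] becomes [phi (T u' m)], which is 0. *)
- move=> y omy.
  have Dy a : \sum_b T (D a b) (y b) = 0.
    apply: sep => v; have := omy (om (fun a' => if a' == a then v else 0)).
    rewrite /om (bigD1 a) //= eqxx [X in _ + X]big1 ?addr0 => [-> //|a' /negPf a'a]; last first.
      by rewrite a'a ap0l linear0.
    by exists (fun a' => if a' == a then v else 0).
  have [b|a|m ym] := lft (fun b => T (vtx F Q (hd b)) (y b)).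
  + by rewrite ap_vtx_vtx eqxx.
  + by rewrite -[RHS](Dy a); apply: eq_bigr => b _; rewrite apM.
  rewrite /theta; under eq_bigr => b _ do rewrite apM ym.
  by rewrite -linear_sum -ap_strip1 ?phiu'.
have phit b m : phi (T (strip b u' * vtx F Q (hd b) - \sum_a v a * D a b) m) = 0.
  have /(congr1 (fun w => w [ffun b' => if b' == b then m else 0])) := vE.
  rewrite omE /theta (bigD1 b) //= [in RHS](bigD1 b) //= !ffunE eqxx.
  rewrite [X in _ + X = _]big1 ?addr0 => [|b' /negPf b'b]; last by rewrite ffunE b'b ap0 linear0.
  rewrite [X in _ = _ + X]big1 ?addr0 => [E|b' /negPf b'b]; last by rewrite ffunE b'b ap0 linear0.
  by rewrite apBl linearB /= E subrr.
have IHb b := IH _ (phit b).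
pose z b := s2val (cid2 (IHb b)).
(* The first sum approximates, up to order [N] in each quotient by [b], what the combination of
   derivatives leaves of [u']; multiplication by the arrow gains the missing order. *)
exists (\sum_b z b * arr F b + \sum_a vtx F Q l * v a * cderiv a S).
  have zI b : ideal_span [set cderiv a S | a in [set: Q]] (z b) by rewrite /z; case: cid2.
  move=> I II DI; have [I0 IB IMl IMr] := II.
  have ID x1 x2 : I x1 -> I x2 -> I (x1 + x2).
    by move=> Ix1 Ix2; rewrite -[x2]opprK; apply: (IB) => //; rewrite -sub0r; apply: (IB).
  apply: (ID); apply: big_ind => // b _; first by apply: IMr; apply: zI.
  by apply: IMl; apply: DI; exists b.
have -> : u' - (\sum_b z b * arr F b + \sum_a vtx F Q l * v a * cderiv a S) =
  \sum_b (vtx F Q l * (strip b u' * vtx F Q (hd b) - \sum_a v a * D a b) - z b) * arr F b.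
  rewrite opprD addrA addrAC; under [RHS]eq_bigr => b _ do rewrite mulrBl.
  rewrite sumrB; congr (_ - _).
  under [RHS]eq_bigr => b _ do rewrite mulrBr mulrBl mulrA arr_vtx_hd.
  rewrite sumrB; congr (_ - _).
    by rewrite -{1}lu' {1}(strip_decomp1 u'1) mulr_sumr; apply: eq_bigr => b _; rewrite mulrA.
  under [RHS]eq_bigr => b _ do rewrite mulr_sumr mulr_suml.
  rewrite exchange_big; apply: eq_bigr => a _ /=.
  rewrite [in LHS](strip_decomp1 (@cderiv_mpow1 _ _ _ a S lf pS)) mulr_sumr.
  by apply: eq_bigr => b _; rewrite /D !mulrA arr_vtx_hd.
apply: mpow_sum => b _; rewrite -addn1; apply: mpowM; last exact: mpow_arr.
by rewrite /z; case: cid2.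
Qed.

(** Since m^d kills [U], its elements give the zero functional, so [annihilator_jac] applies. The
    consequence concerns every module over the Jacobian algebra: e_l m^d acts on it by zero. *)
Lemma lifts_jac S (U : lmodType F) (T : action Q U) l s d x :
  loop_free Q -> potential S -> finite_dim U -> (forall m, nil T d m) ->
  socle_spanned T l s -> lifts T S -> mpow d x ->
  ideal_set (jac_ideal S) (vtx F Q l * x).
Proof.
move=> lf pS fU nU soc lft xd; have [phi [phis phil]] := socle_functional fU soc.
apply: (annihilator_jac lf pS fU nU soc lft phis phil) => m.
by rewrite (ap_order xd) ?linear0.
Qed.

End Envelopes.

(** * Recognition of the injective envelope *)

Section Uniqueness.
Variables (F : fieldType) (V : finType) (Q : quiver V).
Local Notation A := (cpalg F Q).

Lemma ker0_inj (U W : zmodType) (h : {additive U -> W}) :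
  (forall m, h m = 0 -> m = 0) -> injective h.
Proof. by move=> h0 m n hmn; apply/eqP; rewrite -subr_eq0; apply/eqP/h0; rewrite raddfB hmn subrr. Qed.

Lemma nil_mpow (U : lmodType F) (T : action Q U) d m :
  (forall x, mpow d x -> T x m = 0) -> nil T d m.
Proof.
elim: d m => [m m0|d IH m dm a]; first by rewrite /= -(ap1 T m) m0.
apply: IH => x xd; rewrite -apM; apply: dm; rewrite -addn1.
by apply: mpowM => //; exact: mpow_arr.
Qed.

(* Injectivity of M extends E -> M to the whole of U; as e_l m^d lies in J(S), *)
(* M is killed by m^d like U, and the lifting property of U then absorbs the   *)
(* elements of M one socle layer after the other.                              *)
Lemma envelope_iso (S : A) (U : lmodType F) (T : action Q U) l s d
    (M : lmodType (jacobian S)) :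
  loop_free Q -> potential S -> finite_dim U -> (forall m, nil T d m) -> kills T S ->
  socle_spanned T l s -> lifts T S -> indec_injective l M ->
  exists2 h : {linear U -> vspace_of M}, bijective h &
    forall x m, h (T x m) = @act F V Q S M x (h m).
Proof.
move=> lf pS fU nU kU soc lft envM; pose X := of_action kU.
have [s' [[s'0 ls' as' soc'] s'key [E [f [g fK gK] fE] [i ii [e0 ie0]]]]] := envelope_socle envM.
have [s0 ls as0 socS] := soc.
(* The line of [s] is a copy of the simple; injectivity of [M] will extend its embedding in [M] to
   all of [U]. *)
have [j jE] : exists j : {linear E -> X}, j =1 fun e => (f e : F) *: (s : U).
  apply: hom_of => [m n|x m]; first by rewrite linearD scalerDl.
  by rewrite of_actionE fE apZ (ap_socle_vtx (l := l)) // scalerA mulrC.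
have ji : injective j.
  move=> e1 e2; rewrite !jE => e12; apply: (can_inj fK); apply/eqP.
  have /eqP : (f e1 - f e2 : F) *: s = 0.
    by rewrite scalerBl; apply/eqP; rewrite subr_eq0; apply/eqP.
  by rewrite scaler_eq0 (negPf s0) orbF subr_eq0.
have [_ _ [injM _]] := envM.
have [h hE] := injM _ _ j i ji.
have ha x (m : U) : h (T x m) = @act F V Q S M x (h m).
  by rewrite -hom_act of_actionE.
have hZ (c : F) (m : U) : h (c *: m) = c *: (h m : vspace_of M).
  rewrite -(of_action_scale kU) -[RHS]/(@act F V Q S M (@cp_const F V Q c) (h m)) -ha.
  by congr (h _); exact: of_actionE.
have hl : linear (h : U -> vspace_of M) by move=> c m n; rewrite -hZ; apply: (raddfD h).
pose k : {linear U -> vspace_of M} := HB.pack (h : U -> vspace_of M)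
  (GRing.isLinear.Build F U (vspace_of M) _ (h : U -> vspace_of M) hl).
have khs : k s != 0.
  apply: contraNneq s'0 => ks; have := hE e0; rewrite jE ie0 => <-.
  by rewrite [h _]hZ -[h s]/(k s) ks scaler0.
have kinj : injective k.
  apply: ker0_inj => m km; apply/eqP; apply: contraT => /(socle_reach soc (nU m))[x xm].
  by move: khs; rewrite -xm [k _]ha [h m]km linear0 eqxx.
have nM y : nil (act_action M) d y.
  apply: nil_mpow => x xd; apply/eqP; apply: contraT => xy.
  (* The largest submodule of [M] without component at [l]. If it were nonzero it would contain
     [s'], which lies at [l]. *)
  pose P : set M := [set w | forall u, act (vtx F Q l * u) (w : vspace_of M) = 0].
  have Psub : is_submod P.
    split=> [u|q w1 w2 P1 P2 u]; first exact: linear0.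
    rewrite [act _ _](apD (act_action M)) [X in _ + X]P2 addr0 -[q]quot_piK.
    rewrite -[quot_pi _ _ *: _]/(act (repr q) (w1 : vspace_of M)).
    by rewrite -[LHS](apM (act_action M)) -mulrA; apply: P1.
  have Ps' : P s'.
    apply: s'key Psub _; exists (act x (y : vspace_of M)) => // u.
    rewrite -[LHS](apM (act_action M)) -mulrA; apply: (@act_kills F V Q S M).
    by apply: (lifts_jac lf pS fU nU soc lft); apply: mpowMr.
  have := Ps' 1; rewrite mulr1 => ls'0.
  by move: s'0; rewrite -ls' [act_action M _ _]ls'0 eqxx.
exists k => //; have [c0 s'E] : exists c, c *: k s = s'.
  have [c ksE] : exists c, k s = c *: s'.
    by apply: soc' => a; rewrite -[LHS]ha as0 linear0.
  have c0 : c != 0 by apply: contraNneq khs => c0; rewrite ksE c0 scale0r.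
  by exists c^-1; rewrite ksE scalerA mulVf ?scale1r.
have surj n y : nil (act_action M) n y -> exists m, k m = y.
  elim: n y => [y /= ->|n IH y ny]; first by exists 0; rewrite linear0.
  (* The [z a] are preimages of the a y. They satisfy the relations because [k] is injective; an [m]
     with a m = z a leaves [y - k m] in the socle, whose generator [s'] is a multiple of [k s]. *)
  pose z a := projT1 (cid (IH _ (ny a))).
  have kz a : k (z a) = act (arr F a) y by rewrite /z; case: cid.
  have [a|a|m zm] := lft z.
  - by apply: kinj; rewrite [k _]ha [h _]kz kz; apply: (ap_vtx_arr (act_action M)).
  - apply: kinj; rewrite linear0 linear_sum.
    under eq_bigr => b _ do rewrite [k _]ha [h _]kz.
    rewrite -[LHS](@ap_strip1 _ _ _ _ (act_action M)); last exact: cderiv_mpow1.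
    by apply: (@act_kills F V Q S M); apply: sub_closure => I _ DI; apply: DI; exists a.
  have [a|c yE] := soc' (y - k m).
    by rewrite apB -[X in _ - X]ha -zm [X in _ - X]kz subrr.
  exists (m + (c * c0) *: s); rewrite linearD linearZ /= -scalerA s'E -yE.
  by rewrite addrC subrK.
pose k' y := projT1 (cid (surj _ _ (nM y))).
have gK' : cancel k' k by move=> y; rewrite /k'; case: cid.
by exists k' => // m; apply: kinj; rewrite gK'.
Qed.

End Uniqueness.

Lemma sum_triangle (U : zmodType) (G : nat -> nat -> U) n :
  \sum_(i < n.+1) \sum_(j < i.+1) G i j =
  \sum_(j < n.+1) \sum_(i < (n - j).+1) G (j + i)%N j.
Proof.
elim: n G => [|n IH] G; first by rewrite !big_ord1.
under eq_bigr => i _ do rewrite big_ord_recl.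
rewrite big_split [RHS]big_ord_recl /=; congr (_ + _).
rewrite big_ord_recl big_ord0 add0r.
exact: (IH (fun i j => G i.+1 j.+1)).
Qed.

(** * Cyclic chain rule and Jacobian ideals *)

Section CyclicDerivative.
Variables (F : fieldType) (V : finType) (Q : quiver V).
Local Notation A := (cpalg F Q).
Implicit Types (x y z g S : A) (a b c : Q) (v : V) (s w : seq Q).

Definition strips w x : A := foldr (@strip F V Q) x w.

Lemma wcoef_strips w x v s : wcoef (strips w x) v s = wcoef x v (s ++ w).
Proof.
elim: w s => [|a w IH] s; first by rewrite cats0.
by rewrite /= wcoef_strip IH cat_rcons.
Qed.

Fact strips_linear w : linear (strips w).
Proof.
elim: w => [//|a w IH] c x y.
by rewrite -[LHS]/(strip a (strips w (c *: x + y))) IH linearP.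
Qed.
HB.instance Definition _ w := GRing.isLinear.Build F A A _ (strips w) (strips_linear w).

Lemma mpow_strips w n x : mpow (size w + n) x -> mpow n (strips w x).
Proof.
by move=> xn v s sn; rewrite wcoef_strips xn // size_cat addnC ltn_add2l.
Qed.

(** Either [w] is removed from [y] alone, or it is cut: its end is a full term of [y] and its
    beginning is removed from [x]. [v] is a placeholder, as the tail of the nonempty word
    [take j.+1 w] does not depend on it. *)
Lemma strips_mul v w x y : strips w (x * y) = x * strips w y +
  \sum_(j < size w) wcoef y (word_tl v (take j.+1 w)) (drop j.+1 w) *: strips (take j.+1 w) x.
Proof.
elim: w v => [|a w IH] v; first by rewrite big_ord0 addr0.
rewrite -[LHS]/(strip a (strips w (x * y))) (IH (tl a)) raddfD /= strip_mul wcoef_strips.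
rewrite [in RHS]big_ord_recl -!addrA /= take0 drop0; congr (_ + (_ + _)).
by rewrite (linear_sum (strip a)); apply: eq_bigr => j _; rewrite linearZ.
Qed.

(* For a cyclic path x = p b q this is q g p: the sum over the occurrences of  *)
(* b in x of x with b removed and g inserted on the other side.                *)
Definition cyc_insert b x g : A := of_wcoef (fun v s => (v == tl b)%:R *
  \sum_(i < (size s).+1)
     wcoef (g * strips (b :: take i s) x) (word_tl v (take i s)) (drop i s)).

Lemma wcoef_cyc_insert b x g v s : is_path v s ->
  wcoef (cyc_insert b x g) v s = (v == tl b)%:R *
  \sum_(i < (size s).+1)
     wcoef (g * strips (b :: take i s) x) (word_tl v (take i s)) (drop i s).
Proof. by move=> p; rewrite wcoef_of p. Qed.

Lemma cyc_insert_linearl b g : linear (cyc_insert b ^~ g).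
Proof.
move=> c x y; apply: wcoefP => v s; rewrite wcoefD wcoefZ !wcoef_of.
case: ifP => _; last by rewrite mulr0 addr0.
rewrite mulrCA -mulrDr; congr (_ * _); rewrite mulr_sumr -big_split; apply: eq_bigr => i _.
by rewrite linearP mulrDr -cp_scalerAr wcoefD wcoefZ.
Qed.

Lemma cyc_insert_linear b x : linear (cyc_insert b x).
Proof.
move=> c g h; apply: wcoefP => v s; rewrite wcoefD wcoefZ !wcoef_of.
case: ifP => _; last by rewrite mulr0 addr0.
rewrite mulrCA -mulrDr; congr (_ * _); rewrite mulr_sumr -big_split; apply: eq_bigr => i _.
by rewrite mulrDl -cp_scalerAl wcoefD wcoefZ.
Qed.
HB.instance Definition _ b x :=
  GRing.isLinear.Build F A A _ (cyc_insert b x) (cyc_insert_linear b x).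

Definition cyc_insertl b g x := cyc_insert b x g.
HB.instance Definition _ b g :=
  GRing.isLinear.Build F A A _ (cyc_insertl b g) (cyc_insert_linearl b g).

Lemma cyc_insert_suml b g I (r : seq I) (P : pred I) (f : I -> A) :
  cyc_insert b (\sum_(i <- r | P i) f i) g = \sum_(i <- r | P i) cyc_insert b (f i) g.
Proof. exact: (linear_sum (cyc_insertl b g)). Qed.

(** The removed [b] lies in [x] or in [y], and on the circle the other factor is adjacent to the
    inserted element. For [g = 1] the right side is symmetric, so x y and y x have the same
    derivative. *)
Lemma cyc_insert_leibniz b x y g :
  cyc_insert b (x * y) g = cyc_insert b x (y * g) + cyc_insert b y (g * x).
Proof.
apply: wcoefP => v s; rewrite wcoefD.
have [p|np] := boolP (is_path v s); last by rewrite !wcoef_out ?addr0.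
rewrite !wcoef_cyc_insert // -mulrDr; have [vb|_] := eqVneq v (tl b); last by rewrite !mul0r.
congr (_ * _).
under eq_bigr => i _ do rewrite (strips_mul v) mulrDr wcoefD.
rewrite big_split addrC; congr (_ + _); first by apply: eq_bigr => i _; rewrite mulrA.
have wE t : word_tl v (b :: t) = word_tl (tl b) t by [].
pose G i j := wcoef y (word_tl v (take j s)) (drop j (take i s)) *
  wcoef (g * strips (b :: take j s) x) (word_tl v (take i s)) (drop i s).
transitivity (\sum_(i < (size s).+1) \sum_(j < i.+1) G i j).
  apply: eq_bigr => i _; have le_i : (i <= size s)%N by rewrite -ltnS.
  rewrite [size (b :: _)]/= size_takel // mulr_sumr wcoef_sum; apply: eq_bigr => j _.
  rewrite -cp_scalerAr wcoefZ /G [take j.+1 _]/= [drop j.+1 _]/= wE -vb.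
  by rewrite take_takel // -ltnS ltn_ord.
rewrite sum_triangle; apply: eq_bigr => j _; have le_j : (j <= size s)%N by rewrite -ltnS.
rewrite -mulrA wcoef_mul size_drop; apply: eq_bigr => i _.
by rewrite /G [(j + i)%N]addnC -take_drop drop_drop addnC takeD word_tl_cat.
Qed.

Lemma cyc_insert_vtx b i g : cyc_insert b (vtx F Q i) g = 0.
Proof.
apply: wcoefP => v s; rewrite wcoef0 wcoef_of; case: ifP => // _.
rewrite big1 ?mulr0 // => j _.
have -> : strips (b :: take j s) (vtx F Q i) = 0.
  apply: wcoefP => u t; rewrite wcoef_strips wcoef_vtx wcoef0.
  by case: t => *; rewrite andbF.
by rewrite mulr0 wcoef0.
Qed.

Lemma cyc_insert_arr b a g :
  cyc_insert b (arr F a) g = (b == a)%:R *: (vtx F Q (tl b) * g * vtx F Q (hd b)).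
Proof.
apply: wcoefP => v s; have [p|np] := boolP (is_path v s); last by rewrite !wcoef_out.
rewrite wcoef_cyc_insert // wcoefZ -mulrA wcoef_vtx_mul big_ord_recl /= take0 drop0.
rewrite strip_arr -cp_scalerAr wcoefZ big1 ?addr0 => [|i _]; last first.
  have -> : strip b (strips (take (bump 0 i) s) (arr F a)) = 0; last by rewrite mulr0 wcoef0.
  apply: wcoefP => u t; rewrite -[strip b _]/(strips (b :: take (bump 0 i) s) (arr F a)).
  rewrite wcoef_strips wcoef_arr wcoef0; case: eqP => // /(congr1 size).
  by rewrite size_cat /= size_takel ?ltn_ord // addnC /bump /= add1n addSn.
have [->|_] := eqVneq b a; last by rewrite !mul0r mulr0.
by case: eqP; rewrite !(mul1r, mul0r).
Qed.

Lemma cyc_insert_mul_vtx b x i g : cyc_insert b (x * vtx F Q i) g = cyc_insert b x (vtx F Q i * g).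
Proof. by rewrite cyc_insert_leibniz cyc_insert_vtx addr0. Qed.
Lemma cyc_insert_vtx_mul b x i g : cyc_insert b (vtx F Q i * x) g = cyc_insert b x (g * vtx F Q i).
Proof. by rewrite cyc_insert_leibniz cyc_insert_vtx add0r. Qed.

Lemma cyc_insert_strip b x g : cyc_insert b x g =
  \sum_a (cyc_insert b (strip a x) (arr F a * g) + cyc_insert b (arr F a) (g * strip a x)).
Proof.
rewrite [in LHS](strip_decomp x) -[LHS]/(cyc_insertl b g _) linearD !linear_sum /=.
rewrite big1 ?add0r => [|i _]; last first.
  by rewrite linearZ /= [cyc_insertl _ _ _]cyc_insert_vtx scaler0.
by apply: eq_bigr => a _; apply: cyc_insert_leibniz.
Qed.

Lemma mpow_cyc_insert n b x g : mpow n g -> mpow n (cyc_insert b x g).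
Proof.
move=> gn v s sn; rewrite wcoef_of; case: ifP => // _.
rewrite big1 ?mulr0 // => i _; apply: (mpowMl (strips (b :: take i s) x) gn).
by rewrite size_drop (leq_ltn_trans _ sn) // leq_subr.
Qed.

Lemma mpow_cyc_insertl n b x g : mpow n.+1 x -> mpow n (cyc_insert b x g).
Proof.
move=> xn v s sn; rewrite wcoef_of; case: ifP => // _.
rewrite big1 ?mulr0 // => i _; have le_i : (i <= size s)%N by rewrite -ltnS.
have si : mpow (n - i) (strips (b :: take i s) x).
  apply: mpow_strips; rewrite /= size_takel // addSn subnKC //.
  exact: leq_trans le_i (ltnW sn).
apply: (mpowMr g si); rewrite size_drop.
by apply: ltn_sub2r => //; exact: leq_ltn_trans sn.
Qed.

(** [cyc_insert] imposes the head [tl b] on its terms and [cderiv] does not; the condition is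
    automatic when all terms of [S] are cyclic. *)
Lemma cderivE b S : potential S -> cderiv b S = cyc_insert b S 1.
Proof.
move=> /potentialP pS; apply: wcoefP => v s.
have [p|np] := boolP (is_path v s); last by rewrite !wcoef_out.
rewrite wcoef_cyc_insert // wcoef_of p.
under [in RHS]eq_bigr => i _ do rewrite mul1r wcoef_strips.
have [vb|vb] := eqVneq v (tl b); first by rewrite mul1r.
rewrite mul0r big1 // => i _; apply/eqP; apply: contraT => nz.
have [_] := pS _ _ nz; rewrite word_tl_cat.
case Ds: (take i s) nz => [|a t] nz; first by move=> E; case/eqP: vb; exact: E.
have : is_path v (take i s).
  by move: p; rewrite -[in X in X -> _](cat_take_drop i s) is_path_cat => /andP[].
rewrite Ds /= => /andP[/eqP av _].
have : is_path (word_tl v (a :: t)) (drop i s ++ b :: a :: t).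
  by apply: contraT => np; rewrite wcoef_out ?eqxx in nz.
by rewrite is_path_cat /= => /and4P[_ _ /eqP ab _]; rewrite -av ab eqxx in vb.
Qed.

Fact cderiv_linear b : linear (cderiv b : A -> A).
Proof.
move=> c x y; apply: wcoefP => v s; rewrite wcoefD wcoefZ !wcoef_of.
case: ifP => _; last by rewrite mulr0 addr0.
by rewrite mulr_sumr -big_split; apply: eq_bigr => i _; rewrite wcoefD wcoefZ.
Qed.
HB.instance Definition _ b := GRing.isLinear.Build F A A _ (@cderiv F V Q b) (cderiv_linear b).

Lemma potentialB S S' : potential S -> potential S' -> potential (S - S').
Proof.
move=> /potentialP pS /potentialP pS'; apply/potentialP => v s; rewrite wcoefB.
have [/eqP S0|/pS //] := boolP (wcoef S v s == 0); rewrite S0 sub0r oppr_eq0.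
exact: pS'.
Qed.

Lemma potentialD S S' : potential S -> potential S' -> potential (S + S').
Proof.
move=> /potentialP pS /potentialP pS'; apply/potentialP => v s; rewrite wcoefD.
have [/eqP S0|/pS //] := boolP (wcoef S v s == 0); rewrite S0 add0r.
exact: pS'.
Qed.

Lemma cderiv_cyc_equiv b S S' : potential S -> potential S' ->
  cyc_equiv S S' -> cderiv b S = cderiv b S'.
Proof.
move=> pS pS' /madic_closureP SS'; apply/eqP; rewrite -subr_eq0 -linearB /=; apply/eqP.
rewrite cderivE; last exact: potentialB.
(* Deleting [b] costs one degree, hence the accuracy [n.+1]. *)
apply: mpow_eq => n; rewrite subr0; have [y ry xy] := SS' n.+1.
rewrite -[S - S'](subrK y) -[cyc_insert _ _ _]/(cyc_insertl b 1 _) linearD /=.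
have -> : cyc_insertl b 1 y = 0; last by rewrite addr0; apply: mpow_cyc_insertl.
apply: (ry [set z | cyc_insertl b 1 z = 0]); first split=> [|c x1 x2 /= e1 e2].
- exact: linear0.
- by rewrite linearP /= e1 e2 scaler0 addr0.
move=> z [a [p [_ _ ->]]] /=; rewrite linearB /= /cyc_insertl !cyc_insert_leibniz.
by rewrite !(mul1r, mulr1) [X in _ - X]addrC subrr.
Qed.

Definition closed_ideal (J : set A) :=
  two_sided_ideal J /\ forall x, madic_closure J x -> J x.

Lemma idealD (J : set A) x y : two_sided_ideal J -> J x -> J y -> J (x + y).
Proof. by case=> J0 JB _ _ Jx Jy; rewrite -[y]opprK; apply: (JB) => //; rewrite -sub0r; apply: JB. Qed.

Lemma ideal_sum (J : set A) I (r : seq I) (P : pred I) (f : I -> A) : two_sided_ideal J ->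
  (forall i, P i -> J (f i)) -> J (\sum_(i <- r | P i) f i).
Proof.
move=> JI Jf; apply: big_ind => //; first by case: JI.
by move=> x y; apply: idealD.
Qed.

Lemma idealZ (J : set A) (k : F) x : two_sided_ideal J -> J x -> J (k *: x).
Proof. by case=> _ _ JM _ Jx; rewrite -[x]mul1r cp_scalerAl; apply: JM. Qed.

(** Each term of [x] contributes an element of [J], but there may be infinitely many. Moving the
    last arrows of [x] to the inserted element splits off a finite sum in [J] and raises the order
    of the rest; closedness of [J] concludes. *)
Lemma cyc_insert_ideal (J : set A) b x g : closed_ideal J -> J g -> J (cyc_insert b x g).
Proof.
move=> [JI Jc] Jg; apply: Jc; apply/madic_closureP => n; have [J0 JB JMl JMr] := JI.
(* [d] bounds the order of the inserted element from below, and [e] counts the arrows still to be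
   moved. *)
suff H e d x' g' : J g' -> mpow d g' -> exists2 z, J z & mpow (d + e) (cyc_insert b x' g' - z).
  by have [z Jz zn] := H n 0%N x g Jg (mpow_any g); exists z.
elim: e d x' g' => [|e IH] d x' g' Jg' g'd.
  by exists 0 => //; rewrite subr0 addn0; apply: mpow_cyc_insert.
have Hx a : exists2 z, J z & mpow (d.+1 + e) (cyc_insert b (strip a x') (arr F a * g') - z).
  apply: IH; first exact: JMl.
  by rewrite -add1n; apply: mpowM => //; apply: mpow_arr.
pose z a := s2val (cid2 (Hx a)).
exists (\sum_a (z a + cyc_insert b (arr F a) (g' * strip a x'))).
  apply: ideal_sum => // a _; apply: idealD => //; first by rewrite /z; case: cid2.
  by rewrite cyc_insert_arr; apply: idealZ => //; apply: (JMr); apply: (JMl); apply: (JMr).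
rewrite cyc_insert_strip -sumrB; apply: mpow_sum => a _.
rewrite opprD addrACA subrr addr0 addnS -addSn /z; by case: cid2.
Qed.

End CyclicDerivative.

(** * The cyclic chain rule for algebra homomorphisms *)

Section ChainRule.
Variables (F : fieldType) (V : finType) (Q Q' : quiver V).
Local Notation A := (cpalg F Q).
Local Notation A' := (cpalg F Q').

Record filtered_hom (psi : A -> A') : Prop := FilteredHom {
  fh_linear : linear psi;
  fh_mul : forall x y, psi (x * y) = psi x * psi y;
  fh_vtx : forall i, psi (vtx F Q i) = vtx F Q' i;
  fh_mpow : forall n x, mpow n x -> mpow n (psi x) }.

Section Linear.
Variable psi : {linear A -> A'}.
Hypothesis psi_hom : filtered_hom psi.

(** The difference [D] of the two sides obeys the Leibniz rule and vanishes on vertices and arrows.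
    So [D y h] is the sum over [a] of [D (strip a y) (arr F a * h)]; iterating, the order of the
    second argument grows without bound, and [D] is 0. *)
Lemma cyc_insert_chain b x g : cyc_insert b (psi x) (psi g) =
  \sum_a cyc_insert b (psi (arr F a)) (psi (cyc_insert a x g)).
Proof.
have psiM y z : psi (y * z) = psi y * psi z by apply: (fh_mul psi_hom).
have psiv i : psi (vtx F Q i) = vtx F Q' i by apply: (fh_vtx psi_hom).
pose D y h := cyc_insert b (psi y) (psi h) - \sum_a cyc_insert b (psi (arr F a)) (psi (cyc_insert a y h)).
have Dsum I (r : seq I) (f : I -> A) h : D (\sum_(i <- r) f i) h = \sum_(i <- r) D (f i) h.
  rewrite /D linear_sum cyc_insert_suml sumrB; congr (_ - _).
  rewrite exchange_big; apply: eq_bigr => a _.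
  by rewrite cyc_insert_suml !linear_sum.
have Dmul y z h : D (y * z) h = D y (z * h) + D z (h * y).
  rewrite /D psiM cyc_insert_leibniz !psiM addrACA -opprD -big_split; congr (_ - _).
  by apply: eq_bigr => a _; rewrite cyc_insert_leibniz !linearD.
have Dvtx (k : F) i h : D (k *: vtx F Q i) h = 0.
  rewrite /D linearZ psiv -[cyc_insert b (k *: _) _]/(cyc_insertl b _ _) linearZ /=.
  rewrite [cyc_insertl _ _ _]cyc_insert_vtx scaler0 sub0r big1 ?oppr0 // => a _.
  rewrite -[cyc_insert a (k *: _) _]/(cyc_insertl a _ _) linearZ /=.
  by rewrite [cyc_insertl _ _ _]cyc_insert_vtx scaler0 !linear0.
have Darr a h : D (arr F a) h = 0.
  rewrite /D (bigD1 a) //= big1 ?addr0 => [|c /negPf ca]; last first.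
    by rewrite cyc_insert_arr ca scale0r !linear0.
  rewrite cyc_insert_arr eqxx scale1r !psiM !psiv -cyc_insert_vtx_mul -cyc_insert_mul_vtx.
  by rewrite -!psiv -!psiM vtx_arr eqxx scale1r arr_vtx eqxx scale1r subrr.
have DD y z h : D (y + z) h = D y h + D z h.
  by have := Dsum _ [:: y; z] id h; rewrite !big_cons !big_nil !addr0.
have Dstrip y h : D y h = \sum_a D (strip a y) (arr F a * h).
  rewrite {1}(strip_decomp y) DD !Dsum big1 ?add0r => [|i _]; last exact: Dvtx.
  by apply: eq_bigr => a _; rewrite Dmul Darr addr0.
apply: mpow_eq => n; rewrite -/(D x g).
suff H e d y h : mpow d h -> mpow (d + e) (D y h) by apply: (H n 0%N).
elim: e d y h => [|e IH] d y h hd.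
  rewrite addn0; apply: mpowB; last apply: mpow_sum => a _;
    by apply: mpow_cyc_insert; apply: (fh_mpow psi_hom) => //; apply: mpow_cyc_insert.
rewrite Dstrip addnS -addSn; apply: mpow_sum => a _; apply: IH.
by rewrite -add1n; apply: mpowM => //; apply: mpow_arr.
Qed.

Lemma cderiv_chain b S : potential S -> potential (psi S) ->
  cderiv b (psi S) = \sum_a cyc_insert b (psi (arr F a)) (psi (cderiv a S)).
Proof.
move=> pS pS'; have psi1 : psi 1 = 1.
  rewrite -(sum_vtx F Q) linear_sum -(sum_vtx F Q').
  by apply: eq_bigr => i _; apply: (fh_vtx psi_hom).
rewrite cderivE // -psi1 cyc_insert_chain.
by apply: eq_bigr => a _; rewrite cderivE.
Qed.

End Linear.

Lemma cderiv_chain_ideal (psi : A -> A') b S (J : set A') :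
  filtered_hom psi -> potential S -> potential (psi S) ->
  closed_ideal J -> (forall a, J (psi (cderiv a S))) -> J (cderiv b (psi S)).
Proof.
move=> psih pS pS' Jc JS.
pose f : {linear A -> A'} := HB.pack psi (GRing.isLinear.Build F A A' _ psi (fh_linear psih)).
rewrite (@cderiv_chain f psih) //; apply: ideal_sum => [|a _]; first by case: Jc.
by apply: cyc_insert_ideal; last exact: JS.
Qed.

End ChainRule.

Lemma quot_ring_iso (A B : pzRingType) (I : ideal2 A) (J : ideal2 B) (f : {rmorphism A -> B}) :
  (forall x, ideal_set I x <-> ideal_set J (f x)) -> (forall y, exists x, f x = y) ->
  exists2 r : {rmorphism quot_ring I -> quot_ring J}, bijective r &
    forall x, r (quot_pi I x) = quot_pi J (f x).
Proof.
move=> IJ fsurj; pose r (q : quot_ring I) : quot_ring J := quot_pi J (f (repr q)).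
have rE x : r (quot_pi I x) = quot_pi J (f x).
  by apply/quot_piE; rewrite -rmorphB; apply/IJ/quot_piE; rewrite quot_piK.
have rB : zmod_morphism r.
  by move=> p q; rewrite -[p]quot_piK -[q]quot_piK -rmorphB !rE !rmorphB.
have rM : monoid_morphism r.
  split=> [|p q]; first by rewrite -(rmorph1 (quot_pi I)) rE !rmorph1.
  by rewrite -[p]quot_piK -[q]quot_piK -rmorphM !rE !rmorphM.
exists (HB.pack r (GRing.isZmodMorphism.Build _ _ r rB) (GRing.isMonoidMorphism.Build _ _ r rM)
  : {rmorphism quot_ring I -> quot_ring J}) => //.
pose g (p : quot_ring J) : quot_ring I := quot_pi I (projT1 (cid (fsurj (repr p)))).
exists g => [q|p]; last by rewrite [LHS]rE; case: cid => x /= ->; rewrite quot_piK.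
rewrite /g -[RHS]quot_piK; apply/quot_piE/IJ; case: cid => x /= xE.
by rewrite rmorphB xE; apply/quot_piE; rewrite quot_piK.
Qed.

Section ClosedIdeals.
Variables (F : fieldType) (V : finType) (Q Q' : quiver V).
Local Notation A := (cpalg F Q).
Local Notation A' := (cpalg F Q').

Lemma preim_closed_ideal (psi : A -> A') (J : set A') :
  filtered_hom psi -> closed_ideal J -> closed_ideal [set x | J (psi x)].
Proof.
move=> psih [[J0 JB JMl JMr] Jc]; have [psil psiM _ psim] := psih.
pose f : {linear A -> A'} := HB.pack psi (GRing.isLinear.Build F A A' _ psi psil).
have psiB x y : psi (x - y) = psi x - psi y by apply: (linearB f).
split; first split=> /= [|x y Jx Jy|x y Jy|x y Jy].
- by rewrite -[psi 0]/(f 0) linear0.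
- by rewrite psiB; apply: JB.
- by rewrite psiM; apply: JMl.
- by rewrite psiM; apply: JMr.
move=> x /madic_closureP cx; apply: Jc; apply/madic_closureP => n; have [y Jy xy] := cx n.
by exists (psi y) => //; rewrite -psiB; apply: psim.
Qed.

Lemma jac_closed (S : A) : closed_ideal (ideal_set (jac_ideal S)).
Proof. by split; [exact: ideal2P | move=> x; apply: madic_closureK]. Qed.

Lemma cderiv_jac (a : Q) (S : A) : ideal_set (jac_ideal S) (cderiv a S).
Proof. by apply: sub_closure => I _ DI; apply: DI; exists a. Qed.

Lemma jac_sub (S : A) (J : set A) : closed_ideal J ->
  (forall a, J (cderiv a S)) -> forall x, ideal_set (jac_ideal S) x -> J x.
Proof.
move=> [JI Jc] JS x /madic_closureP cx; apply: Jc; apply/madic_closureP => n; have [y Iy xy] := cx n.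
by exists y => //; apply: Iy => // _ [a _ <-].
Qed.

(** The image of an arrow runs between two distinct vertices, so it has no term of length 0. This
    provides the continuity of right-equivalences. *)
Lemma loop_free_filtered_hom (psi : A -> A') : loop_free Q -> linear psi ->
  (forall x y, psi (x * y) = psi x * psi y) -> (forall i, psi (vtx F Q i) = vtx F Q' i) ->
  filtered_hom psi.
Proof.
move=> lf psil psiM psiv.
pose f : {linear A -> A'} := HB.pack psi (GRing.isLinear.Build F A A' _ psi psil).
have psia a : mpow 1 (psi (arr F a)).
  have -> : psi (arr F a) = vtx F Q' (hd a) * psi (arr F a) * vtx F Q' (tl a).
    by rewrite -!psiv -!psiM vtx_arr eqxx scale1r arr_vtx eqxx scale1r.
  move=> v [|//] _; rewrite wcoef_mul_vtx wcoef_vtx_mul /word_tl /=.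
  case: eqP => // ->; case: eqP => // E.
  by have := lf a; rewrite E eqxx.
split=> //; elim=> // n IH x xn; rewrite (strip_decomp1 (mpow_le _ xn)) //.
rewrite -[psi _]/(f _) linear_sum; apply: mpow_sum => a _; rewrite /= psiM -addn1.
by apply: mpowM => //; apply: IH; apply: mpow_strip.
Qed.

End ClosedIdeals.

(** * Removal of a trivial summand *)

Section Splitting.
Variables (F : fieldType) (V : finType) (Q C : quiver V).
Local Notation sQ := (sum_quiver Q C).
Local Notation A := (cpalg F Q).
Local Notation sA := (cpalg F sQ).
Local Notation il := (inl : Q -> sQ).

Lemma is_path_inl v s : is_path v (map il s) = is_path v s.
Proof. by elim: s v => //= a s IH v; rewrite IH. Qed.
Lemma word_tl_inl v s : word_tl v (map il s) = word_tl v s.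
Proof. by rewrite /word_tl -map_comp. Qed.

Lemma inl_wordP (s : seq sQ) : (exists s', s = map il s') \/ ~~ all (@left_arrow V Q C) s.
Proof.
elim: s => [|[a|c] s IH]; [by left; exists [::]| |by right].
by case: IH => [[s' ->]|ns]; [left; exists (a :: s') | right].
Qed.

Lemma all_left s : all (@left_arrow V Q C) (map il s).
Proof. by elim: s. Qed.
Lemma pmap_left s : pmap (@left_arrow V Q C) (map il s) = s.
Proof. by elim: s => //= a s ->. Qed.

Lemma wcoef_inl (x : A) v s : wcoef (sum_inl C x) v (map il s) = wcoef x v s.
Proof.
rewrite wcoef_of is_path_inl all_left pmap_left.
by case: ifPn => // np; rewrite wcoef_out.
Qed.
Lemma wcoef_inl0 (x : A) v s : ~~ all (@left_arrow V Q C) s -> wcoef (sum_inl C x) v s = 0.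
Proof. by move=> /negPf ns; rewrite wcoef_of ns if_same. Qed.
Lemma wcoef_inr0 (x : cpalg F C) v s : ~~ all (@right_arrow V Q C) s -> wcoef (sum_inr Q x) v s = 0.
Proof. by move=> /negPf ns; rewrite wcoef_of ns if_same. Qed.

Fact sum_inl_linear : linear (sum_inl C : A -> sA).
Proof.
move=> c x y; apply: wcoefP => v s; rewrite wcoefD wcoefZ.
case: (inl_wordP s) => [[s' ->]|ns]; first by rewrite !wcoef_inl wcoefD wcoefZ.
by rewrite !wcoef_inl0 ?mulr0 ?addr0.
Qed.
HB.instance Definition _ := GRing.isLinear.Build F A sA _ (sum_inl C : A -> sA) sum_inl_linear.

Lemma sum_inlM (x y : A) : sum_inl C (x * y) = sum_inl C x * sum_inl C y.
Proof.
apply: wcoefP => v s; rewrite wcoef_mul; case: (inl_wordP s) => [[s' ->]|ns].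
  rewrite wcoef_inl wcoef_mul size_map; apply: eq_bigr => i _.
  by rewrite -map_take -map_drop !wcoef_inl word_tl_inl.
rewrite wcoef_inl0 // big1 // => i _.
have := ns; rewrite -{1}(cat_take_drop i s) all_cat negb_and => /orP[n1|n1].
  by rewrite (wcoef_inl0 x v n1) mul0r.
by rewrite (wcoef_inl0 y _ n1) mulr0.
Qed.

(** The homomorphism that sets the arrows of [C] to zero, a left inverse of the inclusion. *)
Definition sum_proj (z : sA) : A := of_wcoef (fun v s => wcoef z v (map il s)).

Lemma wcoef_proj z v s : wcoef (sum_proj z) v s = wcoef z v (map il s).
Proof. by rewrite wcoef_of; case: ifPn => // np; rewrite wcoef_out ?is_path_inl. Qed.

Fact sum_proj_linear : linear sum_proj.
Proof. by move=> c x y; apply: wcoefP => v s; rewrite !(wcoef_proj, wcoefD, wcoefZ). Qed.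
HB.instance Definition _ := GRing.isLinear.Build F sA A _ sum_proj sum_proj_linear.

Fact sum_proj_monoid : monoid_morphism sum_proj.
Proof.
split=> [|x y]; apply: wcoefP => v s; rewrite wcoef_proj; first by rewrite !wcoef1; case: s.
rewrite !wcoef_mul size_map; apply: eq_bigr => i _.
by rewrite !wcoef_proj map_take map_drop -map_take word_tl_inl.
Qed.
HB.instance Definition _ := GRing.isMonoidMorphism.Build sA A sum_proj sum_proj_monoid.

Lemma sum_inlK : cancel (sum_inl C) sum_proj.
Proof. by move=> x; apply: wcoefP => v s; rewrite wcoef_proj wcoef_inl. Qed.

Lemma mpow_proj n z : mpow n z -> mpow n (sum_proj z).
Proof. by move=> zn v s sn; rewrite wcoef_proj zn // size_map. Qed.
Lemma mpow_inl n (x : A) : mpow n x -> mpow n (sum_inl C x).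
Proof.
move=> xn v s sn; case: (inl_wordP s) => [[s' sE]|ns]; last by rewrite wcoef_inl0.
by rewrite sE wcoef_inl xn // -(size_map il) -sE.
Qed.

Lemma proj_vtx i : sum_proj (vtx F sQ i) = vtx F Q i.
Proof. by apply: wcoefP => v s; rewrite wcoef_proj !wcoef_vtx; case: s. Qed.
Lemma inl_vtx i : sum_inl C (vtx F Q i) = vtx F sQ i.
Proof.
apply: wcoefP => v s; case: (inl_wordP s) => [[s' ->]|ns].
  by rewrite wcoef_inl !wcoef_vtx; case: s'.
by rewrite wcoef_inl0 // wcoef_vtx; case: s ns => //= *; rewrite andbF.
Qed.

Lemma proj_filtered : filtered_hom sum_proj.
Proof.
split; [exact: sum_proj_linear|exact: rmorphM|exact: proj_vtx|exact: mpow_proj].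
Qed.
Lemma inl_filtered : filtered_hom (sum_inl C : A -> sA).
Proof. split; [exact: sum_inl_linear|exact: sum_inlM|exact: inl_vtx|exact: mpow_inl]. Qed.

Variables (W : A) (T : cpalg F C).
Hypothesis trivT : trivial_QP T.
Local Notation WT := (sum_inl C W + sum_inr Q T).

Lemma cderiv_inl a : cderiv (inl a : sQ) WT = sum_inl C (cderiv a W).
Proof.
apply: wcoefP => v s; have [p|np] := boolP (is_path v s); last by rewrite !wcoef_out.
rewrite wcoef_of p; have right0 x t1 t2 : wcoef (sum_inr Q T) x (t1 ++ inl a :: t2) = 0.
  by rewrite wcoef_inr0 // all_cat /= andbF.
under eq_bigr => i _ do rewrite wcoefD right0 addr0.
case: (inl_wordP s) p => [[s' ->]|ns] p.
  rewrite wcoef_inl wcoef_of -is_path_inl p size_map; apply: eq_bigr => i _.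
  by rewrite -map_take -map_drop word_tl_inl -wcoef_inl map_cat.
rewrite wcoef_inl0 // big1 // => i _; apply: wcoef_inl0; apply: contra ns.
by rewrite all_cat /= => /andP[d0 t0]; rewrite -(cat_take_drop i s) all_cat t0 d0.
Qed.

(** [T] is of degree 2, so its derivatives are combinations of arrows of [C], and no term of [W]
    passes through [c]. *)
Lemma proj_cderiv_inr c : sum_proj (cderiv (inr c : sQ) WT) = 0.
Proof.
apply: wcoefP => v s; rewrite wcoef_proj wcoef0 wcoef_of; case: ifP => // _.
have [hT _] := trivT; rewrite big1 // => i _; rewrite wcoefD wcoef_inl0 ?add0r; last first.
  by rewrite all_cat /= andbF.
rewrite -map_take -map_drop; case: s i => [|a s] i /=; last first.
  by apply: wcoef_inr0; apply/negP; rewrite all_cat /=; case: i => -[|i] ? /=; rewrite ?andbF.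
rewrite wcoef_of; case: ifP => // p /=; apply/eqP; apply: contraT.
have pc : is_path (Q := C) (word_tl v (map il [::])) [:: c] by [].
by rewrite (wcoefE _ pc) => /hT.
Qed.

Local Notation ir := (inr : C -> sQ).

Lemma is_path_inr v s : is_path v (map ir s) = is_path v s.
Proof. by elim: s v => //= a s IH v; rewrite IH. Qed.
Lemma word_tl_inr v s : word_tl v (map ir s) = word_tl v s.
Proof. by rewrite /word_tl -map_comp. Qed.
Lemma inr_wordP (s : seq sQ) : (exists s', s = map ir s') \/ ~~ all (@right_arrow V Q C) s.
Proof.
elim: s => [|[a|c] s IH]; [by left; exists [::]|by right|].
by case: IH => [[s' ->]|ns]; [left; exists (c :: s') | right].
Qed.
Lemma wcoef_inr (x : cpalg F C) v s : wcoef (sum_inr Q x) v (map ir s) = wcoef x v s.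
Proof.
rewrite wcoef_of is_path_inr.
have -> : all (@right_arrow V Q C) (map ir s) by elim: s.
have -> : pmap (@right_arrow V Q C) (map ir s) = s by elim: s => //= a s ->.
by case: ifPn => // np; rewrite wcoef_out.
Qed.

Lemma cderiv_inr c : cderiv (inr c : sQ) WT = sum_inr Q (cderiv c T).
Proof.
apply: wcoefP => v s; have [p|np] := boolP (is_path v s); last by rewrite !wcoef_out.
rewrite wcoef_of p; have left0 x t1 t2 : wcoef (sum_inl C W) x (t1 ++ inr c :: t2) = 0.
  by rewrite wcoef_inl0 // all_cat /= andbF.
under eq_bigr => i _ do rewrite wcoefD left0 add0r.
case: (inr_wordP s) p => [[s' ->]|ns] p.
  rewrite wcoef_inr wcoef_of -is_path_inr p size_map; apply: eq_bigr => i _.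
  by rewrite -map_take -map_drop word_tl_inr -wcoef_inr map_cat.
rewrite wcoef_inr0 // big1 // => i _; apply: wcoef_inr0; apply: contra ns.
by rewrite all_cat /= => /andP[d0 t0]; rewrite -(cat_take_drop i s) all_cat t0 d0.
Qed.

(** Triviality makes [c] a combination of derivatives of [T], which are the derivatives of the whole
    potential along arrows of [C]. *)
Lemma arr_inr_jac c : ideal_set (jac_ideal WT) (arr F (inr c : sQ)).
Proof.
have [_ spanT] := trivT.
have /spanT[k kE] : homogeneous 1 (arr F c : cpalg F C).
  move=> p; rewrite Defs.coefE wcoef_arr /path_len.
  by case: (path_word p =P _) => [-> //|_] /=; rewrite eqxx.
have -> : arr F (inr c : sQ) = \sum_c' k c' *: cderiv (inr c' : sQ) WT.
  apply: wcoefP => v s; rewrite wcoef_sum.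
  under eq_bigr => c' _ do rewrite wcoefZ cderiv_inr.
  case: (inr_wordP s) => [[s' ->]|ns]; last first.
    rewrite big1 => [|c' _]; last by rewrite wcoef_inr0 ?mulr0.
    by rewrite wcoef_arr; case: eqP ns => [->|].
  under eq_bigr => c' _ do rewrite wcoef_inr -wcoefZ.
  rewrite -wcoef_sum -kE !wcoef_arr -[[:: inr c]]/(map ir [:: c]).
  by rewrite (inj_eq (inj_map (f := ir) _)) // => ? ? [].
apply: ideal_sum => [|c' _]; first exact: ideal2P.
by apply: (idealZ _ (ideal2P _)); exact: cderiv_jac.
Qed.

(** Every term of [z] passes through an arrow of [C]. Peeling off last arrows until one of [C]
    appears approximates [z] to any order by elements of the ideal. *)
Lemma no_left_jac z : sum_proj z = 0 -> ideal_set (jac_ideal WT) z.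
Proof.
have JI := ideal2P (jac_ideal WT).
move=> z0; apply: (jac_closed WT).2; apply/madic_closureP => n.
elim: n z z0 => [|n IH] z z0; first by exists 0 => //; case: JI.
have zil a : sum_proj (strip (inl a : sQ) z) = 0.
  apply: wcoefP => v s; rewrite wcoef_proj wcoef_strip wcoef0 -map_rcons -wcoef_proj z0.
  exact: wcoef0.
pose y a := s2val (cid2 (IH _ (zil a))).
exists (\sum_a y a * arr F (inl a : sQ) + \sum_c strip (inr c : sQ) z * arr F (inr c : sQ)).
  apply: (idealD JI); apply: ideal_sum => [//|a _]; have [_ _ Ml Mr] := JI.
    by apply: Mr; rewrite /y; case: cid2.
  by apply: Ml; apply: arr_inr_jac.
have z1 : mpow 1 z.
  by move=> v [|//] _; have := congr1 (fun x => wcoef x v [::]) z0; rewrite wcoef_proj wcoef0.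
rewrite [in X in X - _](strip_decomp1 z1) big_sumType /= opprD addrACA subrr addr0 -sumrB.
apply: mpow_sum => a _; rewrite -mulrBl -addn1; apply: mpowM; last exact: mpow_arr.
by rewrite /y; case: cid2.
Qed.

Lemma sum_jac_proj z : ideal_set (jac_ideal WT) z <-> ideal_set (jac_ideal W) (sum_proj z).
Proof.
split.
  apply: (jac_sub (preim_closed_ideal proj_filtered (jac_closed W))) => -[a|c] /=.
    by rewrite cderiv_inl sum_inlK; apply: cderiv_jac.
  by rewrite proj_cderiv_inr; case: (ideal2P (jac_ideal W)).
move=> Jz; rewrite -[z](subrK (sum_inl C (sum_proj z))); apply: (idealD (ideal2P _)).
  by apply: no_left_jac; rewrite linearB /= sum_inlK subrr.
move: (sum_proj z) Jz.
apply: (jac_sub (preim_closed_ideal inl_filtered (jac_closed WT))) => a /=.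
by rewrite -cderiv_inl; apply: cderiv_jac.
Qed.

End Splitting.

(** * Jacobian algebras under right-equivalence and reduction *)

Section Reduction.
Variables (F : fieldType) (V : finType) (P Q C : quiver V).

Lemma right_equivalence_jac (P' : quiver V) (U : cpalg F P) (W : cpalg F P')
    (phi : {rmorphism cpalg F P -> cpalg F P'}) y :
  loop_free P -> loop_free P' -> potential U -> potential W ->
  right_equivalence U W phi -> ideal_set (jac_ideal U) y <-> ideal_set (jac_ideal W) (phi y).
Proof.
move=> lfP lfP' pU pW [[psi phiK psiK] phiZ phiv pphiU cyc].
have phil : linear phi by move=> c x z; rewrite rmorphD; congr (_ + _); apply: phiZ.
have psil : linear psi by move=> c x z; apply: (can_inj phiK); rewrite phil !psiK.
have psiM x z : psi (x * z) = psi x * psi z by apply: (can_inj phiK); rewrite rmorphM !psiK.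
have psiv i : psi (vtx F P' i) = vtx F P i by apply: (can_inj phiK); rewrite psiK phiv.
have fphi : filtered_hom phi by apply: loop_free_filtered_hom => //; apply: rmorphM.
have fpsi : filtered_hom psi by apply: loop_free_filtered_hom.
have cycd a : cderiv a (phi U) = cderiv a W by apply: cderiv_cyc_equiv.
split.
  apply: (jac_sub (preim_closed_ideal fphi (jac_closed W))) => a.
  (* [U] is read as the image of [phi U] under the inverse [psi], so that the chain rule for [psi]
     applies; the derivatives of [phi U] are those of [W]. *)
  rewrite -{1}(phiK U).
  apply: (@cderiv_chain_ideal _ _ _ _ psi a (phi U)
    [set x | ideal_set (jac_ideal W) (phi x)]) => //; first by rewrite phiK.
    exact: preim_closed_ideal fphi (jac_closed W).
  by move=> b /=; rewrite psiK cycd; apply: cderiv_jac.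
rewrite -{2}(phiK y); move: (phi y).
apply: (jac_sub (preim_closed_ideal fpsi (jac_closed U))) => a; rewrite -cycd.
apply: (@cderiv_chain_ideal _ _ _ _ phi a U
    [set x | ideal_set (jac_ideal U) (psi x)]) => //; first exact: preim_closed_ideal fpsi (jac_closed U).
by move=> b /=; rewrite phiK; apply: cderiv_jac.
Qed.

Lemma reduction_iso (U : cpalg F P) (W : cpalg F Q) (T : cpalg F C)
    (phi : {rmorphism cpalg F P -> cpalg F (sum_quiver Q C)}) :
  loop_free P -> potential U -> is_QP W -> is_QP T -> trivial_QP T ->
  right_equivalence U (sum_inl C W + sum_inr Q T) phi ->
  exists2 r : {rmorphism jacobian U -> jacobian W}, bijective r &
    forall y, r (jac U y) = jac W (sum_proj (phi y)).
Proof.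
move=> lfP pU [lfQ pW] [lfC pT] triv req.
have lfs : loop_free (sum_quiver Q C) by case=> [a|c]; [exact: lfQ | exact: lfC].
have pWT : potential (sum_inl C W + sum_inr Q T).
  apply: potentialD; apply/potentialP => v s.
    case: (inl_wordP s) => [[s' ->]|ns]; last by rewrite wcoef_inl0 ?eqxx.
    by rewrite wcoef_inl size_map word_tl_inl; move/potentialP: pW; apply.
  case: (inr_wordP s) => [[s' ->]|ns]; last by rewrite wcoef_inr0 ?eqxx.
  by rewrite wcoef_inr size_map word_tl_inr; move/potentialP: pT; apply.
apply: (@quot_ring_iso _ _ (jac_ideal U) (jac_ideal W) (@sum_proj F V Q C \o phi)) => [x|y].
  by rewrite (right_equivalence_jac _ lfP lfs pU pWT req) sum_jac_proj.
have [[psi _ psiK] _ _ _ _] := req; exists (psi (sum_inl C y)).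
by rewrite /= psiK sum_inlK.
Qed.

End Reduction.

(** * Cyclic derivatives of the premutation *)

Section ArrowEnds.
Variables (F : fieldType) (V : finType) (P : quiver V) (p : P).

Lemma vtx_arr_hd : vtx F P (hd p) * arr F p = arr F p.
Proof. by rewrite vtx_arr eqxx scale1r. Qed.

Lemma arr_vtx_tl : arr F p * vtx F P (tl p) = arr F p.
Proof. by rewrite arr_vtx eqxx scale1r. Qed.

End ArrowEnds.

Lemma cyc_insert_triangle (F : fieldType) (V : finType) (P : quiver V) (q p1 p2 p3 : P) :
  tl p1 = hd p2 -> tl p2 = hd p3 -> tl p3 = hd p1 ->
  cyc_insert q (arr F p1 * arr F p2 * arr F p3) 1 =
  (if q == p1 then arr F p2 * arr F p3 else 0) + (if q == p2 then arr F p3 * arr F p1 else 0) +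
  (if q == p3 then arr F p1 * arr F p2 else 0).
Proof.
have tri (r1 r2 r3 : P) : tl r1 = hd r2 -> tl r3 = hd r1 ->
    cyc_insert q (arr F r1) (arr F r2 * arr F r3) = if q == r1 then arr F r2 * arr F r3 else 0.
  move=> h12 h31; rewrite cyc_insert_arr.
  case: eqP => [->|_]; last by rewrite scale0r.
  by rewrite scale1r mulrA h12 vtx_arr_hd -mulrA -h31 arr_vtx_tl.
move=> h12 h23 h31; rewrite cyc_insert_leibniz mulr1 mul1r [X in X + _]cyc_insert_leibniz.
by rewrite !tri.
Qed.

Section PremutationPotential.
Variables (F : fieldType) (V : finType) (Q : quiver V) (k : V).
Local Notation A := (cpalg F Q).
Local Notation Q' := (premut_quiver Q k).
Local Notation A' := (cpalg F Q').
Local Notation inQ := (in_arrow Q k).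
Local Notation outQ := (out_arrow Q k).
Local Notation oldQ := (old_arrow Q k).
Hypothesis lfQ : loop_free Q.
Hypothesis no2 : ~ in_2cycle Q k.

Lemma in_hd (a : inQ) : hd (val a) = k. Proof. exact/eqP/(valP a). Qed.
Lemma out_tl (b : outQ) : tl (val b) = k. Proof. exact/eqP/(valP b). Qed.
Lemma in_tl (a : inQ) : tl (val a) != k.
Proof. by have := lfQ (val a); rewrite in_hd eq_sym. Qed.
Lemma out_hd (b : outQ) : hd (val b) != k.
Proof. by have := lfQ (val b); rewrite out_tl. Qed.
Lemma old_hd (c : oldQ) : hd (val c) != k. Proof. by case/andP: (valP c). Qed.
Lemma old_tl (c : oldQ) : tl (val c) != k. Proof. by case/andP: (valP c). Qed.
Lemma hook_neq (b : outQ) (a : inQ) : hd (val b) != tl (val a).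
Proof. by apply/eqP => E; apply: no2; exists (val b), (val a); rewrite out_tl in_hd. Qed.

Lemma premut_loop_free : loop_free Q'.
Proof.
case=> [[c|[b a]]|[a|b]] /=; [exact: lfQ|exact: hook_neq|exact: in_tl|].
by rewrite eq_sym out_hd.
Qed.

Lemma sum_sig (U : nmodType) (T : finType) (P : pred T) (f : T -> U) :
  \sum_(x : {x | P x}) f (val x) = \sum_(x | P x) f x.
Proof. exact: (esym (big_sub P f)). Qed.

Lemma sum_arrows (U : nmodType) (f : Q -> U) :
  \sum_q f q = \sum_(c : oldQ) f (val c) + \sum_(a : inQ) f (val a) + \sum_(b : outQ) f (val b).
Proof.
rewrite !sum_sig (bigID (fun q => tl q == k)) /= addrC; congr (_ + _).
rewrite (bigID (fun q : Q => hd q == k)) /= addrC; congr (_ + _).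
  by apply: eq_bigl => q; rewrite andbC.
by apply: eq_bigl => q; case: (hd q =P k) => [<-|_]; rewrite ?andbF // eq_sym lfQ.
Qed.

Lemma sum_premut_arrows (U : nmodType) (f : Q' -> U) :
  \sum_q f q = (\sum_c f (p_old c) + \sum_b \sum_a f (p_hook b a)) +
               (\sum_a f (p_star_in a) + \sum_b f (p_star_out b)).
Proof.
rewrite big_sumType /= !big_sumType /=; congr (_ + _ + _).
by rewrite pair_big /=; apply: eq_bigr => -[b a] _.
Qed.

Lemma expand_path v s : ~~ has (@is_star V Q k) s ->
  is_path v (flatten (map (@expand V Q k) s)) = is_path v s.
Proof.
elim: s v => // -[[c|[b a]]|q] s IH v //= ns; first by rewrite IH.
by rewrite IH // out_tl in_hd eqxx.
Qed.

Lemma expand_tl v s : ~~ has (@is_star V Q k) s ->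
  word_tl v (flatten (map (@expand V Q k) s)) = word_tl v s.
Proof.
elim: s v => // -[[c|[b a]]|q] s IH v //= ns.
  exact: (IH (tl (val c)) ns).
exact: (IH (tl (val a)) ns).
Qed.

Lemma wcoef_bracket (x : A) v s : ~~ has (@is_star V Q k) s ->
  wcoef (bracket k x) v s = wcoef x v (flatten (map (@expand V Q k) s)).
Proof.
move=> ns; rewrite wcoef_of (negPf ns); case: ifPn => // np.
by rewrite wcoef_out // expand_path.
Qed.

Lemma wcoef_bracket0 (x : A) v s : has (@is_star V Q k) s -> wcoef (bracket k x) v s = 0.
Proof. by move=> ns; rewrite wcoef_of ns if_same. Qed.

Lemma mpow1_bracket (x : A) : mpow 1 x -> mpow 1 (bracket k x).
Proof. by move=> x1 v [|//] _; rewrite wcoef_bracket ?x1. Qed.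

Lemma strip_bracket_old (x : A) (c : oldQ) :
  strip (p_old c) (bracket k x) = bracket k (strip (val c) x).
Proof.
apply: wcoefP => v s; rewrite wcoef_strip.
have [ns|ns] := boolP (has (@is_star V Q k) s).
  by rewrite !wcoef_bracket0 // has_rcons ns orbT.
rewrite !wcoef_bracket ?has_rcons // wcoef_strip.
by rewrite map_rcons flatten_rcons cats1.
Qed.

Lemma strip_bracket_hook (x : A) (b : outQ) (a : inQ) :
  strip (p_hook b a) (bracket k x) = bracket k (strip (val b) (strip (val a) x)).
Proof.
apply: wcoefP => v s; rewrite wcoef_strip.
have [ns|ns] := boolP (has (@is_star V Q k) s).
  by rewrite !wcoef_bracket0 // has_rcons ns orbT.
rewrite !wcoef_bracket ?has_rcons // !wcoef_strip.
by rewrite map_rcons flatten_rcons -!cats1 -catA.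
Qed.

Lemma strip_bracket_star (x : A) (q : Q') : is_star q -> strip q (bracket k x) = 0.
Proof.
move=> sq; apply: wcoefP => v s; rewrite wcoef_strip wcoef_bracket0 ?wcoef0 //.
by rewrite has_rcons sq.
Qed.

Lemma vtx_strip i (b : Q) (x : A) : vtx F Q i * strip b x = strip b (vtx F Q i * x).
Proof. by rewrite strip_mul strip_vtx scaler0 addr0. Qed.

Lemma strip_vtx_hd (b : Q) (x : A) : strip b x * vtx F Q (hd b) = strip b x.
Proof.
apply: wcoefP => v s; rewrite wcoef_mul_vtx wcoef_strip; case: eqP => // ne.
by rewrite wcoef_out // is_path_rcons negb_and orbC; move/eqP: ne => ->.
Qed.

Lemma strip_strip0 (b a : Q) (x : A) : hd b <> tl a -> strip a (strip b x) = 0.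
Proof.
move=> ba; apply: wcoefP => v s; rewrite !wcoef_strip wcoef0 wcoef_out //.
rewrite is_path_rcons word_tl_rcons negb_and; apply/orP; right.
by apply/eqP => E; apply: ba.
Qed.

Variable S : A.
Hypothesis potS : potential S.
Hypothesis S_hd : forall s, wcoef S k s = 0.

Lemma vtx_cderiv (a : Q) : vtx F Q (tl a) * cderiv a S = cderiv a S.
Proof.
apply: wcoefP => v s; rewrite wcoef_vtx_mul cderivE // wcoef_of.
by case: eqP => // _; rewrite mul0r if_same.
Qed.

(* A split of [expand s] inside a hook lies at the vertex k. *)
Lemma sum_splits (G : seq Q -> seq Q -> F) s :
  (forall t1 t2 b, tl b = k -> G (rcons t1 b) t2 = 0) -> ~~ has (@is_star V Q k) s ->
  let e := flatten (map (@expand V Q k) s) in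
  \sum_(i < (size e).+1) G (take i e) (drop i e) =
  \sum_(i < (size s).+1) G (flatten (map (@expand V Q k) (take i s)))
                           (flatten (map (@expand V Q k) (drop i s))).
Proof.
elim: s G => [|q s IH] G G0; first by rewrite /= !big_ord1.
case: q => [[c|[b a]]|//] ns /=; rewrite big_ord_recl [RHS]big_ord_recl; congr (_ + _).
  apply: (IH (fun t1 t2 => G (val c :: t1) t2)) => // t1 t2 b tb.
  by rewrite -rcons_cons G0.
rewrite big_ord_recl -[X in X + _]/(G (rcons [::] (val b)) _) G0 ?out_tl // add0r.
apply: (IH (fun t1 t2 => G (val b :: val a :: t1) t2)) => // t1 t2 b' tb.
by rewrite -!rcons_cons G0.
Qed.

Lemma wcoef_normal_tl v (s1 s2 : seq Q) : word_tl v s1 = k -> wcoef S (word_tl v s1) s2 = 0.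
Proof. by move->. Qed.

(** Cuts of a bracketed path correspond to the cuts of its expansion outside the hooks; a cut inside
    a hook would need a term of [S] beginning at [k]. *)
Lemma cderiv_bracket_old (c : oldQ) :
  cderiv (p_old c) (bracket k S) = bracket k (cderiv (val c) S).
Proof.
apply: wcoefP => v s; have [p|np] := boolP (is_path v s); last by rewrite !wcoef_out.
rewrite wcoef_of p; have [ns|ns] := boolP (has (@is_star V Q k) s).
  rewrite wcoef_bracket0 // big1 // => i _; rewrite wcoef_bracket0 //.
  by rewrite has_cat /= orbC -has_cat cat_take_drop.
rewrite wcoef_bracket // wcoef_of expand_path // p.
rewrite (sum_splits (G := fun t1 t2 => wcoef S (word_tl v t1) (t2 ++ val c :: t1))) //; last first.
  by move=> t1 t2 b tb; rewrite word_tl_rcons tb.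
apply: eq_bigr => i _; have [nt nd] : ~~ has (@is_star V Q k) (take i s) /\ ~~ has (@is_star V Q k) (drop i s).
  by move: ns; rewrite -{1}(cat_take_drop i s) has_cat negb_or => /andP[].
rewrite wcoef_bracket ?expand_tl //; last by rewrite has_cat /= negb_or nt nd.
by rewrite map_cat flatten_cat.
Qed.

(** The quotient by [b] of the derivative along [a] collects the terms where [b] immediately
    precedes [a]: it is the derivative along the hook b a. *)
Lemma cderiv_bracket_hook (b : outQ) (a : inQ) :
  cderiv (p_hook b a) (bracket k S) = bracket k (strip (val b) (cderiv (val a) S)).
Proof.
apply: wcoefP => v s; have [p|np] := boolP (is_path v s); last by rewrite !wcoef_out.
rewrite wcoef_of p; have [ns|ns] := boolP (has (@is_star V Q k) s).
  rewrite wcoef_bracket0 // big1 // => i _; rewrite wcoef_bracket0 //.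
  by rewrite has_cat /= orbC -has_cat cat_take_drop.
rewrite wcoef_bracket // wcoef_strip; set e := flatten _.
have ep : is_path v e by rewrite expand_path.
transitivity (\sum_(i < (size e).+1) wcoef S (word_tl v (take i e)) (drop i e ++ [:: val b, val a & take i e])).
  rewrite (sum_splits (G := fun t1 t2 => wcoef S (word_tl v t1) (t2 ++ [:: val b, val a & t1]))) //; last first.
    by move=> t1 t2 b' tb; rewrite word_tl_rcons tb.
  apply: eq_bigr => i _; have [nt nd] : ~~ has (@is_star V Q k) (take i s) /\ ~~ has (@is_star V Q k) (drop i s).
    by move: ns; rewrite -{1}(cat_take_drop i s) has_cat negb_or => /andP[].
  rewrite wcoef_bracket ?expand_tl //; last by rewrite has_cat /= negb_or nt nd.
  by rewrite map_cat flatten_cat.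
(* The last cut concerns a term of [S] with first arrow [a] and last arrow [b]; it begins at [k], so
   its coefficient is 0. *)
rewrite wcoef_of size_rcons [in RHS]big_ord_recr /= [take (size e).+1 _]take_oversize ?size_rcons //.
rewrite word_tl_rcons out_tl S_hd addr0.
case: ifPn => [_|np].
  apply: eq_bigr => i _; have le_i : (i <= size e)%N by rewrite -ltnS.
  rewrite -cats1 takel_cat // drop_cat; case: ltnP => [_|ge_i]; first by rewrite -catA.
  have -> : nat_of_ord i = size e by apply/eqP; rewrite eqn_leq le_i.
  by rewrite subnn /= drop_size.
rewrite big1 // => i _; rewrite wcoef_out // is_path_cat negb_and -word_tl_cat cat_take_drop /=.
move: np; rewrite is_path_rcons ep /= eq_sym => /negPf ->; by rewrite orbT.
Qed.

Lemma cderiv_bracket_star (q : Q') : is_star q -> cderiv q (bracket k S) = 0.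
Proof.
move=> sq; apply: wcoefP => v s; rewrite wcoef0 wcoef_of; case: ifP => // _.
by rewrite big1 // => i _; rewrite wcoef_bracket0 // has_cat /= sq orbT.
Qed.

(** A constant term would come from a term b a of [S], which would be a 2-cycle through [k]. *)
Lemma strip_cderiv_mpow1 (b : outQ) (a : inQ) : mpow 1 (strip (val b) (cderiv (val a) S)).
Proof.
move=> v [|//] _; rewrite wcoef_strip wcoef_of; case: ifP => // _.
rewrite big_ord_recl big_ord1 /= [X in _ + X](wcoef_normal_tl (s1 := [:: val b])) ?addr0; last exact: out_tl.
apply/eqP; apply: contraT => nz; have [_] := (potentialP S).1 potS _ _ nz.
have : is_path v [:: val b; val a] by apply: contraT => np; rewrite wcoef_out ?eqxx in nz.
rewrite /= => /andP[/eqP <- _] E.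
by case/eqP: (hook_neq b a).
Qed.

Lemma strip_cderiv_old0 (a : inQ) (c : oldQ) v :
  wcoef (strip (val a) (cderiv (val c) S)) v [::] = 0.
Proof.
rewrite wcoef_strip wcoef_of; case: ifP => //= /andP[/eqP vk _].
rewrite -vk in_hd big_ord_recl S_hd add0r big_ord1 /=.
rewrite wcoef_out //= negb_and; apply/orP; right.
by rewrite in_hd andbT eq_sym old_tl.
Qed.

(** No term of [S] begins at [k], hence, being cyclic, none ends there; so every occurrence of [b]
    is directly followed by an incoming arrow. *)
Lemma cderiv_out (b : outQ) :
  cderiv (val b) S = \sum_(a : inQ) arr F (val a) * strip (val b) (cderiv (val a) S).
Proof.
apply: wcoefP => v s; rewrite wcoef_sum; case: s => [|c t].
  rewrite (cderiv_mpow1 (val b) lfQ potS) // big1 // => a _.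
  by rewrite wcoef_mul_nil wcoef_arr mul0r.
have [p|np] := boolP (is_path v (c :: t)); last first.
  by rewrite wcoef_out // big1 // => a _; rewrite wcoef_out.
have cv : hd c = v by case/andP: p => /eqP.
have pt : is_path (tl c) t by case/andP: p.
rewrite wcoef_of p.
have mulE (a : inQ) x : wcoef (arr F (val a) * x) v (c :: t) = (c == val a)%:R * wcoef x (tl c) t.
  rewrite wcoef_mul big_ord_recl /= wcoef_arr mul0r add0r big_ord_recl /= take0 drop0.
  rewrite wcoef_arr eqseq_cons eqxx andbT.
  rewrite big1 ?addr0 => [|i _]; last first.
    rewrite wcoef_arr; case: eqP => [E|]; rewrite ?mul0r //.
    by case: i E => -[|i] //=; case: t {p pt} => //.
  by rewrite -cv; case: eqP => [->|]; rewrite ?eqxx ?mul0r.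
under [RHS]eq_bigr => a _ do rewrite mulE.
have [ck|nck] := eqVneq (hd c) k; last first.
  rewrite [RHS]big1 => [|a _]; last first.
    by case: (c =P val a) nck => [->|_ _]; rewrite ?mul0r // in_hd eqxx.
  rewrite big_ord_recl big1 => [|i _].
    rewrite addr0 /=; apply/eqP; apply: contraT => nz.
    have [_] := (potentialP S).1 potS _ _ nz.
    rewrite -cat_cons word_tl_cat => vb; have vk : v = k by rewrite -(out_tl b); exact: vb.
    by rewrite cv vk eqxx in nck.
  apply: wcoef_out; rewrite is_path_cat negb_and; apply/orP; right => /=.
  by rewrite out_tl (negPf nck) andbF.
pose c' : inQ := exist _ c (introT eqP ck).
rewrite [RHS](bigD1 c') //= eqxx mul1r [X in _ = _ + X]big1 ?addr0 => [|a ac]; last first.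
  by case: (c =P val a) => [E|_]; rewrite ?mul0r //; case/eqP: ac; apply: val_inj.
rewrite big_ord_recl /= [X in X + _](wcoef_normal_tl (s1 := [::])) ?add0r; last by rewrite -cv.
rewrite wcoef_strip wcoef_of size_rcons [in RHS]big_ord_recr /=.
rewrite [take (size t).+1 _]take_oversize ?size_rcons // word_tl_rcons out_tl S_hd addr0.
case: ifPn => [_|np].
  apply: eq_bigr => i _; have le_i : (i <= size t)%N by rewrite -ltnS.
  rewrite -cats1 takel_cat // drop_cat; case: ltnP => [_|ge_i]; first by rewrite -catA.
  have -> : nat_of_ord i = size t by apply/eqP; rewrite eqn_leq le_i.
  by rewrite subnn /= drop_size.
rewrite big1 // => i _; rewrite wcoef_out // is_path_cat negb_and /=.
have -> : word_tl (word_tl v (c :: take i t)) (drop i t) = word_tl (tl c) t.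
  by rewrite -word_tl_cat cat_cons cat_take_drop.
by move: np; rewrite is_path_rcons pt /= eq_sym => /negPf ->; rewrite orbT.
Qed.

(** * The Jacobian relations of the premutation *)

Definition hook_pot : A' := \sum_(b : outQ) \sum_(a : inQ)
  arr F (p_star_out b) * arr F (p_hook b a) * arr F (p_star_in a).

Lemma premut_potE : premut_pot k S = bracket k S + hook_pot.
Proof. by []. Qed.

Lemma potential_bracket : potential (bracket k S).
Proof.
apply/potentialP => v s; have [ns|ns] := boolP (has (@is_star V Q k) s).
  by rewrite wcoef_bracket0 ?eqxx.
rewrite wcoef_bracket // => /(potentialP S).1 -/(_ potS)[]; rewrite expand_tl //.
by case: s {ns}.
Qed.

Lemma potential_sum I (r : seq I) (f : I -> A') :
  (forall i, potential (f i)) -> potential (\sum_(i <- r) f i).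
Proof.
move=> pf; apply: (big_ind (@potential F V Q')) => //; last exact: potentialD.
by apply/potentialP => v s; rewrite wcoef0 eqxx.
Qed.

Lemma potential_hook_pot : potential hook_pot.
Proof.
apply: potential_sum => b; apply: potential_sum => a; set x := _ * _ * _.
have x1 : mpow 1 x by apply: mpowMr; exact: mpow_arr.
have kx : vtx F Q' k * x = x.
  by rewrite /x !mulrA; congr (_ * _ * _); exact: (vtx_arr_hd F (p_star_out b)).
have xk : x * vtx F Q' k = x.
  by rewrite /x -mulrA; congr (_ * _); exact: (arr_vtx_tl F (p_star_in a)).
apply/potentialP => v s nz; split.
  by case: s nz => // /eqP[]; rewrite x1.
have vk : v = k by apply/eqP; apply: contraNT nz => /negPf vk; rewrite -kx wcoef_vtx_mul vk.
have sk : word_tl v s = k by apply/eqP; apply: contraNT nz => /negPf sk; rewrite -xk wcoef_mul_vtx sk.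
by rewrite sk.
Qed.

Lemma premut_potential : potential (premut_pot k S).
Proof. exact: potentialD potential_bracket potential_hook_pot. Qed.

Lemma cderiv_hook_pot (q : Q') : cderiv q hook_pot = \sum_(b : outQ) \sum_(a : inQ)
  ((if q == p_star_out b then arr F (p_hook b a) * arr F (p_star_in a) else 0) +
   (if q == p_hook b a then arr F (p_star_in a) * arr F (p_star_out b) else 0) +
   (if q == p_star_in a then arr F (p_star_out b) * arr F (p_hook b a) else 0)).
Proof.
rewrite cderivE; last exact: potential_hook_pot.
rewrite cyc_insert_suml; apply: eq_bigr => b _; rewrite cyc_insert_suml.
by apply: eq_bigr => a _; apply: cyc_insert_triangle.
Qed.

Lemma premut_deriv_old (c : oldQ) :
  cderiv (p_old c) (premut_pot k S) = bracket k (cderiv (val c) S).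
Proof.
rewrite premut_potE linearD /= cderiv_bracket_old cderiv_hook_pot.
rewrite big1 => [|b _]; first by rewrite addr0.
by rewrite big1 // => a _; rewrite addr0 addr0.
Qed.

Lemma premut_deriv_hook (b : outQ) (a : inQ) :
  cderiv (p_hook b a) (premut_pot k S) = bracket k (strip (val b) (cderiv (val a) S)) +
    arr F (p_star_in a) * arr F (p_star_out b).
Proof.
rewrite premut_potE linearD /= cderiv_bracket_hook cderiv_hook_pot; congr (_ + _).
have hookE (b' : outQ) (a' : inQ) : (p_hook b a == p_hook b' a') = (b' == b) && (a' == a).
  by rewrite andbC eq_sym; apply/eqP/andP => [[-> ->]|[/eqP -> /eqP ->]]; rewrite ?eqxx.
transitivity (\sum_(b' : outQ) if b' == b then \sum_(a' : inQ)
    (if a' == a then arr F (p_star_in a') * arr F (p_star_out b') else 0) else 0).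
  apply: eq_bigr => b' _; case: (eqVneq b' b) => [E|/negPf E].
    by apply: eq_bigr => a' _; rewrite hookE E eqxx addr0 add0r.
  by rewrite big1 // => a' _; rewrite hookE E addr0 add0r.
by rewrite -big_mkcond big_pred1_eq -big_mkcond big_pred1_eq.
Qed.

Lemma premut_deriv_in (a : inQ) :
  cderiv (p_star_in a) (premut_pot k S) = \sum_(b : outQ) arr F (p_star_out b) * arr F (p_hook b a).
Proof.
rewrite premut_potE linearD /= cderiv_bracket_star // add0r cderiv_hook_pot.
have starE (a' : inQ) : (p_star_in a == p_star_in a') = (a' == a).
  by rewrite eq_sym; apply/eqP/eqP => [[->]|->].
apply: eq_bigr => b _.
transitivity (\sum_(a' : inQ) if a' == a then arr F (p_star_out b) * arr F (p_hook b a') else 0).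
  by apply: eq_bigr => a' _; rewrite starE addr0 add0r.
by rewrite -big_mkcond big_pred1_eq.
Qed.

Lemma premut_deriv_out (b : outQ) :
  cderiv (p_star_out b) (premut_pot k S) = \sum_(a : inQ) arr F (p_hook b a) * arr F (p_star_in a).
Proof.
rewrite premut_potE linearD /= cderiv_bracket_star // add0r cderiv_hook_pot.
have starE (b' : outQ) : (p_star_out b == p_star_out b') = (b' == b).
  by rewrite eq_sym; apply/eqP/eqP => [[->]|->].
transitivity (\sum_(b' : outQ) if b' == b then \sum_(a : inQ) arr F (p_hook b' a) * arr F (p_star_in a) else 0).
  apply: eq_bigr => b' _; rewrite starE; case: (b' == b).
    by apply: eq_bigr => a _; rewrite addr0 addr0.
  by rewrite big1 // => a _; rewrite addr0 addr0.
by rewrite -big_mkcond big_pred1_eq.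
Qed.

End PremutationPotential.

(** * Premutation of a module *)

Section SubEndo.
Variables (F : fieldType) (W : lmodType F) (A : submod W).

Lemma sub_ofP (x : sub_of A) : sub_set A (val x).
Proof. exact/asboolP/(valP x). Qed.

Definition to_sub (w : W) (Aw : sub_set A w) : sub_of A :=
  exist (fun w => submod_pred A w) w (asboolT Aw).

Lemma sub_valD (x y : sub_of A) : val (x + y) = val x + val y. Proof. by []. Qed.
Lemma sub_valZ c (x : sub_of A) : val (c *: x) = c *: val x. Proof. by []. Qed.
Lemma sub_val0 : val (0 : sub_of A) = 0. Proof. exact: (raddf0 (val : {additive sub_of A -> W})). Qed.
Lemma sub_val_sum I (r : seq I) (P : pred I) (f : I -> sub_of A) :
  val (\sum_(i <- r | P i) f i) = \sum_(i <- r | P i) val (f i).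
Proof. exact: (raddf_sum (val : {additive sub_of A -> W})). Qed.

Fact sub_val_linear : linear (val : sub_of A -> W). Proof. by []. Qed.

Variables (f : {linear W -> W}) (fA : forall w, sub_set A w -> sub_set A (f w)).

Definition sub_endo (x : sub_of A) : sub_of A := to_sub (fA (sub_ofP x)).

Fact sub_endo_linear : linear sub_endo.
Proof. by move=> c x y; apply: val_inj; rewrite /= linearP. Qed.
HB.instance Definition _ := GRing.isLinear.Build F (sub_of A) (sub_of A) _ sub_endo sub_endo_linear.

End SubEndo.

Section PremutationModule.
Variables (F : fieldType) (V : finType) (Q : quiver V) (k : V).
Local Notation A := (cpalg F Q).
Local Notation Q' := (premut_quiver Q k).
Local Notation A' := (cpalg F Q').
Local Notation inQ := (in_arrow Q k).
Local Notation outQ := (out_arrow Q k).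
Local Notation oldQ := (old_arrow Q k).
Hypothesis lfQ : loop_free Q.
Hypothesis no2 : ~ in_2cycle Q k.
Variable S : A.
Hypothesis potS : potential S.
Hypothesis S_hd : forall s, wcoef S k s = 0.

Variables (U : lmodType F) (T : action Q U) (d : nat).
Hypothesis nilT : forall m, nil T d m.
Hypothesis killT : kills T S.

Local Notation B := (U * {ffun inQ -> U})%type.
Local Notation hook_deriv b a := (strip (val b) (cderiv (val a) S)).

Fact premut_sub_subproof : is_submod [set p : B | [/\ T (vtx F Q k) p.1 = 0,
  forall a : inQ, T (vtx F Q (tl (val a))) (p.2 a) = p.2 a &
  \sum_(a : inQ) T (arr F (val a)) (p.2 a) = 0]].
Proof.
split=> [|c x y [x1 x2 x3] [y1 y2 y3]]; split=> /=.
- exact: ap0.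
- by move=> a; rewrite !ffunE ap0.
- by rewrite big1 // => a _; rewrite ffunE ap0.
- by rewrite apD apZ x1 y1 scaler0 addr0.
- by move=> a; rewrite !ffunE apD apZ x2 y2.
under eq_bigr => a _ do rewrite !ffunE apD apZ.
by rewrite big_split -scaler_sumr /= x3 y3 scaler0 addr0.
Qed.
(* Pairs (m, z) with m in the sum of the U_j, j <> k, and z in ker alpha. *)
Definition premut_sub : submod B := Submod premut_sub_subproof.

Definition pm_vtx i (p : B) : B := if i == k then (0, p.2) else (T (vtx F Q i) p.1, 0).
(** The arrows of the premutation once its space at [k] is identified with ker alpha: [a^*] acts
    through the inclusion and [b^*] through - gamma. The formulas make sense on the whole product
    and preserve [premut_sub]. *)
Definition pm_arr (q : Q') (p : B) : B := match q with
  | inl (inl c) => (T (arr F (val c)) p.1, 0)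
  | inl (inr (b, a)) => (T (arr F (val b)) (T (arr F (val a)) p.1), 0)
  | inr (inl a) => (p.2 a, 0)
  | inr (inr b) => (0, [ffun a : inQ => - T (hook_deriv b a) p.1])
  end.

Fact pm_vtx_linear i : linear (pm_vtx i).
Proof.
move=> c x y; rewrite /pm_vtx; case: ifP => _; congr (_, _); rewrite /= ?scaler0 ?addr0 //.
by rewrite apD apZ.
Qed.
HB.instance Definition _ i := GRing.isLinear.Build F B B _ (pm_vtx i) (pm_vtx_linear i).

Fact pm_arr_linear q : linear (pm_arr q).
Proof.
move=> c x y; case: q => [[c'|[b a]]|[a|b]]; congr (_, _); rewrite /= ?scaler0 ?addr0 //.
- by rewrite apD apZ.
- by rewrite !apD !apZ.
- by rewrite !ffunE.
by apply/ffunP => a; rewrite !ffunE apD apZ opprD scalerN.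
Qed.
HB.instance Definition _ q := GRing.isLinear.Build F B B _ (pm_arr q) (pm_arr_linear q).

Lemma hook_deriv_vtx (b : outQ) (a : inQ) m :
  T (vtx F Q (tl (val a))) (T (hook_deriv b a) m) = T (hook_deriv b a) m.
Proof. by rewrite -apM vtx_strip vtx_cderiv. Qed.

Lemma hook_deriv_hd (b : outQ) (a : inQ) m :
  T (hook_deriv b a) (T (vtx F Q (hd (val b))) m) = T (hook_deriv b a) m.
Proof. by rewrite -apM strip_vtx_hd. Qed.

Lemma hook_deriv_hd0 (b : outQ) (a : inQ) i m : i != hd (val b) ->
  T (hook_deriv b a) (T (vtx F Q i) m) = 0.
Proof. by move=> /negPf ib; rewrite -hook_deriv_hd ap_vtx_vtx eq_sym ib ap0. Qed.

Lemma kills_cderiv a m : T (cderiv a S) m = 0.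
Proof. by apply: killT; apply: cderiv_jac. Qed.

(** This is gamma beta = 0: only outgoing arrows have tail [k], so the sum is the derivative along
    [a]. *)
Lemma sum_out_hook (a : inQ) m :
  \sum_(b : outQ) T (hook_deriv b a) (T (arr F (val b)) m) = 0.
Proof.
rewrite -[RHS](kills_cderiv (val a) m) ap_strip1; last exact: cderiv_mpow1.
rewrite (sum_arrows k lfQ) [X in X + _ + _]big1 => [|c _]; last first.
  by rewrite strip_cderiv ?ap0l // in_hd; apply/eqP; exact: old_tl.
rewrite [X in _ + X + _]big1 => [|c _]; last first.
  by rewrite strip_cderiv ?ap0l // in_hd; apply/eqP; exact: in_tl.
by rewrite !add0r.
Qed.

(** This is alpha gamma = 0, since [cderiv_out] turns the sum into the derivative along [b]. *)
Lemma sum_in_hook (b : outQ) m :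
  \sum_(a : inQ) T (arr F (val a)) (T (hook_deriv b a) m) = 0.
Proof.
rewrite -[RHS](kills_cderiv (val b) m) (cderiv_out lfQ potS S_hd) ap_suml.
by apply: eq_bigr => a _; rewrite apM.
Qed.

Fact pm_vtx_sub i w : sub_set premut_sub w -> sub_set premut_sub (pm_vtx i w).
Proof.
move=> [w1 w2 w3]; rewrite /pm_vtx; have [_|/negPf ik] := eqVneq i k; split=> //=.
- exact: ap0.
- by rewrite ap_vtx_vtx eq_sym ik.
- by move=> a; rewrite ffunE ap0.
by rewrite big1 // => a _; rewrite ffunE ap0.
Qed.

Fact pm_arr_sub q w : sub_set premut_sub w -> sub_set premut_sub (pm_arr q w).
Proof.
move=> [w1 w2 w3].
case: q => [[c|[b a]]|[a|b]]; split=> //=; try by move=> *; rewrite ffunE ap0.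
- by rewrite ap_vtx_arr0 // eq_sym old_hd.
- by rewrite big1 // => a _; rewrite ffunE ap0.
- by rewrite ap_vtx_arr0 // eq_sym out_hd.
- by rewrite big1 // => a' _; rewrite ffunE ap0.
- by rewrite -w2 ap_vtx_vtx eq_sym (negPf (in_tl lfQ a)).
- by rewrite big1 // => a' _; rewrite ffunE ap0.
- exact: ap0.
- by move=> a; rewrite ffunE apN hook_deriv_vtx.
under eq_bigr => a _ do rewrite ffunE apN.
by rewrite sumrN sum_in_hook oppr0.
Qed.

Local Notation N := (sub_of premut_sub).
Definition premut_vtx_endo i : {linear N -> N} := sub_endo (@pm_vtx_sub i).
Definition premut_arr_endo q : {linear N -> N} := sub_endo (@pm_arr_sub q).

Lemma nil_mpow1 e x m : mpow 1 x -> nil T e.+1 m -> nil T e (T x m).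
Proof.
move=> x1 em; apply: nil_mpow => z ze; rewrite -apM; apply: (ap_order _ em).
by rewrite -addn1; apply: mpowM.
Qed.

Local Notation rnilB := (rnil (fun q => pm_arr q : {linear B -> B})).

(** A detour through [k], [b^*] then [a^*], uses two arrows and is only sure to lower the nilpotency
    order in [U] by one, hence the doubling. The extra unit serves vectors located at [k]. *)
Lemma pm_rnil p : rnilB (d.*2).+1 p.
Proof.
have out0 (b : outQ) : [ffun a : inQ => - T (hook_deriv b a) 0] = 0.
  by apply/ffunP => a; rewrite !ffunE ap0 oppr0.
have z_nil e (z : {ffun inQ -> U}) : (forall a, rnilB e (z a, 0)) -> rnilB e.+1 (0, z).
  move=> ze [[c|[b a]]|[a|b]].
  - change (rnilB e (T (arr F (val c)) 0, 0)); rewrite ap0; exact: rnil0.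
  - change (rnilB e (T (arr F (val b)) (T (arr F (val a)) 0), 0)); rewrite !ap0; exact: rnil0.
  - exact: ze.
  change (rnilB e (0, [ffun a : inQ => - T (hook_deriv b a) 0])); rewrite out0; exact: rnil0.
have m_nil e m : nil T e m -> rnilB e.*2 (m, 0).
  elim: e m => [m /= -> //|e IH m em]; rewrite doubleS => -[[c|[b a]]|[a|b]].
  - by apply: rnilS; apply: IH; apply: em.
  - by apply: rnilS; apply: IH; apply: nil_mpow1; [exact: mpow_arr | apply: nilS; apply: em].
  - by change (rnilB e.*2.+1 ((0 : {ffun inQ -> U}) a, 0)); rewrite ffunE; apply: rnil0.
  apply: z_nil => a; rewrite ffunE; apply: IH; rewrite -scaleN1r -apZl.
  by apply: nil_mpow1 em; apply: mpowZ; apply: strip_cderiv_mpow1.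
case: p => m z; have -> : (m, z) = 1 *: (m, 0) + (0, z) :> B.
  by rewrite scale1r; congr (_, _); rewrite /= ?addr0 ?add0r.
apply: rnilD; first by apply: rnilS; apply: m_nil.
by apply: z_nil => a; apply: m_nil.
Qed.

Lemma pm_vtxk p : pm_vtx k p = (0, p.2). Proof. by rewrite /pm_vtx eqxx. Qed.
Lemma pm_vtxN i p : i != k -> pm_vtx i p = (T (vtx F Q i) p.1, 0).
Proof. by move=> /negPf ik; rewrite /pm_vtx ik. Qed.

Lemma pm_vtx_vtx i j p : pm_vtx i (pm_vtx j p) = if i == j then pm_vtx i p else 0.
Proof.
have [jk|jk] := eqVneq j k.
  rewrite jk pm_vtxk; have [->|ik] := eqVneq i k; first by rewrite !pm_vtxk.
  by rewrite pm_vtxN //= ap0.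
rewrite (pm_vtxN _ jk); have [ik|ik] := eqVneq i k.
  by rewrite ik pm_vtxk eq_sym (negPf jk).
by rewrite !pm_vtxN //= ap_vtx_vtx; case: eqP.
Qed.

Lemma pm_vtx_sum p : T (vtx F Q k) p.1 = 0 -> \sum_i pm_vtx i p = p.
Proof.
move=> pk; rewrite (bigD1 k) //= pm_vtxk.
have -> : \sum_(i | i != k) pm_vtx i p = (p.1, 0).
  rewrite -[in RHS](ap_vtx_sum T p.1) [in RHS](bigD1 k) //= pk add0r.
  apply: (big_rec2 (fun (p : B) u => p = (u, 0))) => // i u p' ik ->.
  by rewrite pm_vtxN //; congr (_, _); rewrite /= addr0.
by rewrite [RHS]surjective_pairing; congr (_, _); rewrite /= ?add0r ?addr0.
Qed.

Lemma pm_arr_vtx q i p : pm_arr q (pm_vtx i p) = if i == tl q then pm_arr q p else 0.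
Proof.
have [->|ik] := eqVneq i k.
  rewrite pm_vtxk; case: q => [[c|[b a]]|[a|b]] /=.
  - by rewrite eq_sym (negPf (old_tl c)) ap0.
  - by rewrite eq_sym (negPf (in_tl lfQ a)) !ap0.
  - by rewrite eqxx.
  rewrite eq_sym (negPf (out_hd lfQ b)); congr (_, _).
  by apply/ffunP => a; rewrite !ffunE ap0 oppr0.
rewrite pm_vtxN //; case: q => [[c|[b a]]|[a|b]] /=.
- have [->|it] := eqVneq i (tl (val c)); first by rewrite ap_arr_vtx.
  by rewrite ap_arr_vtx0.
- have [->|it] := eqVneq i (tl (val a)); first by rewrite ap_arr_vtx.
  by rewrite ap_arr_vtx0 // ap0.
- by rewrite (negPf ik) ffunE.
have [->|it] := eqVneq i (hd (val b)); congr (_, _); apply/ffunP => a; rewrite !ffunE.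
  by rewrite hook_deriv_hd.
by rewrite hook_deriv_hd0 // oppr0.
Qed.

Lemma pm_vtx_arr q i p : sub_set premut_sub p ->
  pm_vtx i (pm_arr q p) = if i == hd q then pm_arr q p else 0.
Proof.
move=> [_ p2 _]; have [->|ik] := eqVneq i k.
  rewrite pm_vtxk; case: q => [[c|[b a]]|[a|b]] /=.
  - by rewrite eq_sym (negPf (old_hd c)).
  - by rewrite eq_sym (negPf (out_hd lfQ b)).
  - by rewrite eq_sym (negPf (in_tl lfQ a)).
  by rewrite eqxx.
rewrite pm_vtxN //; case: q => [[c|[b a]]|[a|b]] /=.
- have [->|it] := eqVneq i (hd (val c)); first by rewrite ap_vtx_arr.
  by rewrite ap_vtx_arr0.
- have [->|it] := eqVneq i (hd (val b)); first by rewrite ap_vtx_arr.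
  by rewrite ap_vtx_arr0.
- have [->|it] := eqVneq i (tl (val a)); first by rewrite p2.
  by rewrite -p2 ap_vtx_vtx (negPf it).
by rewrite (negPf ik) ap0.
Qed.

Lemma premut_rep : is_nilrep premut_vtx_endo premut_arr_endo (d.*2).+1.
Proof.
split=> [i j x|x|q i x|q i x|x].
- by apply: val_inj; rewrite [LHS]/= pm_vtx_vtx; case: ifP.
- by apply: val_inj; rewrite sub_val_sum; apply: pm_vtx_sum; case: (sub_ofP x).
- by apply: val_inj; rewrite [LHS]/= pm_arr_vtx; case: ifP.
- by apply: val_inj; rewrite [LHS]/= pm_vtx_arr; [case: ifP | exact: sub_ofP].
have := pm_rnil (val x); elim: (d.*2).+1 x => [x /= x0|e IH x xe q].
  exact: val_inj.
by apply: IH; apply: xe.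
Qed.

Definition premut_action : action Q' N := rep_action premut_rep.
Arguments premut_action : simpl never.

Lemma premut_action_arr q n : val (premut_action (arr F q) n) = pm_arr q (val n).
Proof. by rewrite /premut_action rep_action_arr. Qed.

Lemma premut_action_vtx i n : val (premut_action (vtx F Q' i) n) = pm_vtx i (val n).
Proof. by rewrite /premut_action rep_action_vtx. Qed.

Lemma premut_action_nil n : nil premut_action (d.*2).+1 n.
Proof. exact: rep_action_nil. Qed.

Definition off_vtx (m : U) : U := m - T (vtx F Q k) m.

Fact off_vtx_linear : linear off_vtx.
Proof. by move=> c m n; rewrite /off_vtx apD apZ opprD addrACA -scalerBr. Qed.
HB.instance Definition _ := GRing.isLinear.Build F U U _ off_vtx off_vtx_linear.

Lemma off_vtx_id x i m : i != k -> vtx F Q i * x = x -> off_vtx (T x m) = T x m.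
Proof.
move=> /negPf ik ix; rewrite /off_vtx -ix apM ap_vtx_vtx eq_sym ik subr0 //.
Qed.

Lemma ap_vtx_hd q i m : hd q = i -> T (vtx F Q i) (T (arr F q) m) = T (arr F q) m.
Proof. by move=> <-; rewrite ap_vtx_arr. Qed.

Lemma off_vtx_hd a m : hd a = k -> off_vtx (T (arr F a) m) = 0.
Proof.
move=> ak; rewrite /off_vtx.
by rewrite ap_vtx_hd ?subrr.
Qed.

Lemma pair_sum I (r : seq I) (f : I -> U) :
  \sum_(i <- r) (f i, 0) = (\sum_(i <- r) f i, 0) :> B.
Proof.
apply: (big_rec2 (fun (p : B) u => p = (u, 0))) => // i u p _ ->.
by congr (_, _); rewrite /= addr0.
Qed.

Lemma pair_sum2 I (r : seq I) (f : I -> {ffun inQ -> U}) :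
  \sum_(i <- r) (0, f i) = (0, \sum_(i <- r) f i) :> B.
Proof.
apply: (big_rec2 (fun (p : B) u => p = (0, u))) => // i u p _ ->.
by congr (_, _); rewrite /= addr0.
Qed.

Lemma ap_arr_tl q i m : tl q = i -> T (arr F q) (T (vtx F Q i) m) = T (arr F q) m.
Proof. by move=> <-; rewrite ap_arr_vtx. Qed.

Lemma ap_arr_at a q m : T (vtx F Q a) m = m -> tl q != a -> T (arr F q) m = 0.
Proof. by move=> <- qa; rewrite ap_arr_vtx0 // eq_sym. Qed.

Lemma ap_arr_off q m : T (vtx F Q k) m = 0 -> tl q = k -> T (arr F q) m = 0.
Proof. by move=> mk qk; rewrite -ap_arr_vtx qk mk ap0. Qed.

Lemma off_vtx_in x (a : inQ) m : off_vtx (T x (T (arr F (val a)) m)) =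
  \sum_(b : outQ) off_vtx (T (strip (val b) x) (T (arr F (val b)) (T (arr F (val a)) m))).
Proof.
have am : T (vtx F Q k) (T (arr F (val a)) m) = T (arr F (val a)) m.
  by apply: ap_vtx_hd; exact: in_hd.
rewrite ap_strip linearD linear_sum /= big1 ?add0r => [|i _]; last first.
  have [->|ik] := eqVneq i k; first by rewrite am linearZ /= off_vtx_hd ?scaler0 ?in_hd.
  by rewrite ap_vtx_arr0 ?in_hd // scaler0 linear0.
rewrite (sum_arrows k lfQ) [X in X + _ + _]big1 => [|c _]; last first.
  by rewrite (ap_arr_at am) ?ap0 ?old_tl.
rewrite [X in _ + X + _]big1 => [|c _]; last by rewrite (ap_arr_at am) ?ap0 ?in_tl.
by rewrite !add0r linear_sum.
Qed.

Lemma off_vtx_strip x m : T (vtx F Q k) m = 0 -> off_vtx (T x m) =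
  \sum_i wcoef x i [::] *: off_vtx (T (vtx F Q i) m) +
  (\sum_(c : oldQ) off_vtx (T (strip (val c) x) (T (arr F (val c)) m)) +
   \sum_(b : outQ) \sum_(a : inQ) off_vtx (T (strip (val b) (strip (val a) x))
      (T (arr F (val b)) (T (arr F (val a)) m)))).
Proof.
move=> mk; rewrite [in LHS]ap_strip linearD linear_sum /=; congr (_ + _).
  by apply: eq_bigr => i _; rewrite linearZ.
rewrite linear_sum (sum_arrows k lfQ) /= [X in _ + X]big1 ?addr0 => [|b _]; last first.
  by rewrite ap_arr_off ?out_tl // ap0 linear0.
congr (_ + _); rewrite exchange_big; apply: eq_bigr => a _; exact: off_vtx_in.
Qed.

(** Paths ending at [k] have no bracketed form, so [x] acts as [x] followed by the projection away
    from [k]. The induction peels off an old arrow or a whole hook, by [off_vtx_strip]. *)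
Lemma premut_action_bracket0 x n e : (val n).2 = 0 -> nil T e (val n).1 ->
  val (premut_action (bracket k x) n) = (off_vtx (T x (val n).1), 0).
Proof.
elim: e x n => [|e IH] x n n2 en.
  have -> : n = 0 by apply: val_inj; rewrite [LHS]surjective_pairing n2 [(val n).1]en.
  by rewrite ap0 sub_val0 /= ap0 linear0.
have [nk _ _] := sub_ofP n.
have vtxE i : val (wcoef (bracket k x) i [::] *: premut_action (vtx F Q' i) n) =
    (wcoef x i [::] *: off_vtx (T (vtx F Q i) (val n).1), 0).
  rewrite sub_valZ premut_action_vtx wcoef_bracket //; have [->|ik] := eqVneq i k.
    by rewrite pm_vtxk n2 nk [off_vtx 0]linear0 scaler0; congr (_, _); rewrite /= scaler0.
  rewrite pm_vtxN // [X in (_ *: X, _)](_ : _ = T (vtx F Q i) (val n).1).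
    by congr (_, _); rewrite /= scaler0.
  by apply: (off_vtx_id _ ik); rewrite vtx_mul eqxx scale1r.
have oldE (c : oldQ) : val (premut_action (strip (p_old c) (bracket k x)) (premut_action (arr F (p_old c)) n)) =
    (off_vtx (T (strip (val c) x) (T (arr F (val c)) (val n).1)), 0).
  by rewrite strip_bracket_old IH premut_action_arr //=; apply: en.
have hookE (b : outQ) (a : inQ) :
    val (premut_action (strip (p_hook b a) (bracket k x)) (premut_action (arr F (p_hook b a)) n)) =
    (off_vtx (T (strip (val b) (strip (val a) x)) (T (arr F (val b)) (T (arr F (val a)) (val n).1))), 0).
  rewrite strip_bracket_hook IH premut_action_arr //=.
  by apply: nil_mpow1; [exact: mpow_arr | apply: nilS; apply: en].
rewrite ap_strip sub_valD !sub_val_sum sum_premut_arrows off_vtx_strip //.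
under eq_bigr => i _ do rewrite vtxE.
under [X in _ + (X + _ + _)]eq_bigr => c _ do rewrite oldE.
under [X in _ + (_ + X + _)]eq_bigr => b _.
  under eq_bigr => a _ do rewrite hookE.
  rewrite pair_sum; over.
rewrite [X in _ + (_ + (X + _))]big1 => [|a _]; last by rewrite strip_bracket_star // ap0l.
rewrite [X in _ + (_ + (_ + X))]big1 => [|b _]; last by rewrite strip_bracket_star // ap0l.
by rewrite !pair_sum !addr0; congr (_, _); rewrite /= !addr0.
Qed.

(** Star-free paths of positive length do not start at [k], so the component of [n] in ker alpha
    contributes nothing. *)
Lemma premut_action_bracket x n : mpow 1 x -> val (premut_action (bracket k x) n) = (off_vtx (T x (val n).1), 0).
Proof.
move=> x1; pose n0 := n - premut_action (vtx F Q' k) n.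
have n0E : val n0 = ((val n).1, 0).
  rewrite [LHS](sub_valD n (- _)) -scaleN1r sub_valZ premut_action_vtx pm_vtxk scaleN1r.
  by rewrite [X in X + _]surjective_pairing; congr (_, _); rewrite /= ?subr0 ?subrr.
have -> : premut_action (bracket k x) n = premut_action (bracket k x) n0.
  rewrite /n0 apB ap_strip1 ?[X in _ - X]ap_strip1; try exact: mpow1_bracket.
  rewrite -sumrB; apply: eq_bigr => q _; have [sq|nsq] := boolP (is_star q).
    by rewrite strip_bracket_star // !ap0l subr0.
  rewrite ap_arr_vtx0 ?ap0 ?subr0 // eq_sym.
  by case: q nsq => [[c|[b a]]|//] _ /=; [exact: old_tl | exact: in_tl].
by rewrite (@premut_action_bracket0 x n0 d) n0E //=; apply: nilT.
Qed.

(** The sign in - gamma gives the relations along hooks; those along [a^*] and [b^*] are gamma beta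
    = 0 and membership in ker alpha; the others come from [U]. *)
Lemma premut_action_kills : kills premut_action (premut_pot k S).
Proof.
apply: (kills_of_deriv premut_action_nil) => q n; apply: val_inj; rewrite sub_val0.
have [nk n2 n3] := sub_ofP n; case: q => [[c|[b a]]|[a|b]].
- rewrite premut_deriv_old // premut_action_bracket ?kills_cderiv ?linear0 //.
  exact: cderiv_mpow1.
- rewrite premut_deriv_hook // apDl sub_valD premut_action_bracket; last exact: strip_cderiv_mpow1.
  rewrite apM !premut_action_arr /= ffunE (off_vtx_id (i := tl (val a))) ?in_tl //.
    by congr (_, _); rewrite /= ?subrr ?addr0.
  by rewrite vtx_strip vtx_cderiv.
- rewrite premut_deriv_in // ap_suml sub_val_sum.
  under eq_bigr => b _ do rewrite apM !premut_action_arr /=.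
  rewrite pair_sum2; congr (_, _); apply/ffunP => a'; rewrite sum_ffunE ffunE.
  by under eq_bigr => b _ do rewrite ffunE; rewrite sumrN sum_out_hook oppr0.
rewrite premut_deriv_out // ap_suml sub_val_sum.
under eq_bigr => a _ do rewrite apM !premut_action_arr /=.
by rewrite pair_sum -ap_sum n3 ap0.
Qed.

Lemma premut_finite_dim : finite_dim U -> finite_dim N.
Proof.
move=> fU; pose v : {linear N -> B} := HB.pack (val : N -> B)
  (GRing.isLinear.Build F N B _ (val : N -> B) (@sub_val_linear F B premut_sub)).
apply: (@finite_dim_inj_lin _ _ _ v); first exact: val_inj.
by apply: finite_dim_prod => //; apply: finite_dim_ffun.
Qed.

Variables (l : V) (s : U).
Hypothesis kl : k != l.
Hypothesis soc : socle_spanned T l s.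
Hypothesis lft : lifts T S.

Lemma socle_off : T (vtx F Q k) s = 0.
Proof. by have [_ <- _ _] := soc; rewrite ap_vtx_vtx (negPf kl). Qed.

(** beta is injective: its kernel lies in the socle, which is located at [l] and not at [k]. *)
Lemma ker_out0 m : T (vtx F Q k) m = m -> (forall b : outQ, T (arr F (val b)) m = 0) -> m = 0.
Proof.
move=> mk bm; have [_ _ _ socm] := soc.
have [q|c mc] := socm m; last by rewrite -mk mc apZ socle_off scaler0.
have [qk|qk] := eqVneq (tl q) k; last exact: ap_arr_at mk qk.
exact: (bm (exist _ q (introT eqP qk))).
Qed.

(** The [a^*] detect the component in ker alpha. An incoming arrow [a] is seen only through hooks,
    but if b a m = 0 for all [b] then a m = 0 by [ker_out0]. *)
Lemma premut_action_socle : exists sN, socle_spanned premut_action l sN.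
Proof.
have [s0 ls as0 socm] := soc.
have sNP : sub_set premut_sub (s, 0).
  split=> /=; [exact: socle_off | by move=> a; rewrite ffunE ap0 |].
  by rewrite big1 // => a _; rewrite ffunE ap0.
have rs0 (b : outQ) (a : inQ) : T (hook_deriv b a) s = 0.
  by apply: (ap_order (d := 1)); [exact: strip_cderiv_mpow1 | exact: as0].
exists (to_sub sNP); split.
- by apply: contraNneq s0 => /(congr1 val) /= [->].
- by apply: val_inj; rewrite premut_action_vtx pm_vtxN /= ?ls // eq_sym.
- move=> q; apply: val_inj; rewrite premut_action_arr sub_val0.
  case: q => [[c|[b a]]|[a|b]] /=; rewrite ?as0 ?ap0 ?ffunE //.
  by congr (_, _); apply/ffunP => a; rewrite !ffunE rs0 oppr0.
move=> n an; have [nk n2 n3] := sub_ofP n.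
have anE q : pm_arr q (val n) = 0 by rewrite -premut_action_arr an sub_val0.
have z0 : (val n).2 = 0 by apply/ffunP => a; rewrite ffunE; have [] := anE (p_star_in a).
have [q|c mc] := socm (val n).1.
  have [hk|hk] := eqVneq (tl q) k; first exact: ap_arr_off.
  have [hq|hq] := eqVneq (hd q) k; last first.
    pose c : oldQ := exist _ q (introT andP (conj hq hk)).
    by have [] := anE (p_old c).
  pose a : inQ := exist _ q (introT eqP hq).
  apply: ker_out0; first by apply: ap_vtx_hd.
  by move=> b; have [] := anE (p_hook b a).
exists c; apply: val_inj; rewrite sub_valZ [LHS]surjective_pairing z0 mc.
by congr (_, _); rewrite /= scaler0.
Qed.

(** A family over the premutation is converted into one over [Q], by factoring its hook components
    through [U_k], and a family in ker alpha. The lifting property of [U] serves at [k] for the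
    factorisation, and then for the family over [Q]. *)
Lemma premut_action_lifts : lifts premut_action (premut_pot k S).
Proof.
move=> y yv yS.
pose Y q := val (y q).
have YP q : sub_set premut_sub (Y q) by exact: sub_ofP.
have Yv q : pm_vtx (hd q) (Y q) = Y q by rewrite -premut_action_vtx yv.
have Y2 q : hd q != k -> (Y q).2 = 0 by move=> qk; rewrite -Yv pm_vtxN.
have Y1 q : hd q != k -> T (vtx F Q (hd q)) (Y q).1 = (Y q).1.
  by move=> qk; rewrite -[in RHS]Yv pm_vtxN.
have Yk q : hd q = k -> (Y q).1 = 0 by move=> qk; rewrite -Yv qk pm_vtxk.
have Yold (c : oldQ) : T (vtx F Q (hd (val c))) (Y (p_old c)).1 = (Y (p_old c)).1.
  exact: (Y1 (p_old c) (old_hd c)).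
have Yhook (b : outQ) (a : inQ) : T (vtx F Q (hd (val b))) (Y (p_hook b a)).1 = (Y (p_hook b a)).1.
  exact: (Y1 (p_hook b a) (out_hd lfQ b)).
have Yin (a : inQ) : T (vtx F Q (tl (val a))) (Y (p_star_in a)).1 = (Y (p_star_in a)).1.
  exact: (Y1 (p_star_in a) (in_tl lfQ a)).
have stripM (p1 p2 : Q') : \sum_q premut_action (strip q (arr F p1 * arr F p2)) (y q) =
    premut_action (arr F p1) (y p2).
  transitivity (\sum_q if q == p2 then premut_action (arr F p1) (y p2) else 0); last first.
    by rewrite -big_mkcond big_pred1_eq.
  apply: eq_bigr => q _; rewrite strip_mul wcoef_arr scale0r addr0 strip_arr.
  case: eqP => [->|_]; last by rewrite scale0r mulr0 ap0l.
  by rewrite scale1r apM yv.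
have stripB x : val (\sum_q premut_action (strip q (bracket k x)) (y q)) =
    (off_vtx (\sum_(c : oldQ) T (strip (val c) x) (Y (p_old c)).1 +
     \sum_(b : outQ) \sum_(a : inQ) T (strip (val b) (strip (val a) x)) (Y (p_hook b a)).1), 0).
  have NB q z : hd q != k -> val (premut_action (bracket k z) (y q)) = (off_vtx (T z (Y q).1), 0).
    by move=> qk; apply: premut_action_bracket0 (nilT _); exact: Y2.
  rewrite sum_premut_arrows !sub_valD !sub_val_sum.
  under eq_bigr => c _ do rewrite strip_bracket_old (NB (p_old c)) ?old_hd //.
  rewrite pair_sum; under [X in _ + X + _]eq_bigr => b _.
    rewrite sub_val_sum; under eq_bigr => a _ do rewrite strip_bracket_hook (NB (p_hook b a)) ?out_hd //.
    rewrite pair_sum; over.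
  rewrite pair_sum.
  rewrite [X in _ + (X + _)]big1 => [|a _]; last by rewrite strip_bracket_star // ap0l.
  rewrite [X in _ + (_ + X)]big1 => [|b _]; last by rewrite strip_bracket_star // ap0l.
  rewrite !addr0 linearD !linear_sum /=; congr (_, _); last by rewrite /= addr0.
  by congr (_ + _); apply: eq_bigr => b _; rewrite linear_sum.
(* The future component in ker alpha: by the relations along the [b^*], all outgoing arrows kill its
   image under alpha, and beta is injective. *)
pose n := [ffun a : inQ => (Y (p_star_in a)).1].
have n_sum : \sum_(a : inQ) T (arr F (val a)) (n a) = 0.
  apply: ker_out0; first by rewrite ap_sum; apply: eq_bigr => a _; apply: ap_vtx_hd; exact: in_hd.
  move=> b; have := yS (p_star_out b); rewrite premut_deriv_out //.
  under eq_bigr => q _ do rewrite linear_sum ap_suml.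
  rewrite exchange_big; under eq_bigr => a _ do rewrite stripM.
  move/(congr1 val); rewrite sub_val0 sub_val_sum.
  under eq_bigr => a _ do rewrite premut_action_arr /=.
  rewrite pair_sum => -[E]; rewrite -[RHS]E ap_sum.
  by apply: eq_bigr => a _; rewrite ffunE.
(* For each [a], the hook components with second arrow [a] form an element of ker gamma. *)
have hookE (a a' : inQ) : \sum_(b : outQ) T (hook_deriv b a') (Y (p_hook b a)).1 = 0.
  have := yS (p_star_in a); rewrite premut_deriv_in //.
  under eq_bigr => q _ do rewrite linear_sum ap_suml.
  rewrite exchange_big; under eq_bigr => b _ do rewrite stripM.
  move/(congr1 val); rewrite sub_val0 sub_val_sum.
  under eq_bigr => b _ do rewrite premut_action_arr /=.
  rewrite pair_sum2 => -[/ffunP/(_ a')]; rewrite sum_ffunE ffunE.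
  under eq_bigr => b _ do rewrite ffunE.
  by rewrite sumrN => /eqP; rewrite oppr_eq0 => /eqP.
have oldE (c : oldQ) :
    \sum_(c' : oldQ) T (strip (val c') (cderiv (val c) S)) (Y (p_old c')).1 +
    \sum_(b : outQ) \sum_(a : inQ) T (strip (val b) (strip (val a) (cderiv (val c) S))) (Y (p_hook b a)).1 = 0.
  have := congr1 val (yS (p_old c)); rewrite premut_deriv_old // stripB sub_val0 => -[E].
  have vE : vtx F Q (tl (val c)) * cderiv (val c) S = cderiv (val c) S by exact: vtx_cderiv.
  rewrite -[RHS]E linearD !linear_sum /=; congr (_ + _).
    apply: eq_bigr => c' _; rewrite (off_vtx_id _ (old_tl c)) //.
    by rewrite vtx_strip vE.
  apply: eq_bigr => b _; rewrite linear_sum; apply: eq_bigr => a _ /=.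
  by rewrite (off_vtx_id _ (old_tl c)) // !vtx_strip vE.
have hookE2 (b : outQ) (a : inQ) :
    \sum_(c : oldQ) T (strip (val c) (hook_deriv b a)) (Y (p_old c)).1 = - (Y (p_star_out b)).2 a.
  have := yS (p_hook b a); rewrite premut_deriv_hook //.
  under eq_bigr => q _ do rewrite linearD apDl.
  rewrite big_split /= stripM => /(congr1 val); rewrite sub_val0 sub_valD stripB premut_action_arr /= => -[E _].
  apply/eqP; rewrite -subr_eq0 opprK -[X in _ == X]E; apply/eqP; congr (_ + _).
  rewrite [X in _ + X]big1 ?addr0 => [|b' _]; last first.
    rewrite big1 // => a' _; rewrite [strip (val a') _]strip_strip0 ?linear0 ?ap0l //.
    by apply/eqP; exact: hook_neq.
  rewrite linear_sum; apply: eq_bigr => c _ /=.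
  by rewrite (off_vtx_id _ (in_tl lfQ a)) // !vtx_strip vtx_cderiv.
(* Since ker gamma = im beta, these components are the b w for one vector [w] at [k]. *)
have wP (a : inQ) : exists2 w, T (vtx F Q k) w = w &
    forall b : outQ, T (arr F (val b)) w = (Y (p_hook b a)).1.
  pose y' (q : Q) : U := if insub q is Some b then (Y (p_hook (b : outQ) a)).1 else 0.
  have y'E (b : outQ) : y' (val b) = (Y (p_hook b a)).1 by rewrite /y' valK.
  have y'0 q : tl q != k -> y' q = 0 by move=> qk; rewrite /y' insubN.
  have [q|a'|w wE] := @lft y'.
  - by rewrite /y'; case: insubP => [b _ <-|_]; [exact: Yhook | exact: ap0].
  - have [ak|ak] := eqVneq (hd a') k; last first.
      rewrite big1 // => q _; have [qk|qk] := eqVneq (tl q) k; last by rewrite y'0 ?ap0.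
      by rewrite strip_cderiv ?ap0l // qk; apply/eqP; rewrite eq_sym.
    rewrite (sum_arrows k lfQ) [X in X + _ + _]big1 => [|c _]; last by rewrite y'0 ?ap0 ?old_tl.
    rewrite [X in _ + X + _]big1 => [|c _]; last by rewrite y'0 ?ap0 ?in_tl.
    rewrite !add0r -[RHS](hookE a (exist _ a' (introT eqP ak))).
    by apply: eq_bigr => b _; rewrite y'E.
  exists (T (vtx F Q k) w); first by rewrite ap_vtx_vtx eqxx.
  by move=> b; rewrite ap_arr_tl ?out_tl // -wE y'E.
pose w a := s2val (cid2 (wP a)).
have wk a : T (vtx F Q k) (w a) = w a by rewrite /w; case: cid2.
have wb (a : inQ) (b : outQ) : T (arr F (val b)) (w a) = (Y (p_hook b a)).1 by rewrite /w; case: cid2.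
(* The family over [Q]: incoming arrows receive the factors [w], and outgoing ones 0, as the vector
   sought has no component at [k]. *)
pose Yh (q : Q) : U := if insub q is Some c then (Y (p_old (c : oldQ))).1
  else if insub q is Some a then w (a : inQ) else 0.
have YhO (c : oldQ) : Yh (val c) = (Y (p_old c)).1 by rewrite /Yh valK.
have YhI (a : inQ) : Yh (val a) = w a.
  by rewrite /Yh insubN ?valK // negb_and negbK in_hd eqxx.
have Yh0 (b : outQ) : Yh (val b) = 0.
  by rewrite /Yh !insubN ?out_hd // out_tl eqxx andbF.
have sumYh x : \sum_q T (strip q x) (Yh q) = \sum_(c : oldQ) T (strip (val c) x) (Y (p_old c)).1 +
    \sum_(a : inQ) T (strip (val a) x) (w a).
  rewrite (sum_arrows k lfQ) [X in _ + X]big1 ?addr0 => [|b _]; last by rewrite Yh0 ap0.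
  by congr (_ + _); apply: eq_bigr => c _; rewrite (YhO, YhI).
have [q|q|m mE] := @lft Yh.
- rewrite /Yh; case: insubP => [c _ <-|_]; first exact: Yold.
  by case: insubP => [a _ <-|_]; [rewrite in_hd wk | rewrite ap0].
- rewrite sumYh; have [hq|hq] := eqVneq (hd q) k.
    rewrite !big1 ?addr0 // => c _; rewrite strip_cderiv ?ap0l // hq; apply/eqP.
      exact: in_tl.
    exact: old_tl.
  (* For an outgoing arrow, the relation is alpha applied to the hook relations; it holds because
     the component along [b^*] lies in ker alpha. *)
  have [tq|tq] := eqVneq (tl q) k.
    pose b : outQ := exist _ q (introT eqP tq); rewrite -[q]/(val b).
    rewrite [X in _ + X]big1 ?addr0 => [|a _]; last first.
      by rewrite strip_cderiv ?ap0l //; apply/eqP; rewrite eq_sym hook_neq.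
    have stripE (c : oldQ) : strip (val c) (cderiv (val b) S) =
        \sum_(a : inQ) arr F (val a) * strip (val c) (hook_deriv b a).
      rewrite (cderiv_out lfQ potS S_hd) linear_sum; apply: eq_bigr => a _ /=.
      by rewrite strip_mul (strip_cderiv_mpow1 no2 potS S_hd b a) // scale0r addr0.
    under eq_bigr => c _ do rewrite stripE ap_suml.
    transitivity (\sum_(a : inQ) T (arr F (val a)) (- (Y (p_star_out b)).2 a)).
      rewrite exchange_big; apply: eq_bigr => a _; rewrite -hookE2 ap_sum.
      by apply: eq_bigr => c _; rewrite apM.
    have [_ _ Y3] := YP (p_star_out b).
    by under eq_bigr => a _ do rewrite apN; rewrite sumrN Y3 oppr0.
  pose c : oldQ := exist _ q (introT andP (conj hq tq)); rewrite -[q]/(val c).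
  rewrite -[RHS](oldE c) exchange_big; congr (_ + _); apply: eq_bigr => a _.
  rewrite ap_strip big1 ?add0r => [|i _]; last by rewrite strip_cderiv_old0 ?scale0r.
  rewrite (sum_arrows k lfQ) [X in X + _ + _]big1 => [|c' _]; last first.
    by rewrite (ap_arr_at (wk a)) ?ap0 ?old_tl.
  rewrite [X in _ + X + _]big1 => [|a' _]; last by rewrite (ap_arr_at (wk a)) ?ap0 ?in_tl.
  by rewrite !add0r; apply: eq_bigr => b _; rewrite wb.
have mq q : tl q != k -> T (arr F q) (off_vtx m) = Yh q.
  by move=> qk; rewrite /off_vtx apB ap_arr_vtx0 ?subr0 // eq_sym.
have mP : sub_set premut_sub (off_vtx m, n).
  split=> [|a|] /=; [by rewrite /off_vtx apB ap_vtx_vtx eqxx subrr | by rewrite ffunE Yin |].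
  exact: n_sum.
exists (to_sub mP) => q; apply: val_inj; rewrite premut_action_arr -/(Y q) [LHS]surjective_pairing.
case: q => [[c|[b a]]|[a|b]]; rewrite [RHS]/=.
- by rewrite (Y2 (p_old c)) ?old_hd // mq ?old_tl // YhO.
- by rewrite (Y2 (p_hook b a)) ?out_hd // mq ?in_tl // YhI wb.
- by rewrite (Y2 (p_star_in a)) ?in_tl // ffunE.
rewrite (Yk (p_star_out b)) //; congr (_, _); apply/ffunP => a; rewrite ffunE.
rewrite /off_vtx apB hook_deriv_hd0 ?subr0; last by rewrite eq_sym out_hd.
rewrite ap_strip1; last exact: strip_cderiv_mpow1.
under eq_bigr => q _ do rewrite -mE.
rewrite sumYh [X in _ + X]big1 ?addr0 => [|a' _]; last first.
  by rewrite [strip (val a') _]strip_strip0 ?ap0l //; apply/eqP; exact: hook_neq.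
by rewrite hookE2 opprK.
Qed.

End PremutationModule.

Section Subquotients.
Variables (F : fieldType) (W : lmodType F) (A B : submod W).

Lemma subquot_class_eq u v : sub_set A u -> sub_set A v ->
  subquot_class A B u = subquot_class A B v <-> sub_set B (u - v).
Proof.
move=> Au Av; rewrite /subquot_class mod_piE /= -[X in sub_set B X]/(val _ - val _).
by rewrite !insubdK //; exact/asboolP.
Qed.

Lemma subquot_repr_in c : sub_set A (subquot_repr (A := A) (B := B) c).
Proof. exact: sub_ofP. Qed.

Lemma subquot_reprK c : subquot_class A B (subquot_repr c) = c.
Proof. by rewrite /subquot_class /subquot_repr valKd; exact: mod_piK. Qed.

Lemma subquot_classP t u v : sub_set A u -> sub_set A v ->
  subquot_class A B (t *: u + v) = t *: subquot_class A B u + subquot_class A B v.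
Proof.
move=> Au Av; have [A0 AD] := submodP A.
rewrite /subquot_class; have -> : insubd (0 : sub_of A) (t *: u + v) =
    t *: insubd (0 : sub_of A) u + insubd (0 : sub_of A) v.
  by apply: val_inj; rewrite /= !insubdK //; apply/asboolP => //; apply: AD.
rewrite raddfD; congr (_ + _); exact: (esym (quot_scale_pi _ _ _)).
Qed.

Lemma subquot_class0 : subquot_class A B 0 = 0.
Proof.
rewrite /subquot_class; have -> : insubd (0 : sub_of A) 0 = 0; last exact: raddf0.
by apply: val_inj; rewrite insubdK //; apply/asboolP; case: (submodP A).
Qed.

Lemma subquot_trivial : (forall u, sub_set A u -> u = 0) -> dimension (subquot A B) = 0%N.
Proof.
move=> A0; have q0 (c : subquot A B) : c = 0.
  by rewrite -[c]subquot_reprK (A0 _ (subquot_repr_in c)) subquot_class0.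
have d0 n : has_dim (subquot A B) n -> n = 0%N.
  case=> f bf; case: n f bf => // n f bf.
  have /(bij_inj bf)/rowP/(_ ord0) : f (const_mx 1) = f 0 by rewrite [LHS]q0 [RHS]q0.
  by rewrite !mxE => /eqP; rewrite oner_eq0.
(* In both cases the value is 0, which is also the default of [dimension]. *)
rewrite /dimension; have [[n hn]|nh] := pselect (exists n, has_dim (subquot A B) n).
  by apply: d0; apply: (xgetI 0%N hn).
by apply: xgetPN => n hn; apply: nh; exists n.
Qed.

End Subquotients.

(** * The premutation space at [k] as ker alpha *)

Section PremutationSpace.
Variables (F : fieldType) (V : finType) (Q : quiver V) (S : cpalg F Q) (k : V).
Variables (I : lmodType (jacobian S)) (fin_I : finite_dim (vspace_of I)).
Local Notation M := (DecRep fin_I (fun=> 0%N)).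
Local Notation T := (act_action I).
Local Notation inQ := (in_arrow Q k).
Local Notation outQ := (out_arrow Q k).
Hypothesis lfQ : loop_free Q.
Hypothesis no2 : ~ in_2cycle Q k.
Hypothesis potS : potential S.
Hypothesis lft : lifts T S.
Local Notation hook_deriv b a := (strip (val b) (cderiv (val a) S)).

(** The extra summand of [cderiv2], where the hook closes up cyclically, is the last cut of
    [rcons s b]. If [b] cannot follow [s] both sides vanish, for empty [s] because a hook has
    distinct ends. *)
Lemma cderiv2_strip (b : outQ) (a : inQ) : cderiv2 (val b) (val a) S = hook_deriv b a.
Proof.
apply: wcoefP => v s; have [p|np] := boolP (is_path v s); last by rewrite !wcoef_out.
rewrite wcoef_strip !wcoef_of p is_path_rcons p /= size_rcons.
have [E|ne] := eqVneq (word_tl v s) (hd (val b)).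
  rewrite [RHS]big_ord_recr /= take_oversize ?size_rcons // drop_oversize ?size_rcons //.
  rewrite word_tl_rcons out_tl in_hd; congr (_ + _); apply: eq_bigr => i _.
  have le_i : (i <= size s)%N by rewrite -ltnS.
  rewrite -cats1 takel_cat // drop_cat; case: ltnP => [_|ge_i]; first by rewrite -catA.
  have -> : nat_of_ord i = size s by apply/eqP; rewrite eqn_leq le_i.
  by rewrite subnn /= drop_size.
rewrite big1 ?add0r => [|i _].
  apply: wcoef_out; apply/negP => /andP[_ p2].
  have : is_path (tl (val a)) (rcons s (val b)) by [].
  rewrite is_path_rcons => /andP[_ /eqP].
  case: s p ne {p2} => [|c s] p ne E; first by case/eqP: (hook_neq no2 b a).
  by case/eqP: ne.
apply: wcoef_out; rewrite is_path_cat negb_and -word_tl_cat cat_take_drop /= eq_sym.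
by rewrite (negPf ne) orbT.
Qed.

Lemma gammaE (y : {ffun outQ -> vspace_of I}) (a : inQ) :
  gamma (M := M) y a = \sum_(b : outQ) T (hook_deriv b a) (y b).
Proof. by rewrite ffunE; apply: eq_bigr => b _; rewrite cderiv2_strip. Qed.

Lemma ker_alphaP (z : {ffun inQ -> vspace_of I}) : sub_set (ker_alpha k M) z <->
  and (forall a : inQ, T (vtx F Q (tl (val a))) (z a) = z a)
      (\sum_(a : inQ) T (arr F (val a)) (z a) = 0).
Proof. by []. Qed.

Lemma gamma_beta m : gamma (M := M) (beta k (M := M) m) = 0.
Proof.
apply/ffunP => a; rewrite gammaE [RHS]ffunE.
rewrite -[RHS](sum_out_hook lfQ potS (@act_kills F V Q S I) a m).
by apply: eq_bigr => b _; rewrite ffunE.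
Qed.

(** Extend [y] by 0 to all arrows: the relations of [lifts] along incoming arrows say that gamma
    kills [y], and the others are trivial. *)
Lemma ker_gamma y : sub_set (M_out k M) y -> gamma (M := M) y = 0 -> sub_set (im_beta k M) y.
Proof.
move=> yM y0; pose y' (q : Q) : vspace_of I := if insub q is Some b then y (b : outQ) else 0.
have y'E (b : outQ) : y' (val b) = y b by rewrite /y' valK.
have y'0 q : tl q != k -> y' q = 0 by move=> qk; rewrite /y' insubN.
have [q|a'|m mE] := @lft y'.
- by rewrite /y'; case: insubP => [b _ <-|_]; [exact: yM | exact: (ap0 T)].
- have [ak|ak] := eqVneq (hd a') k; last first.
    rewrite big1 // => q _; have [qk|qk] := eqVneq (tl q) k; last by rewrite y'0 ?ap0.
    by rewrite strip_cderiv ?ap0l // qk; apply/eqP; rewrite eq_sym.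
  rewrite (sum_arrows k lfQ) [X in X + _ + _]big1 => [|c _]; last by rewrite y'0 ?ap0 ?old_tl.
  rewrite [X in _ + X + _]big1 => [|c _]; last by rewrite y'0 ?ap0 ?in_tl.
  rewrite !add0r; have /ffunP/(_ (exist _ a' (introT eqP ak))) := y0.
  rewrite gammaE [RHS]ffunE => E; rewrite -[RHS]E.
  by apply: eq_bigr => b _; rewrite y'E.
exists (T (vtx F Q k) m).
  by rewrite /= -[LHS](apM T) vtx_mul eqxx scale1r.
apply/ffunP => b; rewrite ffunE -y'E mE.
by apply: (ap_arr_tl T); exact: out_tl.
Qed.

Section PremutationIn.
Variable sigma : {linear alpha_gamma k M -> {ffun inQ -> vspace_of I}}.
Hypothesis sigmaP : is_section sigma.
Local Notation Th := (premut_in sigma).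

(** Representatives of a class differ by an element of im beta, which gamma kills; the choice made
    in [premut_in] is therefore immaterial. *)
Lemma gamma_repr u : sub_set (M_out k M) u ->
  gamma (M := M) (subquot_repr (subquot_class (M_out k M) (im_beta k M) u)) = gamma (M := M) u.
Proof.
move=> uM; set c := subquot_class _ _ u.
have : subquot_class (M_out k M) (im_beta k M) (subquot_repr c) = subquot_class (M_out k M) (im_beta k M) u.
  exact: subquot_reprK.
move/(subquot_class_eq _ (subquot_repr_in c) uM) => -[m _ mE].
by apply/eqP; rewrite -subr_eq0 -linearB /= -mE gamma_beta.
Qed.

Lemma premut_in_linear : linear Th.
Proof.
move=> c [[x1 x2] x3] [[y1 y2] y3]; rewrite /premut_in scalerDr addrACA.
congr (_ + _); last exact: linearP.
transitivity (gamma (M := M) (c *: subquot_repr x1 + subquot_repr y1)); last exact: linearP.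
rewrite -[RHS]gamma_repr; last first.
  by case: (submodP (M_out k M)) => _ MD; apply: MD; exact: subquot_repr_in.
congr (gamma (subquot_repr _)).
by rewrite subquot_classP ?subquot_reprK //; exact: subquot_repr_in.
Qed.

Lemma premut_in_class u h w : sub_set (M_out k M) u ->
  Th (subquot_class (M_out k M) (im_beta k M) u, h, w) = gamma (M := M) u + sigma h.
Proof. by move=> uM; rewrite /premut_in /= gamma_repr. Qed.

(** If gamma u + sigma h = 0, the class [h] is that of an element of im gamma, so it is 0; then [u]
    lies in ker gamma, which is contained in im beta. *)
Lemma premut_in_inj : injective Th.
Proof.
pose f : {linear premut_space k M -> {ffun inQ -> vspace_of I}} :=
  HB.pack Th (GRing.isLinear.Build F _ {ffun inQ -> vspace_of I} _ Th premut_in_linear).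
apply: (ker0_inj (h := f)) => -[[c h] w] /=; rewrite /premut_in /= => E.
have uM := subquot_repr_in c.
set u := subquot_repr c in E uM.
have [sk sh] := sigmaP h.
have h0 : h = 0.
  rewrite -sh -(subquot_class0 (ker_alpha k M) (im_gamma k M)).
  apply/subquot_class_eq => //; first by case: (submodP (ker_alpha k M)).
  exists (- u); first by rewrite -scaleN1r -[_ *: _]addr0; case: (submodP (M_out k M)) => M0 MD; apply: MD.
  by rewrite subr0 linearN; apply/eqP; rewrite eq_sym -addr_eq0 addrC; apply/eqP.
have g0 : gamma (M := M) u = 0 by move: E; rewrite h0 linear0 addr0.
have c0 : c = 0.
  rewrite -(subquot_reprK c) -(subquot_class0 (M_out k M) (im_beta k M)).
  apply/subquot_class_eq => //; first by case: (submodP (M_out k M)).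
  by rewrite subr0; apply: ker_gamma.
(* The decoration is 0, so [w] is a row vector of length 0. *)
have -> : w = 0 by apply/rowP => -[].
by rewrite h0 c0.
Qed.

(** [z] differs from the section of its own class by an element of im gamma. *)
Lemma premut_in_surj z : sub_set (ker_alpha k M) z -> exists p, Th p = z.
Proof.
move=> za; pose h := subquot_class (ker_alpha k M) (im_gamma k M) z.
have [sk sh] := sigmaP h.
have /(subquot_class_eq _ za sk)[u uM uE] : h = subquot_class (ker_alpha k M) (im_gamma k M) (sigma h).
  by rewrite sh.
exists (subquot_class (M_out k M) (im_beta k M) u, h, 0); rewrite premut_in_class //.
by rewrite uE subrK.
Qed.

Lemma premut_in_out (b : outQ) m : T (vtx F Q (hd (val b))) m = m ->
  Th (premut_out (M := M) b m) = [ffun a : inQ => - T (hook_deriv b a) m].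
Proof.
move=> bm; have mM : sub_set (M_out k M) [ffun b' : outQ => if b' == b then m else 0].
  move=> b'; rewrite ffunE; case: eqP => [->|_]; [exact: bm | exact: (ap0 T)].
rewrite /premut_out; set c := subquot_class _ _ _.
have -> : (- c, 0, 0) = (-1) *: (c, 0, 0) :> premut_space k M.
  by congr (_, _, _); rewrite /= ?scaler0 ?scaleN1r.
pose f : {linear premut_space k M -> {ffun inQ -> vspace_of I}} :=
  HB.pack Th (GRing.isLinear.Build F _ {ffun inQ -> vspace_of I} _ Th premut_in_linear).
rewrite -[LHS]/(f _) linearZ /= premut_in_class // linear0 addr0 scaleN1r.
apply/ffunP => a; rewrite [LHS]ffunE gammaE [RHS]ffunE; congr (- _).
rewrite (bigD1 b) //= ffunE eqxx big1 ?addr0 // => b' /negPf b'b.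
by rewrite ffunE b'b; exact: (ap0 T).
Qed.

End PremutationIn.
End PremutationSpace.

(** * Passage to the mutation *)

Section Transfer.
Variables (A B : pzRingType) (r : {rmorphism A -> B}).
Hypothesis bijr : bijective r.

(** An extension problem over [A] becomes one over [B] along the inverse of [r]. *)
Lemma restr_injective (I : lmodType B) : injective_module I -> injective_module (restr r I).
Proof.
have [g rK gK] := bijr.
have gB : zmod_morphism g by apply: can2_zmod_morphism.
have gM : monoid_morphism g by apply: can2_monoid_morphism.
pose G : {rmorphism B -> A} := HB.pack g (GRing.isZmodMorphism.Build _ _ g gB)
  (GRing.isMonoidMorphism.Build _ _ g gM).
move=> injI X Y i h ii.
have il : linear (i : restr G X -> restr G Y).
  by move=> b x y; apply: (linearP i).
have hl : linear (h : restr G X -> I).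
  move=> b x y; rewrite -[LHS]/(h (g b *: (x : X) + y)) linearP; congr (_ + _).
  by rewrite -[LHS]/(r (g b) *: (h x : I)) gK.
pose i' : {linear restr G X -> restr G Y} :=
  HB.pack (i : restr G X -> restr G Y) (GRing.isLinear.Build B _ _ _ _ il).
pose h' : {linear restr G X -> I} :=
  HB.pack (h : restr G X -> I) (GRing.isLinear.Build B _ _ _ _ hl).
have [k kE] := injI _ _ i' h' ii.
have kl : linear (k : Y -> restr r I).
  move=> a x y; rewrite -[RHS]/(r a *: k x + k y) -linearP; congr (k _).
  by rewrite -[in LHS](rK a).
by exists (HB.pack (k : Y -> restr r I) (GRing.isLinear.Build A _ _ _ _ kl) : {linear Y -> restr r I}).
Qed.

Lemma restr_envelope (E I : lmodType B) :
  injective_envelope E I -> injective_envelope (restr r E) (restr r I).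
Proof.
case=> injI [i [ii ess]]; split; first exact: restr_injective.
have il : linear (i : restr r E -> restr r I) by move=> a x y; apply: (linearP i).
exists (HB.pack (i : restr r E -> restr r I) (GRing.isLinear.Build A _ _ _ _ il)
  : {linear restr r E -> restr r I}); split=> // P [P0 PD].
have [g rK gK] := bijr.
by apply: ess; split=> // b x y Px Py; rewrite -(gK b); apply: PD.
Qed.

End Transfer.

Section InjectiveMutation.
Variables (F : fieldType) (V : finType).

(** This is what keeps the simple at [l] the simple at [l] under restriction of scalars. *)
Lemma wcoef_nil_linear (Q Q' : quiver V) (f : {linear cpalg F Q -> cpalg F Q'}) x v :
  filtered_hom f -> wcoef (f x) v [::] = wcoef x v [::].
Proof.
move=> [_ _ fv fm]; pose z := \sum_i wcoef x i [::] *: vtx F Q i.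
have xz : mpow 1 (x - z).
  move=> u [|//] _; rewrite wcoefB wcoef_sum (bigD1 u) //= big1 => [|i /negPf iu].
    by rewrite wcoefZ wcoef_vtx eqxx mulr1 addr0 subrr.
  by rewrite wcoefZ wcoef_vtx eq_sym iu mulr0.
rewrite -[x in LHS](subrK z) linearD wcoefD (fm _ _ xz) // add0r.
rewrite linear_sum wcoef_sum (bigD1 v) //= big1 => [|i /negPf iv].
  by rewrite linearZ /= fv wcoefZ wcoef_vtx eqxx mulr1 addr0.
by rewrite linearZ /= fv wcoefZ wcoef_vtx eq_sym iv mulr0.
Qed.

Lemma linear_const (Q Q' : quiver V) (f : {linear cpalg F Q -> cpalg F Q'}) c :
  filtered_hom f -> f (cp_const Q c) = cp_const Q' c.
Proof.
move=> fh; rewrite /cp_const linearZ -(sum_vtx F Q) linear_sum -(sum_vtx F Q').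
by congr (_ *: _); apply: eq_bigr => i _; apply: (fh_vtx fh).
Qed.

Lemma restr_indec_injective (Q Q' : quiver V) (U : cpalg F Q) (W : cpalg F Q') l
    (psi : cpalg F Q -> cpalg F Q') (r : {rmorphism jacobian U -> jacobian W})
    (I : lmodType (jacobian W)) :
  filtered_hom psi -> bijective r -> (forall y, r (jac U y) = jac W (psi y)) ->
  indec_injective l I -> indec_injective l (restr r I).
Proof.
move=> psih bijr rE [E [f bf fE] envE].
have [psil psiM psiv psim] := psih.
exists (restr r E); last exact: restr_envelope.
pose g : {linear cpalg F Q -> cpalg F Q'} :=
  HB.pack psi (GRing.isLinear.Build F _ _ _ psi psil).
have psic c : psi (cp_const Q c) = cp_const Q' c.
  exact: (@linear_const _ _ g).
have fl : linear (f : vspace_of (restr r E) -> F^o).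
  move=> c m n; rewrite -linearP; congr (f (_ + _)).
  by rewrite -[LHS]/(r (jac U (cp_const Q c)) *: (m : E)) rE psic.
exists (HB.pack (f : vspace_of (restr r E) -> F^o) (GRing.isLinear.Build F _ F^o _ _ fl)
  : {linear vspace_of (restr r E) -> F^o}) => //= x e.
rewrite -(@wcoef_nil_linear _ _ g x l psih) -fE; congr (f _).
by rewrite -[LHS]/(r (jac U x) *: (e : E)) rE.
Qed.

Lemma linear_inverse (U W : lmodType F) (h : {linear U -> W}) : bijective h ->
  exists g : {linear W -> U}, cancel h g /\ cancel g h.
Proof.
move=> bh; have [g hK gK] := bh; have gl : linear g.
  by move=> c x y; apply: (bij_inj bh); rewrite linearP !gK.
by exists (HB.pack g (GRing.isLinear.Build F W U _ g gl) : {linear W -> U}).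
Qed.

Lemma wcoef_normal (Q : quiver V) (S : cpalg F Q) k :
  (forall p, coef S p != 0 -> path_hd p <> k) -> forall s, wcoef S k s = 0.
Proof.
move=> nS s; have [p|np] := boolP (is_path k s); last exact: wcoef_out.
by rewrite (wcoefE _ p); apply/eqP; apply: contraT => /nS.
Qed.

(** The model [premut_action] is compared with the envelope over the mutation by [envelope_iso], and
    with the premutation space of the definition through [premut_in]. *)
Theorem injective_mutation (Q : quiver V)
    (S : cpalg F Q) (k l : V)
    (QP_S : is_QP S) (neq_kl : k <> l) (no_2cycle : ~ in_2cycle Q k)
    (mu : QPmutation k S)
    (I : lmodType (jacobian S)) (inj_I : indec_injective l I)
    (I' : lmodType (jacobian (mu_pot mu))) (inj_I' : indec_injective l I')
    (fin_I : finite_dim (vspace_of I)) :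
  exists fin_I' : finite_dim (vspace_of I'),
    forall sigma : {linear alpha_gamma k (DecRep fin_I (fun=> 0%N)) ->
                     {ffun in_arrow Q k -> vspace_of I}},
      is_section sigma ->
      exists2 N : decrep (mu_pot mu),
        is_mutation sigma N & decrep_iso N (DecRep fin_I' (fun=> 0%N)).
Proof.
have [lfQ potS] := QP_S.
set S0 := mu_norm mu; pose T := act_action I.
have pot0 : potential S0 := @mu_norm_potential F V Q k S mu.
have S0_hd : forall s, wcoef S0 k s = 0 := wcoef_normal (@mu_norm_hd F V Q k S mu).
(* [I] thus satisfies the same relations and lifting property for the normalised potential. *)
have dS a : cderiv a S = cderiv a S0.
  by apply: cderiv_cyc_equiv => //; exact: (mu_norm_equiv mu).
have [d nilT] : exists d, forall m, nil T d m.
  by have [d hd] := fin_I; exists d => m; apply: has_dim_nil.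
have killT : kills T S0.
  move=> m x /(jac_sub (jac_closed S)) Jx; apply: (@act_kills F V Q S I).
  by apply: Jx => a; rewrite -dS; apply: cderiv_jac.
have [s [soc _ _]] := envelope_socle inj_I.
have lft := envelope_lifts lfQ potS nilT inj_I.
have lft0 : lifts T S0 by move=> y yv yS; apply: lft => // a; rewrite dS.
have kl : k != l by apply/eqP.
pose TN := premut_action lfQ no_2cycle pot0 S0_hd nilT killT.
have [sN socN] := premut_action_socle lfQ no_2cycle pot0 S0_hd nilT killT kl soc.
have lftN : lifts TN (premut_pot k S0) by apply: (premut_action_lifts kl soc lft0).
have killN := premut_action_kills lfQ no_2cycle pot0 S0_hd nilT killT.
have finN := premut_finite_dim k T fin_I.
have nilN := premut_action_nil lfQ no_2cycle pot0 S0_hd nilT killT.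
have lfP : loop_free (premut_quiver Q k) by exact: premut_loop_free.
have potP : potential (premut_pot k S0) by exact: premut_potential.
have [r bijr rE] := reduction_iso lfP potP (mu_QP mu) (mu_trivial_is_QP mu)
  (mu_trivial mu) (mu_right_equivalence mu).
pose psi := @sum_proj F V (mu_quiver mu) (mu_trivial_quiver mu) \o mu_phi mu.
have psih : filtered_hom psi.
  have [_ phiZ phiv _ _] := mu_right_equivalence mu.
  apply: loop_free_filtered_hom => // [c x y|x y|i]; rewrite /psi /=.
  - by rewrite rmorphD phiZ linearP.
  - by rewrite !rmorphM.
  by rewrite phiv proj_vtx.
pose I2 : lmodType (jacobian (premut_pot k S0)) := restr r I'.
have inj_I2 : indec_injective l I2 by apply: (restr_indec_injective psih bijr).
have [h bijh hE] := envelope_iso lfP potP finN nilN killN socN lftN inj_I2.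
have [g [hK gK]] := linear_inverse bijh.
(* The envelope embeds by [g] in the finite-dimensional model. *)
have fin_I2 : finite_dim (vspace_of I2) by apply: (finite_dim_inj_lin (can_inj gK)).
have psil : linear psi by exact: (fh_linear psih).
have psic c : psi (cp_const (premut_quiver Q k) c) = cp_const (mu_quiver mu) c.
  by apply: (@linear_const _ _ (HB.pack psi (GRing.isLinear.Build F _ _ _ psi psil)
    : {linear cpalg F (premut_quiver Q k) -> cpalg F (mu_quiver mu)})).
have actE y (n : I') : @act F V _ _ I2 y n = @act F V _ _ I' (psi y) n.
  by rewrite -[LHS]/(r (jac _ y) *: n) rE.
have idl : linear (id : vspace_of I' -> vspace_of I2).
  move=> c m n; congr (_ + _).
  rewrite -[RHS]/(@act F V _ _ I2 (cp_const (premut_quiver Q k) c) m) actE psic.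
  by [].
pose idL : {linear vspace_of I' -> vspace_of I2} := HB.pack (id : vspace_of I' -> vspace_of I2)
  (GRing.isLinear.Build F (vspace_of I') (vspace_of I2) _ _ idl).
have fin_I' : finite_dim (vspace_of I').
  by apply: (@finite_dim_inj_lin _ _ _ idL) fin_I2 => m n.
exists fin_I' => sigma sigmaP.
(* The mutation is realised by [I'] itself and the premutation by its restriction [I2], so the
   required isomorphism is the identity. *)
exists (DecRep fin_I' (fun=> 0%N)); last first.
  by split=> //; exists idfun; exists idfun.
exists (DecRep fin_I2 (fun=> 0%N)); last first.
  split=> //; exists idL; first by exists id.
  move=> x y n xy; rewrite -[RHS]/(@act F V _ _ I2 y n) actE.
  by have -> : psi y = x by rewrite /psi /= xy sum_inlK.
pose M := DecRep fin_I (fun=> 0%N).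
have gact x n : g (@act F V _ _ I2 x n) = TN x (g n).
  by apply: (can_inj hK); rewrite hE !gK.
have vtxE i n : val (TN (vtx F _ i) n) = pm_vtx T i (val n) by exact: premut_action_vtx.
have arrE q n : val (TN (arr F q) n) = pm_arr S0 T q (val n) by exact: premut_action_arr.
have gvtx i n : @act F V _ _ I2 (vtx F _ i) n = n -> pm_vtx T i (val (g n)) = val (g n).
  by move=> ni; rewrite -vtxE -gact ni.
have hvtx i nu : pm_vtx T i (val nu) = val nu -> @act F V _ _ I2 (vtx F _ i) (h nu) = h nu.
  by move=> nui; rewrite -hE; congr (h _); apply: val_inj; rewrite [LHS]vtxE.
have zP nu : sub_set (ker_alpha k M) (val (nu : sub_of (premut_sub k T))).2.
  by have [_ n2 n3] := sub_ofP nu.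
have thP n : exists p, premut_in sigma p = (val (g n)).2.
  exact: (premut_in_surj lfQ no_2cycle potS sigmaP (zP (g n))).
(* The preimage under [premut_in] of the component in ker alpha; it is unique, which makes [G]
   linear. *)
pose G n := projT1 (cid (thP n)).
have GE n : premut_in sigma (G n) = (val (g n)).2 by rewrite /G; case: cid.
have thinj : injective (premut_in sigma) := premut_in_inj lfQ no_2cycle potS lft sigmaP.
have thlin : linear (premut_in sigma) := premut_in_linear lfQ no_2cycle potS sigma.
have Gl : linear (G : vspace_of I2 -> premut_space k M).
  by move=> c x y; apply: thinj; rewrite thlin !GE linearP.
pose f (n : vspace_of I2) : vspace_of I := (val (g n)).1.
have valP c x y : val (g (c *: x + y)) = c *: val (g x) + val (g y).
  by rewrite (linearP g).
have fl : linear f.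
  move=> c x y; rewrite /f valP.
  reflexivity.
have thP' p : sub_set (ker_alpha k M) (premut_in sigma p).
  have [K0 KD] := submodP (ker_alpha k M).
  have [sk _] := sigmaP p.1.2; rewrite /premut_in -[gamma _]scale1r; apply: KD => //.
  apply/ker_alphaP; split=> [a|].
    rewrite gammaE // ap_sum; apply: eq_bigr => b _; exact: hook_deriv_vtx.
  under eq_bigr => a _ do rewrite gammaE // ap_sum dS.
  rewrite exchange_big big1 // => b _.
  exact: (sum_in_hook lfQ pot0 S0_hd killT).
have elt_z z : sub_set (ker_alpha k M) z -> sub_set (premut_sub k T) (0, z).
  by case=> z1 z2; split=> //=; exact: (ap0 T).
split.
  (* ker beta is zero, so the new decoration at [k] is 0. *)
  move=> j; rewrite /premut_dec; case: ifP => // _; rewrite subquot_trivial // => m [mk bm].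
  apply: (ker_out0 kl soc mk) => b.
  by have /ffunP/(_ b) := bm; rewrite !ffunE.
exists (HB.pack f (GRing.isLinear.Build F _ _ _ f fl) : {linear vspace_of I2 -> vspace_of I}).
exists (HB.pack (G : vspace_of I2 -> premut_space k M) (GRing.isLinear.Build F _ _ _ (G : vspace_of I2 -> premut_space k M) Gl)
  : {linear vspace_of I2 -> premut_space k M}).
split; last split.
- move=> j jk; split.
  + move=> n /= /gvtx; rewrite pm_vtxN // => E; rewrite /f -[in RHS]E //.
  + move=> x y /set_mem /= /gvtx + /set_mem /= /gvtx; rewrite !pm_vtxN // => Ex Ey fxy.
    apply: (can_inj gK); apply: val_inj; rewrite -Ex -Ey; congr (_, _).
    by congr (T _ _); exact: fxy.
  + move=> m /= mj; have mP : sub_set (premut_sub k T) (m, 0).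
      split=> /= [|a|].
      * by rewrite -mj [LHS](ap_vtx_vtx T) eq_sym (negPf jk).
      * by rewrite ffunE; exact: (ap0 T).
      by rewrite big1 // => a _; rewrite ffunE; exact: (ap0 T).
    exists (h (to_sub mP)); last by rewrite /= /f hK.
    by apply: hvtx; rewrite pm_vtxN //=; congr (_, _).
- split=> //.
  + move=> x y /set_mem /= /gvtx + /set_mem /= /gvtx; rewrite !pm_vtxk // => Ex Ey Gxy.
    apply: (can_inj gK); apply: val_inj; rewrite -Ex -Ey; congr (_, _).
    by rewrite -!GE; exact: (congr1 (premut_in sigma) Gxy).
  + move=> p _; exists (h (to_sub (elt_z _ (thP' p)))); last first.
      by apply: thinj; rewrite [LHS]GE hK.
    by apply: hvtx; rewrite pm_vtxk.
- by move=> c n _; rewrite /= /f gact arrE.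
- by move=> b a n _; rewrite /= /f gact arrE.
- by move=> a n _; rewrite /= GE /f gact arrE.
move=> b n nb; apply: thinj; rewrite [LHS]GE gact arrE /=.
rewrite (premut_in_out lfQ no_2cycle potS sigma (b := b)); last first.
  by have /= /gvtx := nb; rewrite pm_vtxN ?out_hd // => E; rewrite /f -[in RHS]E.
by apply/ffunP => a; rewrite !ffunE dS.
Qed.

End InjectiveMutation.

Theorem corollary3p2 (R : realType) (V : finType) (Q : quiver V)
    (S : cpalg (complex R) Q) (k l : V)
    (QP_S : is_QP S) (neq_kl : k <> l) (no_2cycle : ~ in_2cycle Q k)
    (mu : QPmutation k S)
    (I : lmodType (jacobian S)) (inj_I : indec_injective l I)
    (I' : lmodType (jacobian (mu_pot mu))) (inj_I' : indec_injective l I')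
    (fin_I : finite_dim (vspace_of I)) :
  exists fin_I' : finite_dim (vspace_of I'),
    forall sigma : {linear alpha_gamma k (DecRep fin_I (fun=> 0%N)) ->
                     {ffun in_arrow Q k -> vspace_of I}},
      is_section sigma ->
      exists2 N : decrep (mu_pot mu),
        is_mutation sigma N & decrep_iso N (DecRep fin_I' (fun=> 0%N)).
Proof. exact: injective_mutation QP_S neq_kl no_2cycle mu I inj_I I' inj_I' fin_I. Qed.
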